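(* Let $G$ be a locally compact group and let $(\Phi,\Psi)$ be a complementary pair of Young functions satisfying the $\Delta_2$-condition. Let $\mathrm{B}$ be any one of the commutative Banach algebras $A_\Phi(G)$, $W_\Phi(G)$, $B_\Phi(G)$. Then a subset $M\subseteq\mathrm{B}$ is a minimal ideal of $\mathrm{B}$ if and only if $G$ is discrete and $M=\mathbb{C}\,\chi_{\{x\}}$ for some $x\in G$; and minimal ideals exist in $\mathrm{B}$ if and only if $G$ is discrete.
   Context: Young functions. A Young function is a convex, symmetric function $\Phi:\mathbb{R}\to[0,\infty]$ with $\Phi(0)=0$ and $\lim_{t\to\infty}\Phi(t)=+\infty$; its complementary function is $\Psi(s)=\sup\{t|s|-\Phi(t):t\ge 0\}$. $\Phi\in\Delta_2$ means there are $c>0$, $t_0>0$ with $\Phi(2t)\le c\,\Phi(t)$ for all $t\ge t_0$ if $G$ is compact, and the same inequality with $t_0=0$ if $G$ is non-compact. The pair $(\Phi,\Psi)$ satisfies the $\Delta_2$-condition if both $\Phi$ and $\Psi$ do. $dt$ is a fixed left Haar measure on $G$. Orlicz spaces. $L^\Phi(G)$ is the space of measurable $f:G\to\mathbb{C}$ with $\int_G\Phi(\alpha|f|)\,dt<\infty$ for some $\alpha>0$, with Luxemburg norm $N_\Phi(f)=\inf\{a>0:\int_G\Phi(|f|/a)\,dt\le 1\}$; $L^\Psi(G)$ carries the (equivalent to $N_\Psi$) Orlicz norm $\|g\|_\Psi=\sup\{\int_G|fg|\,dt:\int_G\Phi(|f|)\,dt\le1\}$. $A_\Phi(G)$ is the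 set of continuous functions $u=\sum_n f_n*\check g_n$ with $f_n\in L^\Phi(G)$, $g_n\in L^\Psi(G)$, $\sum_n N_\Phi(f_n)\|g_n\|_\Psi<\infty$, where $\check g(t)=g(t^{-1})$, normed by the infimum of $\sum_n N_\Phi(f_n)\|g_n\|_\Psi$ over all such representations; it is a commutative Banach algebra under pointwise operations. $PF_\Psi(G)$ is the operator-norm closure, in the bounded operators on $L^\Psi(G)$, of $\{T_f:f\in L^1(G)\}$, where $T_f(g)=f*g$. $W_\Phi(G)$ is the dual of $PF_\Psi(G)$, regarded as an algebra of continuous functions $w$ on $G$ via $\langle w,T_f\rangle=\int_G f w\,dt$ ($f\in L^1(G)$); it is a commutative Banach algebra under pointwise multiplication containing $A_\Phi(G)$. $B_\Phi(G)$ is the algebra of continuous functions $u$ on $G$ with $uv\in A_\Phi(G)$ for all $v\in A_\Phi(G)$, with the operator norm of $v\mapsto uv$ on $A_\Phi(G)$ and pointwise operations. One has $A_\Phi(G)\subseteq W_\Phi(G)\subseteq B_\Phi(G)$. $\chi_{\{x\}}$ is the characteristic function of $\{x\}$. A minimal ideal is a non-zero ideal containing no ideals other than $\{0\}$ and itself. $\mathbb{C}\,b=\{kb:k\in\mathbb{C}\}$. *)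

(* Defs.v *)
From HB Require Import structures.
From mathcomp Require Import all_boot all_order all_algebra.
From mathcomp Require Import complex.
From mathcomp Require Import all_classical all_reals all_analysis.

Set Implicit Arguments.
Unset Strict Implicit.
Unset Printing Implicit Defensive.

Import Order.TTheory GRing.Theory Num.Theory.
Import numFieldNormedType.Exports.

Local Open Scope classical_set_scope.
Local Open Scope ring_scope.

(* MathComp-Analysis has topological groups only in additive notation.  The
   base point of a pointed type is needed by [g_sigma_algebraType]; it is
   unrelated to the group structure. *)
HB.mixin Record isTopologicalGroup G & PointedTopological G & Group G := {
  mulg_continuous : continuous (fun p : G * G => (p.1 * p.2)%g) ;
  invg_continuous : continuous (fun x : G => (x^-1)%g) ;
}.

#[short(type="topologicalGroupType")]
HB.structure Definition TopologicalGroup :=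
  {G of PointedTopological G & Group G & isTopologicalGroup G}.

Definition discrete_space (T : topologicalType) := forall A : set T, open A.

Section Haar.
Context {G : topologicalGroupType} {R : realType}.

Definition borel := g_sigma_algebraType (@open G).

(* A Radon measure is finite on compact sets, outer regular on Borel sets and
   inner regular on open sets; no sigma-finiteness is assumed. *)
Definition radon_measure (mu : {measure set borel -> \bar R}) :=
  [/\ forall K : set G, compact K -> (mu K < +oo)%E,
      forall A : set borel, measurable A ->
        mu A = ereal_inf [set mu U | U in [set U : set G | open U /\ A `<=` U]]
    & forall U : set G, open U ->
        mu U =
          ereal_sup [set mu K | K in [set K : set G | compact K /\ K `<=` U]]].

Definition left_haar_measure (mu : {measure set borel -> \bar R}) :=
  [/\ radon_measure mu, mu setT != 0%E
    & forall (x : G) (A : set borel), measurable A ->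
        mu [set (x * y)%g | y in A] = mu A].

End Haar.
Arguments borel : clear implicits.

Section Young.
Context {R : realType}.
Implicit Type Phi : R -> \bar R.

Definition young_function Phi :=
  [/\ forall t, (0 <= Phi t)%E,
      forall s t a : R, 0 <= a <= 1 ->
        (Phi (a * s + (1 - a) * t)%R
          <= a%:E * Phi s + (1 - a)%R%:E * Phi t)%E,
      forall t, Phi (- t) = Phi t,
      Phi 0 = 0%E
    & Phi t @[t --> +oo%R] --> +oo%E].

Definition complementary Phi (s : R) : \bar R :=
  ereal_sup [set ((t * `|s|)%R%:E - Phi t)%E | t in [set t | 0 <= t]].

Definition Delta2_from (t0 : R) Phi :=
  exists2 c : R, 0 < c & forall t, t0 <= t -> (Phi (2 * t)%R <= c%:E * Phi t)%E.

Definition Delta2 (G : topologicalType) Phi :=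
  (compact [set: G] -> exists2 t0 : R, 0 < t0 & Delta2_from t0 Phi) /\
  (~ compact [set: G] -> Delta2_from 0 Phi).

End Young.

Section OrliczSpaces.
Context {R : realType} {G : topologicalGroupType}.
Variable mu : {measure set (borel G) -> \bar R}.
Local Notation C := R[i].
Implicit Types (f g h : G -> C) (Phi Psi : R -> \bar R).

Definition cabs (z : C) : R := ComplexField.Normc.normc z.

Definition cmeasurable f :=
  measurable_fun [set: borel G] (fun t : borel G => complex.Re (f t)) /\
  measurable_fun [set: borel G] (fun t : borel G => complex.Im (f t)).

(* The value of [cintegral f] is meaningful when [cintegrable f] holds. *)
Definition cintegrable f :=
  cmeasurable f /\ (\int[mu]_t (cabs (f t))%:E < +oo)%E.

Definition cintegral f : C :=
  Complex (\int[mu]_t complex.Re (f t)) (\int[mu]_t complex.Im (f t)).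

Definition L1 : set (G -> C) := [set f | cintegrable f].

Definition modular Phi f : \bar R := (\int[mu]_t Phi (cabs (f t)))%E.

Definition LOrlicz Phi : set (G -> C) :=
  [set f | cmeasurable f /\ exists2 a : R, 0 < a &
    (\int[mu]_t Phi (a * cabs (f t))%R < +oo)%E].

Definition luxemburg_norm Phi f : \bar R :=
  ereal_inf [set a%:E | a in [set a : R |
    0 < a /\ (\int[mu]_t Phi (cabs (f t) / a)%R <= 1)%E]].

(* The Orlicz norm of [g] in L^Psi, as a function of the complementary [Phi]. *)
Definition orlicz_norm Phi g : \bar R :=
  ereal_sup [set (\int[mu]_t (cabs (f t * g t)%R)%:E)%E |
    f in [set f | cmeasurable f /\ (modular Phi f <= 1)%E]].

Definition check g : G -> C := fun t => g (t^-1)%g.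

Definition conv f h : G -> C :=
  fun t => cintegral (fun s => f s * h (s^-1 * t)%g).

End OrliczSpaces.

Section Algebras.
Context {R : realType} {G : topologicalGroupType}.
Variables (mu : {measure set (borel G) -> \bar R}) (Phi Psi : R -> \bar R).
Local Notation C := R[i].
Local Notation LPhi := (LOrlicz mu Phi).
Local Notation LPsi := (LOrlicz mu Psi).

Definition A_Phi : set (G -> C) := [set u |
  continuous (u : G -> C^o) /\
  exists f g : nat -> G -> C,
  [/\ forall n, LPhi (f n), forall n, LPsi (g n),
      (\sum_(0 <= n <oo)
         luxemburg_norm mu Phi (f n) * orlicz_norm mu Phi (g n) < +oo)%E
    & forall t, series (fun n => conv mu (f n) (check (g n)) t : C^o) @ \oo
                  --> (u t : C^o)]].

(* Elements of L^Psi are represented by functions, so that operators and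
   identities between their values are only meaningful almost everywhere. *)
Local Notation op := ((G -> C) -> (G -> C)).

Definition op_norm (S : op) : \bar R :=
  ereal_sup [set orlicz_norm mu Phi (S g) |
    g in [set g | LPsi g /\ (orlicz_norm mu Phi g <= 1)%E]].

Definition bounded_operator (S : op) :=
  [/\ forall g, LPsi g -> LPsi (S g),
      forall g h, LPsi g -> LPsi h ->
        {ae mu, forall t, g t = h t} -> {ae mu, forall t, S g t = S h t},
      forall (a : C) g h, LPsi g -> LPsi h ->
        {ae mu, forall t, S (fun s => a * g s + h s) t = a * S g t + S h t}
    & (op_norm S < +oo)%E].

Definition PF_Psi : set op := [set S | bounded_operator S /\
  forall e : R, 0 < e -> exists2 f, L1 mu f &
    (op_norm (fun g t => S g t - conv mu f g t)%R <= e%:E)%E].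

(* Bounded linear functionals on PF_Psi.  Boundedness makes them insensitive to
   the choice of representatives. *)
Definition PF_Psi_dual : set (op -> C) := [set F |
  (forall (a : C) (S T : op), PF_Psi S -> PF_Psi T ->
     F (fun g t => a * S g t + T g t) = a * F S + F T) /\
  exists c : R, forall S, PF_Psi S -> ((cabs (F S))%:E <= c%:E * op_norm S)%E].

Definition W_Phi : set (G -> C) := [set w |
  continuous (w : G -> C^o) /\
  exists2 F, PF_Psi_dual F & forall f, L1 mu f ->
    cintegrable mu (fun t => f t * w t) /\
    F (conv mu f) = cintegral mu (fun t => f t * w t)].

Definition B_Phi : set (G -> C) := [set u |
  continuous (u : G -> C^o) /\ forall v, A_Phi v -> A_Phi (fun t => u t * v t)].

End Algebras.

(* For an algebra B of functions under pointwise operations.  Ideals are the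
   algebraic ones, not assumed closed; the Banach norm of B plays no role. *)
Section Ideals.
Context {R : realType} {G : Type}.
Local Notation C := R[i].
Implicit Types B I M : set (G -> C).

Definition ideal B I :=
  [/\ I `<=` B, I (fun=> 0),
      forall u v, I u -> I v -> I (fun t => u t + v t),
      forall (k : C) u, I u -> I (fun t => k * u t)
    & forall b u, B b -> I u -> I (fun t => b t * u t)].

Definition zero_ideal : set (G -> C) := [set fun=> 0].

Definition minimal_ideal B M :=
  [/\ ideal B M, M != zero_ideal
    & forall I, ideal B I -> I `<=` M -> I = zero_ideal \/ I = M].

End Ideals.

Definition chi_line (R : realType) (G : Type) (x : G) : set (G -> R[i]) :=
  [set (fun t => k * \1_[set x] t) | k in [set: R[i]]].

(* Main.v *)
Require Import Defs.
From mathcomp Require Import all_boot all_order all_algebra.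
From mathcomp Require Import complex ring lra.
From mathcomp Require Import all_classical all_reals all_analysis.
From mathcomp Require Import measurable_realfun.

Set Implicit Arguments.
Unset Strict Implicit.
Unset Printing Implicit Defensive.

Import Order.TTheory GRing.Theory Num.Theory.
Import numFieldNormedType.Exports.

Local Open Scope classical_set_scope.
Local Open Scope ring_scope.

(** Let [u = conv f (check g)], that is [u t = \int f(s) g(t^-1 s) ds], with [f] and
[g] continuous of compact support.  The theorem follows from the fact that such
functions belong to each of the three algebras.  Indeed, with [f] and [g] bump functions,
[u] can be made nonzero at a given point and zero outside a given neighbourhood of it
([Cc_conv_separates]).  Hence each of the algebras, whose members are continuous, separates
points, and contains the characteristic functions of points when [G] is discrete.
These properties alone determine the minimal ideals ([minimal_ideals_of]): by separation,
all elements of a minimal ideal are supported at one common point [x], and continuity of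
a nonzero one makes [x] isolated.

The function [u] lies in [A_Phi] as a series with one term.  It lies in [W_Phi] because
it represents the functional [S |-> \int f * S g], after an exchange of two integrals
([fubini_Cc]).

To see that [u] lies in [B_Phi], it must be shown that [u * conv h (check k)] has a series
representation whose norm is bounded by a constant times the product of the norms of [h]
and [k], uniformly in [h] and [k].  Putting [s' = t^-1 s], so that [u t = u (s s'^-1)], this
multiplies the tensor [h(s) k(s')] by the kernel [u (s s'^-1)].  For [s] in a fixed compact set
[D], this kernel is an absolutely convergent series of rank-one kernels [a(s) b(s')]
([kernel_expansion]).  If [h] has compact support, the support is partitioned into pieces
[E_i] with [E_i y_i] contained in [D].  As [s s'^-1] is invariant under right translation, the
expansion on [D] serves on each piece, and its second factors, moved to the pieces,
overlap at most [M] times, where [M] is independent of the support because the [y_i] can be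
taken separated ([packing_count]).  The first factors do not overlap at all.  Finally, a sum of
tensors [h a_i (x) k b_i] in which the [a_i] and the [b_i] have bounded overlap is an average,
over choices of signs, of single tensors [h a (x) k b] with [a] and [b] bounded
([Rep_signs]); as both norms are lattice norms, its norm is controlled by those of [h] and
[k].  A general [h] is a series of compactly supported functions with norms adding up to little more
than that of [h]: for non-compact [G] this follows from the growth condition on [Phi]
([Nphi_tight]), while for compact [G] every [h] is itself compactly supported. *)

(** * Complex modulus and complex integrals *)

Section ComplexModulus.
Context {R : realType}.
Local Notation C := R[i].
Implicit Types z w : C.

Lemma normC_cabs z : `|z| = (cabs z)%:C%C.
Proof. by case: z. Qed.

Lemma cabs_ge0 z : 0 <= cabs z.
Proof. by case: z => a b; apply: sqrtr_ge0. Qed.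

Lemma cabs0 : cabs (0 : C) = 0.
Proof. exact: ComplexField.Normc.normc0. Qed.

Lemma cabs1 : cabs (1 : C) = 1.
Proof. exact: ComplexField.Normc.normc1. Qed.

Lemma cabs0_eq0 z : cabs z = 0 -> z = 0.
Proof. exact: ComplexField.Normc.eq0_normc. Qed.

Lemma cabsM z w : cabs (z * w) = cabs z * cabs w.
Proof. exact: ComplexField.Normc.normcM. Qed.

Lemma ler_cabsD z w : cabs (z + w) <= cabs z + cabs w.
Proof. exact: (@le_normcD R z w). Qed.

Lemma cabsN z : cabs (- z) = cabs z.
Proof. exact: (@normcN R z). Qed.

Lemma cabsB z w : cabs (z - w) = cabs (w - z).
Proof. by rewrite -cabsN opprB. Qed.

Lemma ler_cabsB z w : cabs (z - w) <= cabs z + cabs w.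
Proof. by rewrite -(cabsN w) ler_cabsD. Qed.

Lemma cabs_real (a : R) : cabs a%:C%C = `|a|.
Proof. by rewrite /cabs /= expr0n /= addr0 sqrtr_sqr. Qed.

Lemma ler_Re_cabs z : `|complex.Re z| <= cabs z.
Proof.
case: z => a b /=; rewrite -sqrtr_sqr ler_sqrt ?addr_ge0 ?sqr_ge0//.
by rewrite lerDl sqr_ge0.
Qed.

Lemma ler_Im_cabs z : `|complex.Im z| <= cabs z.
Proof.
case: z => a b /=; rewrite -sqrtr_sqr ler_sqrt ?addr_ge0 ?sqr_ge0//.
by rewrite lerDr sqr_ge0.
Qed.

Lemma ler_cabs_ReIm z : cabs z <= `|complex.Re z| + `|complex.Im z|.
Proof.
case: z => a b /=; rewrite -(ger0_norm (addr_ge0 (normr_ge0 a) (normr_ge0 b))).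
rewrite -sqrtr_sqr ler_sqrt ?sqr_ge0// sqrrD !real_normK ?num_real// addrAC lerDl.
by rewrite mulrn_wge0// mulr_ge0.
Qed.

Lemma cabs_sum I (r : seq I) (P : pred I) (F : I -> C) :
  cabs (\sum_(i <- r | P i) F i) <= \sum_(i <- r | P i) cabs (F i).
Proof.
elim/big_rec2: _ => [|i x y _ h]; first by rewrite cabs0.
by apply: le_trans (ler_cabsD _ _) _; rewrite lerD2l.
Qed.

(** Translates continuity for the topology of [C^o], whose balls have radii in [C],
into real inequalities on the modulus. *)
Lemma cabs_continuousE (T : topologicalType) (u : T -> C) :
  continuous (u : T -> C^o) <->
  forall x (e : R), 0 < e -> \forall t \near x, cabs (u t - u x) < e.
Proof.
split=> [cu x e e0|cu x].
  have e0' : 0 < e%:C%C :> C by rewrite ltcR.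
  have /cvgrPdist_lt /(_ _ e0') := cu x.
  by apply: filterS => t; rewrite normC_cabs ltcR cabsB.
apply/cvgrPdist_lt => e e0.
have e0' : e = (complex.Re e)%:C%C by rewrite RRe_real// gtr0_real.
move: e0; rewrite e0' ltcR => e0; near=> t.
by rewrite normC_cabs ltcR cabsB; near: t; apply: cu.
Unshelve. all: by end_near. Qed.

Lemma cabs_cvgE (v : nat -> C) (l : C) :
  (v : nat -> C^o) @ \oo --> (l : C^o) <->
  forall e : R, 0 < e -> \forall n \near \oo, cabs (v n - l) < e.
Proof.
split=> [cv e e0|cv].
  have e0' : 0 < e%:C%C :> C by rewrite ltcR.
  move/cvgrPdist_lt : cv => /(_ _ e0').
  by apply: filterS => t; rewrite normC_cabs ltcR cabsB.
apply/cvgrPdist_lt => e e0.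
have e0' : e = (complex.Re e)%:C%C by rewrite RRe_real// gtr0_real.
move: e0; rewrite e0' ltcR => e0; near=> t.
by rewrite normC_cabs ltcR cabsB; near: t; apply: cv.
Unshelve. all: by end_near. Qed.

End ComplexModulus.

Section ComplexIntegral.
Context {R : realType} {G : topologicalGroupType}.
Variable mu : {measure set (borel G) -> \bar R}.
Local Notation C := R[i].
Implicit Types (f g h : G -> C).

Definition norm1 f : \bar R := (\int[mu]_t (cabs (f t))%:E)%E.

Lemma eq_cmeasurable f g : f =1 g -> cmeasurable f -> cmeasurable g.
Proof. by move=> /funext ->. Qed.

Lemma cmeasurableD f g :
  cmeasurable f -> cmeasurable g -> cmeasurable (fun t => f t + g t).
Proof.
move=> [fr fi] [gr gi]; split.
  have -> : (fun t => complex.Re (f t + g t)) =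
      (fun t => complex.Re (f t) + complex.Re (g t)).
    by apply/funext => t; case: (f t) (g t) => [? ?] [? ?].
  exact: measurable_funD.
have -> : (fun t => complex.Im (f t + g t)) =
    (fun t => complex.Im (f t) + complex.Im (g t)).
  by apply/funext => t; case: (f t) (g t) => [? ?] [? ?].
exact: measurable_funD.
Qed.

Lemma cmeasurableM f g :
  cmeasurable f -> cmeasurable g -> cmeasurable (fun t => f t * g t).
Proof.
move=> [fr fi] [gr gi]; split.
  have -> : (fun t => complex.Re (f t * g t)) =
      (fun t => complex.Re (f t) * complex.Re (g t)
                - complex.Im (f t) * complex.Im (g t)).
    by apply/funext => t; case: (f t) (g t) => [? ?] [? ?].
  by apply: measurable_funB; apply: measurable_funM.
have -> : (fun t => complex.Im (f t * g t)) =
    (fun t => complex.Re (f t) * complex.Im (g t)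
              + complex.Im (f t) * complex.Re (g t)).
  by apply/funext => t; case: (f t) (g t) => [? ?] [? ?].
by apply: measurable_funD; apply: measurable_funM.
Qed.

Lemma cmeasurable_cst (z : C) : cmeasurable (fun _ : G => z).
Proof. by split; exact: measurable_cst. Qed.

Lemma cmeasurableZ (z : C) f : cmeasurable f -> cmeasurable (fun t => z * f t).
Proof. by move=> mf; apply: cmeasurableM => //; exact: cmeasurable_cst. Qed.

Lemma cmeasurableB f g :
  cmeasurable f -> cmeasurable g -> cmeasurable (fun t => f t - g t).
Proof.
move=> mf mg; apply: (@eq_cmeasurable (fun t => f t + -1 * g t)).
  by move=> t; rewrite mulN1r.
by apply: cmeasurableD => //; apply: cmeasurableZ.
Qed.

Lemma cmeasurable_cabs f : cmeasurable f ->
  measurable_fun [set: borel G] (fun t : borel G => cabs (f t)).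
Proof.
move=> [fr fi].
have -> : (fun t => cabs (f t)) =
    Num.sqrt \o (fun t => complex.Re (f t) ^+ 2 + complex.Im (f t) ^+ 2).
  by apply/funext => t /=; case: (f t).
apply: measurableT_comp; last by apply: measurable_funD; apply: measurable_funX.
by apply: continuous_measurable_fun; exact: sqrt_continuous.
Qed.

Lemma measurable_EFin_cabs f : cmeasurable f ->
  measurable_fun [set: borel G] (fun t : borel G => (cabs (f t))%:E).
Proof. by move=> mf; apply/measurable_EFinP; exact: cmeasurable_cabs. Qed.

Lemma norm1_ge0 f : (0 <= norm1 f)%E.
Proof. by apply: integral_ge0 => t _; rewrite lee_fin cabs_ge0. Qed.

Lemma norm1_le_dom f g (c : R) : cmeasurable f -> cmeasurable g -> 0 <= c ->
  (forall t, cabs (f t) <= c * cabs (g t)) -> (norm1 f <= c%:E * norm1 g)%E.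
Proof.
move=> mf mg c0 fg; rewrite /norm1 -ge0_integralZl_EFin//; first last.
- exact: measurable_EFin_cabs.
- by move=> t _; rewrite lee_fin cabs_ge0.
apply: ge0_le_integral => //.
- by move=> t _; rewrite lee_fin cabs_ge0.
- exact: measurable_EFin_cabs.
- apply: measurable_funeM; exact: measurable_EFin_cabs.
- by move=> t _; rewrite -EFinM lee_fin.
Qed.

Lemma norm1Z (z : C) f : cmeasurable f ->
  norm1 (fun t => z * f t) = ((cabs z)%:E * norm1 f)%E.
Proof.
move=> mf; rewrite /norm1 -ge0_integralZl_EFin ?cabs_ge0//; first last.
- exact: measurable_EFin_cabs.
- by move=> t _; rewrite lee_fin cabs_ge0.
by apply: eq_integral => t _; rewrite cabsM EFinM.
Qed.

Lemma norm1D f g : cmeasurable f -> cmeasurable g ->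
  (norm1 (fun t => f t + g t)%R <= norm1 f + norm1 g)%E.
Proof.
move=> mf mg; rewrite /norm1 -ge0_integralD//; first last.
- exact: measurable_EFin_cabs.
- by move=> t _; rewrite lee_fin cabs_ge0.
- exact: measurable_EFin_cabs.
- by move=> t _; rewrite lee_fin cabs_ge0.
apply: ge0_le_integral => //.
- by move=> t _; rewrite lee_fin cabs_ge0.
- by apply: measurable_EFin_cabs; exact: cmeasurableD.
- by apply: emeasurable_funD; exact: measurable_EFin_cabs.
- by move=> t _; rewrite -EFinD lee_fin ler_cabsD.
Qed.

Lemma cintegrableD f g : cintegrable mu f -> cintegrable mu g ->
  cintegrable mu (fun t => f t + g t).
Proof.
move=> [mf f1] [mg g1]; split; first exact: cmeasurableD.
by apply: le_lt_trans (norm1D mf mg) _; rewrite lte_add_pinfty.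
Qed.

Lemma cintegrableZ (z : C) f : cintegrable mu f ->
  cintegrable mu (fun t => z * f t).
Proof.
move=> [mf f1]; split; first exact: cmeasurableZ.
by rewrite -/(norm1 _) norm1Z// lte_mul_pinfty// lee_fin cabs_ge0.
Qed.

Lemma cintegrableB f g : cintegrable mu f -> cintegrable mu g ->
  cintegrable mu (fun t => f t - g t).
Proof.
move=> fi gi; have -> : (fun t => f t - g t) = (fun t => f t + -1 * g t).
  by apply/funext => t; rewrite mulN1r.
by apply: cintegrableD => //; apply: cintegrableZ.
Qed.

Lemma le_cintegrable f g (c : R) : cmeasurable f -> cintegrable mu g -> 0 <= c ->
  (forall t, cabs (f t) <= c * cabs (g t)) -> cintegrable mu f.
Proof.
move=> mf [mg g1] c0 fg; split=> //.
apply: le_lt_trans (norm1_le_dom mf mg c0 fg) _.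
by rewrite lte_mul_pinfty// lee_fin.
Qed.

Lemma cintegrable0 : cintegrable mu (fun=> 0).
Proof.
split; first exact: cmeasurable_cst.
by under eq_integral do rewrite cabs0; rewrite integral0.
Qed.

Lemma cintegrable_sum I (r : seq I) (F : I -> G -> C) :
  (forall i, cintegrable mu (F i)) ->
  cintegrable mu (fun t => \sum_(i <- r) F i t).
Proof.
move=> mF; elim: r => [|i r ih].
  have -> : (fun t => \sum_(i <- [::]) F i t) = (fun=> 0).
    by apply/funext => t; rewrite big_nil.
  exact: cintegrable0.
have -> : (fun t => \sum_(j <- i :: r) F j t) = (fun t => F i t + \sum_(j <- r) F j t).
  by apply/funext => t; rewrite big_cons.
exact: cintegrableD.
Qed.

Lemma integrable_Re f : cintegrable mu f ->
  mu.-integrable [set: borel G] (EFin \o (fun t => complex.Re (f t))).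
Proof.
move=> [[fr fi] f1]; apply/integrableP; split; first exact/measurable_EFinP.
apply: le_lt_trans f1; apply: ge0_le_integral => //.
- by apply: measurableT_comp => //; exact/measurable_EFinP.
- exact: measurable_EFin_cabs.
- by move=> t _ /=; rewrite lee_fin ler_Re_cabs.
Qed.

Lemma integrable_Im f : cintegrable mu f ->
  mu.-integrable [set: borel G] (EFin \o (fun t => complex.Im (f t))).
Proof.
move=> [[fr fi] f1]; apply/integrableP; split; first exact/measurable_EFinP.
apply: le_lt_trans f1; apply: ge0_le_integral => //.
- by apply: measurableT_comp => //; exact/measurable_EFinP.
- exact: measurable_EFin_cabs.
- by move=> t _ /=; rewrite lee_fin ler_Im_cabs.
Qed.

Lemma eq_cintegral f g : f =1 g -> cintegral mu f = cintegral mu g.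
Proof. by move=> /funext ->. Qed.

Lemma cintegralD f g : cintegrable mu f -> cintegrable mu g ->
  cintegral mu (fun t => f t + g t) = cintegral mu f + cintegral mu g.
Proof.
move=> fi gi; rewrite /cintegral; simpc; congr Complex.
  rewrite -RintegralD//; [|exact: integrable_Re|exact: integrable_Re].
  by apply: eq_Rintegral => t _; case: (f t) (g t) => [? ?] [? ?].
rewrite -RintegralD//; [|exact: integrable_Im|exact: integrable_Im].
by apply: eq_Rintegral => t _; case: (f t) (g t) => [? ?] [? ?].
Qed.

Lemma cintegralZ (z : C) f : cintegrable mu f ->
  cintegral mu (fun t => z * f t) = z * cintegral mu f.
Proof.
move=> fi; rewrite /cintegral; case: z => a b; simpc; congr Complex.
  rewrite -!RintegralZl//; [|exact: integrable_Im|exact: integrable_Re].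
  rewrite -RintegralB//.
  - by apply: eq_Rintegral => t _; case: (f t) => [? ?].
  - have /= := integrableZl measurableT a (integrable_Re fi).
    by apply: eq_integrable => // t _ /=; rewrite EFinM.
  - have /= := integrableZl measurableT b (integrable_Im fi).
    by apply: eq_integrable => // t _ /=; rewrite EFinM.
rewrite -!RintegralZl//; [|exact: integrable_Re|exact: integrable_Im].
rewrite -RintegralD//.
- by apply: eq_Rintegral => t _; case: (f t) => [? ?].
- have /= := integrableZl measurableT a (integrable_Im fi).
  by apply: eq_integrable => // t _ /=; rewrite EFinM.
- have /= := integrableZl measurableT b (integrable_Re fi).
  by apply: eq_integrable => // t _ /=; rewrite EFinM.
Qed.

Lemma cintegralB f g : cintegrable mu f -> cintegrable mu g ->
  cintegral mu (fun t => f t - g t) = cintegral mu f - cintegral mu g.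
Proof.
move=> fi gi; rewrite -(mulN1r (cintegral mu g)) -cintegralZ// -cintegralD//.
  by apply: eq_cintegral => t; rewrite mulN1r.
exact: cintegrableZ.
Qed.

Lemma cintegral0 : cintegral mu (fun=> 0) = 0.
Proof. by rewrite /cintegral /Rintegral /= integral0. Qed.

Lemma cintegral_sum I (r : seq I) (F : I -> G -> C) :
  (forall i, cintegrable mu (F i)) ->
  cintegral mu (fun t => \sum_(i <- r) F i t) =
  \sum_(i <- r) cintegral mu (F i).
Proof.
move=> mF; elim: r => [|i r ih].
  rewrite big_nil -[RHS]cintegral0; apply: eq_cintegral => t.
  by rewrite big_nil.
rewrite big_cons -ih -cintegralD//; last exact: cintegrable_sum.
by apply: eq_cintegral => t; rewrite big_cons.
Qed.

(** Bounding the real and the imaginary part separately loses a factor 2 against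
the optimal constant; all later uses are insensitive to it. *)
Lemma cabs_cintegral f : cintegrable mu f ->
  ((cabs (cintegral mu f))%:E <= 2%:E * norm1 f)%E.
Proof.
move=> fi; have [mf f1] := fi.
have f1fin : norm1 f \is a fin_num by rewrite ge0_fin_numE// norm1_ge0.
have H (p : C -> R) : (forall z, `|p z| <= cabs z) ->
    mu.-integrable [set: borel G] (EFin \o (fun t => p (f t))) ->
    `|(\int[mu]_t p (f t))%R| <= fine (norm1 f).
  move=> pz pint; apply: le_trans (le_normr_Rintegral _ pint) _ => //.
  rewrite /Rintegral fine_le//.
    by apply: integrable_fin_num => //; exact: integrable_norm.
  apply: ge0_le_integral => //.
  - by apply/measurable_EFinP; apply: measurableT_comp => //;
      apply/measurable_EFinP; case/integrableP : pint.
  - exact: measurable_EFin_cabs.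
  - by move=> t _; rewrite lee_fin pz.
have := H _ ler_Re_cabs (integrable_Re fi).
have := H _ ler_Im_cabs (integrable_Im fi).
move=> hi hr; rewrite -(fineK f1fin) -EFinM lee_fin.
apply: le_trans (ler_cabs_ReIm _) _ => /=; lra.
Qed.

Lemma cabs_cintegral_le f (c : R) : cintegrable mu f -> (norm1 f <= c%:E)%E ->
  cabs (cintegral mu f) <= 2 * c.
Proof.
move=> fi fc; rewrite -lee_fin EFinM; apply: le_trans (cabs_cintegral fi) _.
by apply: lee_pmul => //; rewrite ?norm1_ge0// lee_fin.
Qed.

End ComplexIntegral.

(** * Topological groups and compactly supported functions *)

Section TopologicalGroups.
Context {G : topologicalGroupType}.
Implicit Types (x y z : G) (K L W : set G).

Lemma continuous_mulg (T : topologicalType) (a b : T -> G) :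
  continuous a -> continuous b -> continuous (fun t => (a t * b t)%g).
Proof.
move=> ca cb t.
apply: (@continuous2_cvg _ _ _ _ _ _ a b (fun x y => (x * y)%g)) => //.
- exact: (mulg_continuous (a t, b t)).
- exact: ca.
- exact: cb.
Qed.

Lemma continuous_invg (T : topologicalType) (a : T -> G) :
  continuous a -> continuous (fun t => (a t)^-1%g).
Proof.
move=> ca t.
exact: (@continuous_comp _ _ _ a (fun x : G => x^-1%g) t (ca t) (invg_continuous (a t))).
Qed.

Lemma continuous_mulgl x : continuous (fun t : G => (x * t)%g).
Proof. by apply: continuous_mulg => t; [exact: cvg_cst|exact: cvg_id]. Qed.

Lemma continuous_mulgr x : continuous (fun t : G => (t * x)%g).
Proof. by apply: continuous_mulg => t; [exact: cvg_id|exact: cvg_cst]. Qed.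

Lemma continuous_invg_mulgr x : continuous (fun t : G => (t^-1 * x)%g).
Proof. by apply: continuous_mulg => t; [exact: invg_continuous|exact: cvg_cst]. Qed.

Lemma open_preimage_mulgl x (U : set G) :
  open U -> open [set t | U (x * t)%g].
Proof. by move=> oU; apply: (open_comp _ oU) => t _; exact: continuous_mulgl. Qed.

Lemma compact_mulgl x K : compact K -> compact [set t | K (x * t)%g].
Proof.
move=> cK; have -> : [set t | K (x * t)%g] = (fun t => (x^-1 * t)%g) @` K.
  apply/seteqP; split=> [t /= Kt|_ [t Kt <-]/=]; last by rewrite mulVKg.
  by exists (x * t)%g => //; rewrite mulKg.
apply: continuous_compact cK; apply: continuous_subspaceT.
exact: continuous_mulgl.
Qed.

Lemma compact_mulgr x K : compact K -> compact [set t | K (t * x)%g].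
Proof.
move=> cK; have -> : [set t | K (t * x)%g] = (fun t => (t * x^-1)%g) @` K.
  apply/seteqP; split=> [t /= Kt|_ [t Kt <-]/=]; last by rewrite mulgVK.
  by exists (t * x)%g => //; rewrite mulgK.
apply: continuous_compact cK; apply: continuous_subspaceT.
exact: continuous_mulgr.
Qed.

Definition mulset K L : set G := [set (p.1 * p.2)%g | p in K `*` L].

Definition invset K : set G := [set x | K (x^-1)%g].

Lemma mulsetP K L x y : K x -> L y -> mulset K L (x * y)%g.
Proof. by move=> Kx Ly; exists (x, y). Qed.

Lemma compact_mulset K L : compact K -> compact L -> compact (mulset K L).
Proof.
move=> cK cL; apply: continuous_compact (compact_setX cK cL).
by apply: continuous_subspaceT => p; exact: mulg_continuous.
Qed.

Lemma compact_invset K : compact K -> compact (invset K).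
Proof.
move=> cK; have -> : invset K = (fun t => t^-1%g) @` K.
  apply/seteqP; split=> [t /= Kt|_ [t Kt <-]]; last by rewrite /invset/= invgK.
  by exists (t^-1)%g => //; rewrite invgK.
by apply: continuous_compact cK; apply: continuous_subspaceT; exact: invg_continuous.
Qed.

(** Compactness in the form used below: the translates of one neighbourhood of the
unit, centred in [K]. *)
Lemma compact_translate_cover K W : compact K -> open W -> W 1%g ->
  exists s : seq G, (forall x, x \in s -> K x) /\
    (forall y, K y -> exists2 x, x \in s & W (x^-1 * y)%g).
Proof.
rewrite compact_cover => cK oW W1.
have [D DK cD] := cK G K (fun x => [set y | W (x^-1 * y)%g])
  (fun x _ => open_preimage_mulgl _ oW)
  (fun y Ky => ex_intro2 _ _ y Ky (eq_ind_r W W1 (mulVg y))).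
exists (finmap.enum_fset D); split=> [x xD|y /cD[x xD Wx]]; last by exists x.
by have := DK x xD; rewrite inE.
Qed.

End TopologicalGroups.

Section CompactSupport.
Context {R : realType} {G : topologicalGroupType}.
Local Notation C := R[i].
Implicit Types (f g : G -> C).

Lemma continuous_precomp (a : G -> G) f : continuous a ->
  continuous (f : G -> C^o) -> continuous ((fun t => f (a t)) : G -> C^o).
Proof.
by move=> ca cf t; exact: (@continuous_comp _ _ C^o a (f : G -> C^o) t (ca t) (cf _)).
Qed.

Definition supported f (K : set G) := forall t, ~ K t -> f t = 0.

Definition Cc : set (G -> C) :=
  [set f | continuous (f : G -> C^o) /\ exists2 K, compact K & supported f K].

(** Covers the left and the right uniform structure at once: [op x v] is [v * x] or
[x * v]. *)
Lemma uniform_continuity (op : G -> G -> G) f : Cc f ->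
  continuous (fun p => op p.1 p.2) -> (forall x, op x 1%g = x) ->
  (forall x v, op (op x v) (v^-1)%g = x) ->
  forall e : R, 0 < e -> exists W, [/\ open W, W 1%g &
    forall x v, W v -> cabs (f (op x v) - f x) < e].
Proof.
move=> [cf [K cK fK]] cop op1 opV e e0.
have e20 : 0 < e / 2 by rewrite divr_gt0.
have : \forall v \near (1%g : G), K `<=` (fun x => cabs (f (op x v) - f x) < e).
  move/compact_near_coveringP : cK; apply => x Kx.
  have H : \forall p \near (x, 1%g : G), cabs (f (op p.1 p.2) - f x) < e / 2.
    have /cabs_continuousE/(_ _ _ e20) := cf.
    move=> /(_ x); rewrite -{1}(op1 x) => h.
    exact: (cop (x, 1%g) _ h).
  have H' : \forall p \near (x, 1%g : G), cabs (f p.1 - f x) < e / 2.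
    have /cabs_continuousE/(_ _ _ e20) := cf.
    by move=> /(_ x) h; exact: (@cvg_fst _ _ (nbhs x) (nbhs (1%g : G)) _ _ h).
  near=> p => /=.
  have h1 : cabs (f (op p.1 p.2) - f x) < e / 2 by near: p.
  have h2 : cabs (f p.1 - f x) < e / 2 by near: p.
  have -> : f (op p.1 p.2) - f p.1 = (f (op p.1 p.2) - f x) - (f p.1 - f x) by ring.
  apply: le_lt_trans (ler_cabsB _ _) _; lra.
move=> nW.
(* Outside [K], the point [op x v] either also leaves [K], and [f] vanishes at
   both points, or lies in [K] and is moved back to [x] by [v^-1]. *)
pose W0 := [set v | K `<=` (fun x => cabs (f (op x v) - f x) < e)].
have nW' : nbhs (1%g : G) [set v | W0 (v^-1)%g].
  apply: (@invg_continuous G 1%g); suff -> : (1^-1)%g = 1%g :> G by [].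
  by rewrite invg1.
have : nbhs (1%g : G) (W0 `&` [set v | W0 (v^-1)%g]) by exact: filterI.
rewrite nbhsE => -[W [oW W1] sW].
exists W; split => // x v /sW[Wv Wv'].
have [Kx|nKx] := pselect (K x); first exact: Wv.
have [Ky|nKy] := pselect (K (op x v)).
  by have := Wv' _ Ky; rewrite /= opV cabsB.
by rewrite !fK// subr0 cabs0.
Unshelve. all: by end_near. Qed.

Lemma uniform_continuity_right f : Cc f -> forall e : R, 0 < e ->
  exists W, [/\ open W, W 1%g &
    forall x v, W v -> cabs (f (x * v)%g - f x) < e].
Proof.
move=> Cf; apply: uniform_continuity => //.
- exact: mulg_continuous.
- exact: mulg1.
- by move=> x v; rewrite mulgK.
Qed.

Lemma uniform_continuity_left f : Cc f -> forall e : R, 0 < e ->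
  exists W, [/\ open W, W 1%g &
    forall x v, W v -> cabs (f (v * x)%g - f x) < e].
Proof.
move=> Cf; apply: (@uniform_continuity (fun x v => (v * x)%g)) => //.
- by apply: continuous_mulg => t; [exact: cvg_snd|exact: cvg_fst].
- exact: mul1g.
- by move=> x v; rewrite mulKg.
Qed.

Lemma Cc_bounded f : Cc f -> exists2 b : R, 0 < b & forall t, cabs (f t) <= b.
Proof.
move=> [cf [K cK fK]].
have : \forall b \near +oo, K `<=` (fun x => cabs (f x) < b).
  move/compact_near_coveringP : cK; apply => x Kx.
  have /cabs_continuousE/(_ x 1 ltr01) h := cf.
  near=> t b => /=.
  have h1 : cabs (f t - f x) < 1 by near: t.
  have h2 : cabs (f x) + 1 < b by near: b; apply: nbhs_pinfty_gt; rewrite num_real.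
  rewrite -(subrK (f x) (f t)); apply: le_lt_trans (ler_cabsD _ _) _; lra.
move=> [M [_ hM]]; exists (`|M| + 1) => [|t]; first by rewrite ltr_pwDr.
have [Kt|nKt] := pselect (K t); last by rewrite fK// cabs0 addr_ge0.
apply/ltW/(hM (`|M| + 1)) => //.
by rewrite (le_lt_trans (ler_norm M))// ltrDl.
Unshelve. all: by end_near. Qed.

Lemma Cc_translate f x : Cc f -> Cc (fun t => f (x * t)%g).
Proof.
move=> [cf [K cK fK]]; split.
  exact: continuous_precomp (@continuous_mulgl G x) cf.
exists [set t | K (x * t)%g]; first exact: compact_mulgl.
by move=> t /fK.
Qed.

Lemma Cc_Z f (z : C) : Cc f -> Cc (fun t => z * f t).
Proof.
move=> [cf [K cK fK]]; split.
  apply/cabs_continuousE => x e e0.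
  have z1 : 0 < cabs z + 1 by rewrite ltr_wpDl ?cabs_ge0.
  have /cabs_continuousE/(_ x _ (divr_gt0 e0 z1)) := cf.
  apply: filterS => t; rewrite -mulrBr cabsM ltr_pdivlMr// => h.
  apply: le_lt_trans h; rewrite mulrC ler_wpM2l ?cabs_ge0//; lra.
by exists K => // t /fK ->; rewrite mulr0.
Qed.

Lemma bump_function (U : set G) : hausdorff_space G -> locally_compact [set: G] ->
  nbhs (1%g : G) U ->
  exists f : G -> R, [/\ continuous f, forall t, 0 <= f t, f 1%g = 1,
    forall t, ~ U t -> f t = 0 &
    exists2 K, compact K & forall t, ~ K t -> f t = 0].
Proof.
move=> hG lcG nU.
have [N] := lcG 1%g I; rewrite withinET => nN [cN clN].
pose B := ~` (U `&` N)°.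
have clB : closed B by apply: open_closedC; exact: open_interior.
have nB1 : ~ B 1%g by move/(_ (filterI nU nN)).
have sep : uniform_separator [set (1%g : G)] B.
  exact: (@locally_compact_completely_regular G R).
exists (fun t => 1 - Urysohn [set (1%g : G)] B t); split.
- move=> t; apply: cvgB; first exact: cvg_cst.
  exact: Urysohn_continuous.
- move=> t; rewrite subr_ge0.
  have := @Urysohn_range G R [set 1%g] B _ (ex_intro2 _ _ t I erefl).
  by rewrite /= in_itv/= => /andP[].
- have /= -> := @Urysohn_sub0 G R [set 1%g] B sep _ (ex_intro2 _ _ 1%g erefl erefl).
  by rewrite subr0.
- move=> t nUt; have Bt : B t by move=> /interior_subset[].
  have /= -> := @Urysohn_sub1 G R [set 1%g] B sep _ (ex_intro2 _ _ t Bt erefl).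
  by rewrite subrr.
- exists N => // t nNt; have Bt : B t by move=> /interior_subset[].
  have /= -> := @Urysohn_sub1 G R [set 1%g] B sep _ (ex_intro2 _ _ t Bt erefl).
  by rewrite subrr.
Qed.

End CompactSupport.

(** * Haar measure *)

Section BorelSets.
Context {R : realType} {G : topologicalGroupType}.
Local Notation C := R[i].
Implicit Types (f g : G -> C).

Lemma borel_open (U : set G) : open U -> measurable (U : set (borel G)).
Proof. by move=> oU; apply: sub_sigma_algebra. Qed.

Lemma borel_closed (U : set G) : closed U -> measurable (U : set (borel G)).
Proof.
move=> cU; rewrite -(setCK U); apply: measurableC; apply: borel_open.
exact: closed_openC.
Qed.

Lemma borel_compact (K : set G) : hausdorff_space G -> compact K ->
  measurable (K : set (borel G)).
Proof. by move=> hG cK; apply: borel_closed; exact: compact_closed. Qed.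

Lemma measurable_mulgl (x : G) :
  measurable_fun [set: borel G] (fun t : borel G => (x * t)%g : borel G).
Proof.
apply: (@measurability _ _ (borel G) (borel G) setT _ (@open G) erefl) => _ [U oU <-].
by rewrite setTI; apply: borel_open; exact: open_preimage_mulgl.
Qed.

Lemma measurable_preimage_mulgl (x : G) (A : set (borel G)) :
  measurable A -> measurable ([set t | A (x * t)%g] : set (borel G)).
Proof. by move=> mA; have := measurable_mulgl x measurableT mA; rewrite setTI. Qed.

Lemma continuous_borel (f : G -> R) : continuous f ->
  measurable_fun [set: borel G] (f : borel G -> R).
Proof.
move=> cf; apply: (measurability _ (RGenOpens.measurableE R)).
move=> /= _ [_ [a [b ->] <-]]; rewrite setTI; apply: borel_open.
by apply: open_comp => [t _|]; [exact: cf|exact: interval_open].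
Qed.

Lemma continuous_cmeasurable f : continuous (f : G -> C^o) -> cmeasurable f.
Proof.
move=> /cabs_continuousE cf; split; apply: continuous_borel => x;
  apply/cvgrPdist_lt => e e0; have := cf x e e0; apply: filterS => t;
  apply: le_lt_trans; rewrite distrC.
  have -> : complex.Re (f t) - complex.Re (f x) = complex.Re (f t - f x).
    by case: (f t) (f x) => [? ?] [? ?].
  exact: ler_Re_cabs.
have -> : complex.Im (f t) - complex.Im (f x) = complex.Im (f t - f x).
  by case: (f t) (f x) => [? ?] [? ?].
exact: ler_Im_cabs.
Qed.

Lemma Cc_cmeasurable f : Cc f -> cmeasurable f.
Proof. by case=> cf _; exact: continuous_cmeasurable. Qed.

Lemma Cc_cmeasurable_invg f (x : G) : Cc f ->
  cmeasurable (fun t => f (t^-1 * x)%g).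
Proof.
move=> [cf _]; apply: continuous_cmeasurable.
exact: (continuous_precomp (@continuous_invg_mulgr G x) cf).
Qed.

Lemma cmeasurable_translate f (x : G) : cmeasurable f ->
  cmeasurable (fun t => f (x * t)%g).
Proof.
move=> [fr fi]; split.
  exact: (measurableT_comp fr (measurable_mulgl x)).
exact: (measurableT_comp fi (measurable_mulgl x)).
Qed.

Lemma cmeasurable_indic (A : set (borel G)) : measurable A ->
  cmeasurable (\1_A : G -> C).
Proof.
move=> mA; split.
  have -> : (fun t => complex.Re (\1_A t : C)) = (\1_A : G -> R).
    by apply/funext => t; rewrite /indic; case: (t \in A).
  exact: measurable_indic.
have -> : (fun t => complex.Im (\1_A t : C)) = (fun=> 0).
  by apply/funext => t; rewrite /indic; case: (t \in A).
exact: measurable_cst.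
Qed.

Lemma indic_mem (A : set G) t : A t -> \1_A t = 1 :> C.
Proof. by move=> At; rewrite indicE mem_set. Qed.

Lemma indic_nmem (A : set G) t : ~ A t -> \1_A t = 0 :> C.
Proof. by move=> At; rewrite indicE memNset. Qed.

Lemma cabs_indic (A : set G) t : cabs (\1_A t : C) <= 1.
Proof. by rewrite indicE; case: (t \in A); rewrite ?cabs0 ?cabs1. Qed.

End BorelSets.

Section HaarMeasure.
Context {R : realType} {G : topologicalGroupType}.
Variable mu : {measure set (borel G) -> \bar R}.
Hypothesis hG : hausdorff_space G.
Hypothesis haar : left_haar_measure mu.
Local Notation C := R[i].
Implicit Types (f g : G -> C) (K W : set G).

Lemma haar_compact K : compact K -> (mu K < +oo)%E.
Proof. by case: haar => -[h _ _] _ _; exact: h. Qed.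

Lemma haar_mulgl (x : G) (A : set (borel G)) : measurable A ->
  mu [set t | A (x * t)%g] = mu A.
Proof.
move=> mA; have [_ _ h] := haar; rewrite -(h (x^-1)%g A mA); congr (mu _).
apply/seteqP; split=> [t /= At|_ [t At <-] /=]; last by rewrite mulVKg.
by exists (x * t)%g => //; rewrite mulKg.
Qed.

Lemma ge0_integral_mulgl (x : G) (F : borel G -> \bar R) :
  measurable_fun [set: borel G] F -> (forall t, 0 <= F t)%E ->
  (\int[mu]_t F (x * t)%g = \int[mu]_t F t)%E.
Proof.
move=> mF F0.
have := @ge0_integral_pushforward _ _ _ _ R _ (measurable_mulgl x) mu setT F
  measurableT mF (fun t _ => F0 t).
rewrite preimage_setT => <-; apply: eq_measure_integral => [|? A mA _]; first exact: measurable_mulgl.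
by have := haar_mulgl x mA; rewrite /= /pushforward.
Qed.

Lemma norm1_mulgl (x : G) f : cmeasurable f ->
  norm1 mu (fun t => f (x * t)%g) = norm1 mu f.
Proof.
move=> mf; apply: (@ge0_integral_mulgl x (fun t => (cabs (f t))%:E)).
  exact: measurable_EFin_cabs.
by move=> t; rewrite lee_fin cabs_ge0.
Qed.

Lemma cintegrable_mulgl (x : G) f : cintegrable mu f ->
  cintegrable mu (fun t => f (x * t)%g).
Proof.
move=> [mf f1]; split; first exact: cmeasurable_translate.
by rewrite -/(norm1 _ _) norm1_mulgl.
Qed.

Lemma cintegral_mulgl (x : G) f : cintegrable mu f ->
  cintegral mu (fun t => f (x * t)%g) = cintegral mu f.
Proof.
move=> fi; rewrite /cintegral.
have H (F : borel G -> R) :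
    mu.-integrable [set: borel G] (EFin \o F) ->
    (\int[mu]_t F (x * t)%g)%R = (\int[mu]_t F t)%R.
  move=> Fi; rewrite /Rintegral; congr fine.
  have mF : measurable_fun [set: borel G] (EFin \o F) by case/integrableP : Fi.
  rewrite integralE [RHS]integralE.
  have hp := ge0_integral_mulgl x (measurable_funepos mF) (funepos_ge0 _).
  have hn := ge0_integral_mulgl x (measurable_funeneg mF) (funeneg_ge0 _).
  by rewrite -hp -hn; congr (_ - _)%E; apply: eq_integral => t _;
    rewrite ?funeposE ?funenegE.
congr Complex.
- exact: (H _ (integrable_Re fi)).
- exact: (H _ (integrable_Im fi)).
Qed.

(** A compact set of positive measure is covered by finitely many translates of
any nonempty open set. *)
Lemma haar_open_gt0 (U : set G) x : open U -> U x -> (0 < mu U)%E.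
Proof.
move=> oU Ux; rewrite lt0e measure_ge0 andbT; apply/eqP => mU0.
have [[_ _ inner] muT _] := haar.
have : (0 < mu setT)%E by rewrite lt0e muT measure_ge0.
rewrite (inner setT openT) => /ereal_sup_gt[_ [K [cK _] <-]].
apply/negP; rewrite -leNgt.
pose W := [set t | U (x * t)%g].
have oW : open W by exact: open_preimage_mulgl.
have W1 : W 1%g by rewrite /W/= mulg1.
have muW y : mu [set t | W (y^-1 * t)%g] = 0%E.
  by rewrite haar_mulgl ?haar_mulgl//; [exact: borel_open|exact: borel_open].
have [s [_ sK]] := compact_translate_cover cK oW W1.
pose F i := [set t | W ((nth 1%g s i)^-1 * t)%g].
have oF i : open (F i) by exact: open_preimage_mulgl.
have KF : K `<=` \big[setU/set0]_(i < size s) F i.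
  move=> y /sK[z zs Wz]; rewrite -bigcup_mkord.
  by exists (index z s); rewrite /= ?index_mem// /F nth_index.
have := content_subadditive mu (fun k _ => borel_open (oF k))
  (borel_compact hG cK) KF.
by move/le_trans; apply; rewrite big1// => i _; exact: muW.
Qed.

(** The translates [y_i W] are disjoint of equal measure, and those with [P i] lie
in the compact set [s^-1 D N], whose measure does not depend on [s]. *)
Lemma packing (D N W : set G) (s : G) (p : nat) (y : nat -> G) (P : pred nat) :
  compact D -> compact N -> open W -> W `<=` N ->
  (forall i j t, (i < p)%N -> (j < p)%N ->
     W ((y i)^-1 * t)%g -> W ((y j)^-1 * t)%g -> i = j) ->
  (forall i, (i < p)%N -> P i -> D (s * y i)%g) ->
  (\sum_(i < p | P i) mu W <= mu (mulset D N))%E.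
Proof.
move=> cD cN oW WN disj PD.
have mDN : measurable (mulset D N : set (borel G)).
  by apply: borel_compact => //; exact: compact_mulset.
pose F (i : 'I_p) : set (borel G) := [set t | W ((y i)^-1 * t)%g].
have mF i : measurable (F i).
  by apply: borel_open; exact: open_preimage_mulgl.
have := @measure_bigsetU_ord_cond _ _ _ mu p (fun i => P i) F (fun i _ => mF i).
have tF : trivIset (fun i : 'I_p => P i) F.
  by move=> i j _ _ [t [Wi Wj]]; apply: val_inj;
    exact: (disj i j t (ltn_ord i) (ltn_ord j) Wi Wj).
move=> /(_ tF).
rewrite (eq_bigr (fun=> mu W)); last first.
  by move=> i _; exact: haar_mulgl (borel_open oW).
move=> <-; rewrite -(haar_mulgl s mDN).
apply: le_measure; rewrite ?inE.
- exact: bigsetU_measurable.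
- exact: measurable_preimage_mulgl.
- elim/big_ind : _ => [//|A B hA hB t [/hA|/hB]//|i Pi t Wt] /=.
  have -> : (s * t = (s * y i) * ((y i)^-1 * t))%g.
    by rewrite mulgA mulgK.
  apply: mulsetP; first exact: PD.
  exact: WN.
Qed.


(** A finite cover of [Q] by translates of [W], made disjoint by removing from each
translate the earlier ones. *)
Lemma mesh (Q W : set G) : compact Q -> open W -> W 1%g ->
  exists n (r : nat -> G) (E : nat -> set (borel G)),
  [/\ forall i, measurable (E i),
      forall i t, E i t -> Q t /\ W ((r i)^-1 * t)%g,
      forall i, (i < n)%N -> Q (r i)
    & forall t, Q t -> exists2 i, (i < n)%N & E i t /\ forall j, E j t -> j = i].
Proof.
move=> cQ oW W1; have [s [sQ cov]] := compact_translate_cover cQ oW W1.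
pose r i := nth 1%g s i.
pose F i : set (borel G) := [set t | W ((r i)^-1 * t)%g].
have mF i : measurable (F i).
  by apply: borel_open; exact: open_preimage_mulgl.
exists (size s), r, (fun i => Q `&` (F i `&` \bigcap_(j in [set j | (j < i)%N]) ~` F j)).
split.
- move=> i; apply: measurableI; first exact: borel_compact.
  apply: measurableI => //; apply: bigcap_measurableType => j _.
  exact: measurableC.
- by move=> i t [Qt [Ft _]].
- by move=> i si; apply: sQ; exact: mem_nth.
- move=> t Qt; have [z zs Wz] := cov t Qt.
  have exi : exists i, `[< F i t >].
    by exists (index z s); apply/asboolP; rewrite /F /r /= nth_index.
  case: (ex_minnP exi) => i /asboolP Fi mini; exists i.
    apply: leq_ltn_trans (mini (index z s) _) _; last by rewrite index_mem.
    by apply/asboolP; rewrite /F /r /= nth_index.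
  split.
    split=> //; split=> // j /= ji Fj.
    by have := mini j (asboolT Fj); rewrite leqNgt ji.
  move=> j [_ [Fj nF]]; apply/eqP; rewrite eqn_leq (mini _ (asboolT Fj)) andbT.
  by rewrite leqNgt; apply/negP => ij; exact: nF ij Fi.
Qed.

Lemma norm1_supported f K (b : R) : compact K -> cmeasurable f ->
  supported f K -> 0 <= b -> (forall t, cabs (f t) <= b) ->
  (norm1 mu f <= b%:E * mu K)%E.
Proof.
move=> cK mf fK b0 fb; have mK := borel_compact hG cK.
have -> : mu K = (\int[mu]_t (\1_(K : set (borel G)) t)%:E)%E.
  by rewrite integral_indic// setIT.
rewrite -ge0_integralZl_EFin//; last first.
  by apply/measurable_EFinP; exact: measurable_indic.
apply: ge0_le_integral => //.
- by move=> t _; rewrite lee_fin cabs_ge0.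
- exact: measurable_EFin_cabs.
- by apply: measurable_funeM; apply/measurable_EFinP; exact: measurable_indic.
- move=> t _; rewrite -EFinM lee_fin indicE.
  have [/set_mem Kt|] := boolP (t \in K); first by rewrite mulr1.
  by move=> /negP nK; rewrite fK ?cabs0 ?mulr0// => Kt; apply: nK; rewrite inE.
Qed.

Lemma Cc_cintegrable f : Cc f -> cintegrable mu f.
Proof.
move=> Cf; have mf := Cc_cmeasurable Cf; split=> //.
have [b b0 fb] := Cc_bounded Cf.
case: Cf => _ [K cK fK].
apply: le_lt_trans (norm1_supported cK mf fK (ltW b0) fb) _.
by rewrite lte_mul_pinfty ?lee_fin ?(ltW b0)// haar_compact.
Qed.

Lemma bounded_cintegrable f g (b : R) : cintegrable mu f -> cmeasurable g ->
  (forall t, cabs (g t) <= b) -> cintegrable mu (fun t => f t * g t).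
Proof.
move=> fi mg gb; have [mf _] := fi.
have b0 : 0 <= b by apply: le_trans (gb 1%g); exact: cabs_ge0.
apply: (le_cintegrable (c := b) _ fi) => //; first exact: cmeasurableM.
by move=> t; rewrite cabsM mulrC ler_wpM2r ?cabs_ge0.
Qed.

(** In this form, in which [conv] appears from now on, left invariance of the
measure is used for translations of [s]. *)
Lemma convE f g t :
  Defs.conv mu f (check g) t = cintegral mu (fun s => f s * g (t^-1 * s)%g).
Proof. by apply: eq_cintegral => s; rewrite /check invgM invgK. Qed.

Lemma cabs_cintegral_dom f h (c : R) : cintegrable mu f -> cmeasurable h ->
  0 <= c -> (forall t, cabs (h t) <= c * cabs (f t)) ->
  cabs (cintegral mu h) <= 2 * c * fine (norm1 mu f).
Proof.
move=> fi mh c0 hf; have [mf f1] := fi.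
have f1fin : norm1 mu f \is a fin_num by rewrite ge0_fin_numE// norm1_ge0.
rewrite -mulrA; apply: cabs_cintegral_le; first exact: le_cintegrable hf.
by rewrite EFinM fineK//; exact: norm1_le_dom.
Qed.

(** Dominated convergence is replaced by uniform convergence in the integration
variable, as neighbourhood filters of [G] need not be countably generated. *)
Lemma cintegral_continuous f (k : G -> G -> C) (b : R) : cintegrable mu f ->
  (forall y, cmeasurable (k y)) -> (forall y t, cabs (k y t) <= b) ->
  (forall x (e : R), 0 < e ->
     \forall y \near x, forall t, cabs (k y t - k x t) < e) ->
  continuous ((fun y => cintegral mu (fun t => f t * k y t)) : G -> C^o).
Proof.
move=> fi mk kb ck; have [mf _] := fi.
have c0 : 0 <= fine (norm1 mu f) by rewrite fine_ge0// norm1_ge0.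
set c := fine _ in c0.
have c1 : 0 < 2 * c + 1 by lra.
apply/cabs_continuousE => x e e0.
have e'0 : 0 < e / (2 * c + 1) by rewrite divr_gt0.
apply: filterS (ck x _ e'0) => y ky.
have ki z : cintegrable mu (fun t => f t * k z t) by apply: bounded_cintegrable (kb z).
rewrite -cintegralB//.
apply: le_lt_trans (cabs_cintegral_dom fi _ (ltW e'0) _) _.
- by apply: cmeasurableB; apply: cmeasurableM.
- by move=> t; rewrite -mulrBr cabsM mulrC ler_wpM2r ?cabs_ge0// ltW.
rewrite -/c (_ : 2 * _ * c = (2 * c) * e / (2 * c + 1)).
  by rewrite ltr_pdivrMr// mulrC ltr_pM2l//; lra.
by field; rewrite gt_eqF.
Qed.

Lemma conv_continuous f g : cintegrable mu f -> Cc g ->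
  continuous (Defs.conv mu f (check g) : G -> C^o).
Proof.
move=> fi Cg; have [b b0 gb] := Cc_bounded Cg; have mg := Cc_cmeasurable Cg.
rewrite (_ : Defs.conv _ _ _ =
    (fun y => cintegral mu (fun t => f t * g (y^-1 * t)%g))); last first.
  by apply/funext => y; exact: convE.
apply: (@cintegral_continuous f (fun y t => g (y^-1 * t)%g) b) => //.
  by move=> y; exact: cmeasurable_translate.
move=> x e e0; have [W [oW W1 gW]] := uniform_continuity_left Cg e0.
have cc := @continuous_invg_mulgr G x.
have : \forall y \near x, W (y^-1 * x)%g.
  by apply: (cc x); apply: open_nbhs_nbhs; split=> //; rewrite mulVg.
apply: filterS => y Wy t; have -> : (y^-1 * t = (y^-1 * x) * (x^-1 * t))%g.
  by rewrite mulgA mulgK.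
exact: gW.
Qed.

Lemma conv_continuous_right f g : cintegrable mu f -> Cc g ->
  continuous (Defs.conv mu f g : G -> C^o).
Proof.
move=> fi Cg; have [b b0 gb] := Cc_bounded Cg.
apply: (@cintegral_continuous f (fun y t => g (t^-1 * y)%g) b) => //.
  by move=> y; exact: Cc_cmeasurable_invg.
move=> x e e0; have [W [oW W1 gW]] := uniform_continuity_right Cg e0.
have : \forall y \near x, W (x^-1 * y)%g.
  have cc := @continuous_mulgl G (x^-1)%g.
  by apply: (cc x); apply: open_nbhs_nbhs; split=> //; rewrite mulVg.
apply: filterS => y Wy t; have -> : (t^-1 * y = (t^-1 * x) * (x^-1 * y))%g.
  by rewrite -mulgA mulVKg.
exact: gW.
Qed.

End HaarMeasure.

(** * Young functions *)

Section YoungFunctions.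
Context {R : realType}.
Implicit Types (Phi Psi : R -> \bar R).

Lemma young_ge0 Phi t : young_function Phi -> (0 <= Phi t)%E.
Proof. by case. Qed.

Lemma young_scale Phi (a t : R) : young_function Phi -> 0 <= a <= 1 ->
  (Phi (a * t)%R <= a%:E * Phi t)%E.
Proof.
move=> [_ conv _ Phi0 _] a01; have := conv t 0 a a01.
by rewrite mulr0 addr0 Phi0 mule0 adde0.
Qed.

Lemma young_le Phi (s t : R) : young_function Phi -> 0 <= s <= t ->
  (Phi s <= Phi t)%E.
Proof.
move=> yPhi /andP[s0 st]; have [t0|t0] := leP t 0.
  by have -> : s = t by apply/eqP; rewrite eq_le st (le_trans t0).
have -> : s = (s / t) * t by rewrite divfK// gt_eqF.
have a01 : 0 <= s / t <= 1 by rewrite divr_ge0 ?(ltW t0)//= ler_pdivrMr// mul1r.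
apply: le_trans (young_scale _ yPhi a01) _.
rewrite -[leRHS]mul1e; apply: lee_wpmul2r; first exact: young_ge0.
by rewrite lee_fin; case/andP : a01.
Qed.

Lemma young_ge1 Phi : young_function Phi -> exists2 t : R, 0 < t & (1 <= Phi t)%E.
Proof.
move=> [_ _ _ _ /cvgeyPge /(_ 1)] [M [_ hM]].
exists (`|M| + 1); first by rewrite ltr_pwDr.
by apply: hM; rewrite (le_lt_trans (ler_norm M))// ltrDl.
Qed.

(** By convexity [Phi] grows at least linearly, with slope [1 / t] beyond a point
[t] with [1 <= Phi t], so its conjugate is finite at [1 / t]. *)
Lemma complementary_lty Phi : young_function Phi ->
  exists2 s : R, 0 < s & (complementary Phi s < +oo)%E.
Proof.
move=> yPhi; have [t t0 Pt1] := young_ge1 yPhi.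
have tV0 : 0 < t^-1 by rewrite invr_gt0.
exists t^-1 => //.
suff : (complementary Phi t^-1 <= 1)%E by move/le_lt_trans; apply; rewrite ltry.
apply: ge_ereal_sup => _ [r /= r0 <-]; rewrite (gtr0_norm tV0).
have [rt|tr] := leP r t.
  apply: (@le_trans _ _ (r / t)%:E); last by rewrite lee_fin ler_pdivrMr// mul1r.
  rewrite lee_subel_addr// leeDl//. exact: young_ge0.
have r00 : 0 < r by apply: lt_trans tr.
have : (1 <= (t / r)%:E * Phi r)%E.
  apply: le_trans Pt1 _; have -> : Phi t = Phi ((t / r) * r)%R by rewrite divfK// gt_eqF.
  apply: young_scale => //; rewrite divr_ge0 ?ltW//=.
  by rewrite ltr_pdivrMr// mul1r.
case: (Phi r) (young_ge0 r yPhi) => [p||] // p0; last by rewrite /= addeNy leNye.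
rewrite -EFinM -EFinB !lee_fin => h.
apply: (@le_trans _ _ 0) => //; rewrite subr_le0 ler_pdivrMr//.
by move: h; rewrite mulrAC ler_pdivlMr// mul1r mulrC.
Qed.

(** If [Phi] were infinite off 0, its conjugate would vanish identically. *)
Lemma young_lty Phi : young_function Phi -> young_function (complementary Phi) ->
  exists2 s : R, 0 < s & (Phi s < +oo)%E.
Proof.
move=> yPhi yPsi; apply: contrapT => nfin.
have [t t0] := young_ge1 yPsi; apply/negP; rewrite -ltNge.
apply: (@le_lt_trans _ _ 0%E) => //.
apply: ge_ereal_sup => _ [r /= r0 <-].
have [r00|{}r0] := leP r 0.
  have -> : r = 0 by apply/eqP; rewrite eq_le r00.
  by rewrite mul0r; case: yPhi => _ _ _ -> _; rewrite sube0.
have -> : Phi r = +oo%E.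
  by apply/eqP; rewrite eq_le leey leNgt; apply/negP => Pr; apply: nfin; exists r.
by rewrite addeNy leNye.
Qed.

Lemma young_ineq Phi (a b : R) : young_function Phi -> 0 <= a -> 0 <= b ->
  ((a * b)%:E <= Phi a + complementary Phi b)%E.
Proof.
move=> yPhi a0 b0.
have : ((a * `|b|)%:E - Phi a <= complementary Phi b)%E.
  by apply: ereal_sup_ubound; exists a.
have Psi0 : (0 <= complementary Phi b)%E.
  apply: ereal_sup_ubound; exists 0 => //=; rewrite mul0r.
  by case: yPhi => _ _ _ -> _; rewrite sube0.
rewrite (ger0_norm b0); case: (Phi a) (young_ge0 a yPhi) => [p||]// _ h.
- by rewrite -leeBlDl.
- rewrite addye ?leey//; case: (complementary Phi b) Psi0 => //.
Qed.

(** A monotone function is measurable; [Phi] is monotone on the half-line only,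
whence the maximum. *)
Lemma measurable_young Phi : young_function Phi ->
  measurable_fun [set: R] (fun t => Phi (Num.max 0 t)).
Proof.
move=> yPhi; apply: (measurability _ (ErealGenCInfty.measurableE R)).
move=> /= _ [_ [r ->] <-]; apply: measurableI => //.
apply: is_interval_measurable => s t/=.
rewrite !in_itv/= !andbT => fs ft u /andP[su ut].
rewrite in_itv/= andbT (le_trans fs)//; apply: young_le => //.
by rewrite le_max lexx/= ge_max le_max lexx/= le_max su orbT.
Qed.

End YoungFunctions.

(** * The Luxemburg and Orlicz norms *)

Section OrliczNorms.
Context {R : realType} {G : topologicalGroupType}.
Variable mu : {measure set (borel G) -> \bar R}.
Local Notation C := R[i].
Implicit Types (f g h : G -> C) (Phi : R -> \bar R).

Lemma measurable_young_cabs Phi f (a : R) : young_function Phi ->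
  cmeasurable f -> 0 <= a ->
  measurable_fun [set: borel G] (fun t : borel G => Phi (a * cabs (f t))).
Proof.
move=> yPhi mf a0.
have -> : (fun t => Phi (a * cabs (f t))) =
    (fun t => Phi (Num.max 0 t)) \o (fun t => a * cabs (f t)).
  by apply/funext => t /=; congr Phi; apply/esym/max_idPr; rewrite mulr_ge0// cabs_ge0.
apply: measurableT_comp; first exact: measurable_young.
by apply: measurable_funM => //; exact: cmeasurable_cabs.
Qed.

Definition scaled_modular Phi (a : R) f : \bar R := (\int[mu]_t Phi (a * cabs (f t))%R)%E.

Lemma scaled_modular_le Phi f g (a b : R) : young_function Phi -> cmeasurable f ->
  cmeasurable g -> 0 <= a -> 0 <= b ->
  (forall t, a * cabs (f t) <= b * cabs (g t)) -> (scaled_modular Phi a f <= scaled_modular Phi b g)%E.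
Proof.
move=> yPhi mf mg a0 b0 fg; apply: ge0_le_integral => //.
- by move=> t _; exact: young_ge0.
- by apply: measurable_young_cabs.
- by apply: measurable_young_cabs.
- by move=> t _; apply: young_le => //; rewrite fg mulr_ge0// cabs_ge0.
Qed.

Lemma scaled_modularZ Phi f (a c : R) : young_function Phi -> cmeasurable f ->
  0 <= a <= 1 -> 0 <= c -> (scaled_modular Phi (a * c)%R f <= a%:E * scaled_modular Phi c f)%E.
Proof.
move=> yPhi mf /andP[a0 a1] c0; rewrite /scaled_modular -ge0_integralZl_EFin//; first last.
- by apply: measurable_young_cabs.
- by move=> t _; exact: young_ge0.
apply: ge0_le_integral => //.
- by move=> t _; exact: young_ge0.
- by apply: measurable_young_cabs => //; rewrite mulr_ge0.
- by apply: measurable_funeM; by apply: measurable_young_cabs.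
- by move=> t _; rewrite -mulrA; apply: young_scale => //; rewrite a0.
Qed.

(** Real values of the two norms; by [NphiE] and [OpsiE] they carry the same
information on the Orlicz spaces themselves, where the norms are finite. *)
Definition Nphi Phi f : R := fine (luxemburg_norm mu Phi f).

Lemma luxemburg_ge0 Phi f : (0 <= luxemburg_norm mu Phi f)%E.
Proof. by apply: le_ereal_inf_tmp => _ [a [/ltW a0 _] <-]; rewrite lee_fin. Qed.

Lemma luxemburg_scaled_modular Phi f (a : R) : 0 < a -> (scaled_modular Phi a^-1 f <= 1)%E ->
  (luxemburg_norm mu Phi f <= a%:E)%E.
Proof.
move=> a0 fa; apply: ereal_inf_lbound; exists a => //; split=> //.
by under eq_integral do rewrite mulrC.
Qed.

Lemma luxemburg_lt Phi f (c : \bar R) : (luxemburg_norm mu Phi f < c)%E ->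
  exists a, [/\ 0 < a, (a%:E < c)%E & (scaled_modular Phi a^-1 f <= 1)%E].
Proof.
move=> /ereal_inf_lt[_ [a [a0 fa] <-] ac]; exists a; split=> //.
by rewrite /scaled_modular; under eq_integral do rewrite mulrC.
Qed.

Lemma luxemburg_lty Phi f : young_function Phi -> LOrlicz mu Phi f ->
  (luxemburg_norm mu Phi f < +oo)%E.
Proof.
move=> yPhi [mf [a a0 fa]].
have m0 : (0 <= scaled_modular Phi a f)%E by apply: integral_ge0 => t _; exact: young_ge0.
have [m mE] : exists m, scaled_modular Phi a f = m%:E.
  by exists (fine (scaled_modular Phi a f)); rewrite fineK// ge0_fin_numE.
move: m0; rewrite mE lee_fin => m0.
have m1 : 0 < m + 1 by lra.
suff : (luxemburg_norm mu Phi f <= ((m + 1) / a)%:E)%E.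
  by move/le_lt_trans; apply; rewrite ltry.
apply: luxemburg_scaled_modular; first exact: divr_gt0.
rewrite invf_div -(mulr1 (a / _)) mulrAC mulrC mulr1.
apply: le_trans (scaled_modularZ yPhi mf _ (ltW a0)) _.
  by rewrite invr_ge0 (ltW m1)/= invf_le1//; lra.
by rewrite mE -EFinM lee_fin mulrC ler_pdivrMr// mul1r; lra.
Qed.

Lemma NphiE Phi f : young_function Phi -> LOrlicz mu Phi f ->
  luxemburg_norm mu Phi f = (Nphi Phi f)%:E.
Proof.
by move=> yPhi Lf; rewrite fineK// ge0_fin_numE ?luxemburg_ge0// luxemburg_lty.
Qed.

Lemma Nphi_ge0 Phi f : 0 <= Nphi Phi f.
Proof. by apply: fine_ge0; exact: luxemburg_ge0. Qed.

Lemma LOrlicz_dom Phi f g (c : R) : young_function Phi -> LOrlicz mu Phi f ->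
  cmeasurable g -> 0 <= c -> (forall t, cabs (g t) <= c * cabs (f t)) ->
  LOrlicz mu Phi g.
Proof.
move=> yPhi [mf [a a0 fa]] mg c0 gf; split=> //.
have c1 : 0 < c + 1 by lra.
exists (a / (c + 1)); first exact: divr_gt0.
apply: le_lt_trans fa; apply: scaled_modular_le => //; rewrite ?ltW ?divr_gt0// => t.
rewrite -mulrA ler_pM2l// mulrC ler_pdivrMr//.
apply: le_trans (gf t) _; rewrite mulrC ler_wpM2l ?cabs_ge0//; lra.
Qed.

(** The norm is a lattice norm.  The infimum in its definition need not be attained,
so the bound is proved up to [e], by enlarging both [c] and [Nphi Phi f] by [d]. *)
Lemma Nphi_dom Phi f g (c : R) : young_function Phi -> LOrlicz mu Phi f ->
  cmeasurable g -> 0 <= c -> (forall t, cabs (g t) <= c * cabs (f t)) ->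
  Nphi Phi g <= c * Nphi Phi f.
Proof.
move=> yPhi Lf mg c0 gf; have Lg := LOrlicz_dom yPhi Lf mg c0 gf.
have [mf _] := Lf.
set l := Nphi Phi f; have l0 : 0 <= l := Nphi_ge0 Phi f.
apply/ler_addgt0Pr => e e0.
pose d := Num.min 1 (e / (c + l + 1)).
have s0 : 0 < c + l + 1 by lra.
have d0 : 0 < d by rewrite lt_min ltr01 divr_gt0.
have d1 : d <= 1 by rewrite ge_min lexx.
have de : d * (c + l + 1) <= e.
  by rewrite -ler_pdivlMr// ge_min lexx orbT.
have [a [a0 al fa]] : exists a, [/\ 0 < a, (a%:E < (l + d)%:E)%E &
    (scaled_modular Phi a^-1 f <= 1)%E].
  by apply: luxemburg_lt; rewrite NphiE// lte_fin ltrDl.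
rewrite lte_fin in al.
have cd0 : 0 < c + d by lra.
have : (luxemburg_norm mu Phi g <= ((c + d) * a)%:E)%E.
  apply: luxemburg_scaled_modular; first exact: mulr_gt0.
  apply: le_trans fa; apply: scaled_modular_le => //.
  - by rewrite invr_ge0 mulr_ge0// ltW.
  - by rewrite invr_ge0 ltW.
  - move=> t; rewrite invfM -mulrA mulrCA ler_pM2l ?invr_gt0//.
    rewrite ler_pdivrMl//; apply: le_trans (gf t) _.
    by rewrite ler_wpM2r ?cabs_ge0//; lra.
rewrite NphiE// lee_fin => /le_trans; apply.
apply: (@le_trans _ _ ((c + d) * (l + d))); first by rewrite ler_pM2l// ltW.
nra.
Qed.

Definition Opsi Phi g : R := fine (orlicz_norm mu Phi g).

Lemma orlicz_ge0 Phi g : young_function Phi -> (0 <= orlicz_norm mu Phi g)%E.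
Proof.
move=> yPhi; apply: ereal_sup_ubound; exists (fun=> 0).
  split; first exact: cmeasurable_cst.
  rewrite /modular; under eq_integral do rewrite cabs0.
  by case: yPhi => _ _ _ -> _; rewrite integral0.
by under eq_integral do rewrite mul0r cabs0; rewrite integral0.
Qed.

(** Young's inequality [|f| (a |g|) <= Phi |f| + Psi (a |g|)], integrated. *)
Lemma orlicz_lty Phi g : young_function Phi ->
  young_function (complementary Phi) -> LOrlicz mu (complementary Phi) g ->
  (orlicz_norm mu Phi g < +oo)%E.
Proof.
move=> yPhi yPsi [mg [a a0 ga]].
have m0 : (0 <= scaled_modular (complementary Phi) a g)%E.
  by apply: integral_ge0 => t _; exact: young_ge0.
have [m mE] : exists m, scaled_modular (complementary Phi) a g = m%:E.
  by exists (fine (scaled_modular (complementary Phi) a g)); rewrite fineK// ge0_fin_numE.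
suff : (orlicz_norm mu Phi g <= (a^-1 * (1 + m))%:E)%E.
  by move/le_lt_trans; apply; rewrite ltry.
apply: ge_ereal_sup => _ [f [mf f1] <-].
rewrite EFinM -[leLHS]/(norm1 mu (fun t => f t * g t)).
apply: (@le_trans _ _ (a^-1%:E * (\int[mu]_t
    (Phi (1 * cabs (f t))%R + complementary Phi (a * cabs (g t))%R)%E))%E); last first.
  apply: lee_wpmul2l; first by rewrite lee_fin invr_ge0 ltW.
  rewrite ge0_integralD//; first last.
  - by apply: measurable_young_cabs => //; exact: ltW.
  - by move=> t _; exact: young_ge0.
  - by apply: measurable_young_cabs.
  - by move=> t _; exact: young_ge0.
  rewrite EFinD -mE leeD// (le_trans _ f1)// /modular.
  by under eq_integral do rewrite mul1r.
rewrite -ge0_integralZl_EFin//; first last.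
- by rewrite invr_ge0 ltW.
- apply: emeasurable_funD; first by apply: measurable_young_cabs.
  by apply: measurable_young_cabs => //; exact: ltW.
- by move=> t _; rewrite adde_ge0// young_ge0.
apply: ge0_le_integral => //.
- by move=> t _; rewrite lee_fin cabs_ge0.
- by apply: measurable_EFin_cabs; exact: cmeasurableM.
- apply: measurable_funeM.
  apply: emeasurable_funD; first by apply: measurable_young_cabs.
  by apply: measurable_young_cabs => //; exact: ltW.
- move=> t _; rewrite mul1r lee_pdivlMl//.
  rewrite -EFinM cabsM mulrCA.
  by apply: young_ineq; rewrite ?cabs_ge0// mulr_ge0 ?cabs_ge0// ltW.
Qed.

Section ComplementaryPair.
Variables Phi Psi : R -> \bar R.
Hypothesis yPhi : young_function Phi.
Hypothesis yPsi : young_function Psi.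
Hypothesis compl : Psi = complementary Phi.
Hypothesis hG : hausdorff_space G.
Hypothesis haar : left_haar_measure mu.
Local Notation LPhi := (LOrlicz mu Phi).
Local Notation LPsi := (LOrlicz mu Psi).
Local Notation N := (Nphi Phi).
Local Notation O := (Opsi Phi).

Lemma OpsiE g : LPsi g -> orlicz_norm mu Phi g = (O g)%:E.
Proof.
move=> Lg; rewrite fineK// ge0_fin_numE ?orlicz_ge0//.
by apply: orlicz_lty; rewrite -?compl.
Qed.

Lemma Opsi_ge0 g : 0 <= O g.
Proof. by apply: fine_ge0; exact: orlicz_ge0. Qed.

Lemma orlicz_ubound f g : cmeasurable f -> (scaled_modular Phi 1 f <= 1)%E ->
  (norm1 mu (fun t => f t * g t)%R <= orlicz_norm mu Phi g)%E.
Proof.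
move=> mf f1; apply: ereal_sup_ubound; exists f => //; split=> //.
by move: f1; rewrite /scaled_modular /modular; under eq_integral do rewrite mul1r.
Qed.

Lemma Opsi_dom g h (c : R) : LPsi g -> cmeasurable h -> 0 <= c ->
  (forall t, cabs (h t) <= c * cabs (g t)) -> O h <= c * O g.
Proof.
move=> Lg mh c0 hg; have Lh := LOrlicz_dom yPsi Lg mh c0 hg.
have [mg _] := Lg.
rewrite -lee_fin -OpsiE// EFinM -OpsiE//.
apply: ge_ereal_sup => _ [f [mf f1] <-].
apply: (@le_trans _ _ (c%:E * norm1 mu (fun t => f t * g t)%R)%E).
  apply: norm1_le_dom => //; [exact: cmeasurableM|exact: cmeasurableM|].
  by move=> t; rewrite !cabsM mulrCA ler_wpM2l ?cabs_ge0.
apply: lee_wpmul2l; first by rewrite lee_fin.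
by apply: ereal_sup_ubound; exists f.
Qed.

(** The Orlicz norm is by definition dual to the unit ball of the Luxemburg norm,
so the inequality holds with constant 1. *)
Lemma holder f g : LPhi f -> LPsi g ->
  (norm1 mu (fun t => f t * g t)%R <= (N f * O g)%:E)%E.
Proof.
move=> Lf Lg; have [mf _] := Lf; have [mg _] := Lg.
apply/lee_addgt0Pr => e e0.
have o0 := Opsi_ge0 g; have o1 : 0 < O g + 1 by lra.
pose d := e / (O g + 1).
have d0 : 0 < d by rewrite divr_gt0.
have [a [a0 al fa]] : exists a, [/\ 0 < a, (a%:E < (N f + d)%:E)%E &
    (scaled_modular Phi a^-1 f <= 1)%E].
  by apply: luxemburg_lt; rewrite NphiE// lte_fin ltrDl.
rewrite lte_fin in al.
have ac : cabs (a^-1%:C%C : C) = a^-1 by rewrite cabs_real gtr0_norm// invr_gt0.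
have mfa : cmeasurable (fun t => a^-1%:C%C * f t) by exact: cmeasurableZ.
have : (norm1 mu (fun t => (a^-1%:C%C * f t) * g t)%R <= (O g)%:E)%E.
  rewrite -OpsiE//; apply: orlicz_ubound => //.
  apply: le_trans fa; apply: scaled_modular_le => //; first by rewrite invr_ge0 ltW.
  by move=> t; rewrite cabsM ac mul1r.
move=> h; apply: (@le_trans _ _ (a%:E * (O g)%:E)%E).
  apply: le_trans (lee_wpmul2l _ h); last by rewrite lee_fin ltW.
  apply: norm1_le_dom; rewrite ?(ltW a0)//; [exact: cmeasurableM|exact: cmeasurableM|].
  by move=> t; rewrite !cabsM ac !mulrA divff ?mul1r// gt_eqF.
rewrite -EFinM -EFinD lee_fin.
apply: (@le_trans _ _ ((N f + d) * O g)); first by rewrite ler_wpM2r// ltW.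
rewrite mulrDl lerD2l /d mulrAC ler_pdivrMr// ler_pM2l//; lra.
Qed.

Lemma scaled_modular_mulgl (a : R) f (x : G) : cmeasurable f -> 0 <= a ->
  scaled_modular Phi a (fun t => f (x * t)%g) = scaled_modular Phi a f.
Proof.
move=> mf a0.
apply: (ge0_integral_mulgl haar x (F := fun t => Phi (a * cabs (f t)))).
  by apply: measurable_young_cabs.
by move=> t; exact: young_ge0.
Qed.

Lemma LOrlicz_mulgl f (x : G) : LPhi f -> LPhi (fun t => f (x * t)%g).
Proof.
move=> [mf [a a0 fa]]; split; first exact: cmeasurable_translate.
by exists a => //; have := scaled_modular_mulgl x mf (ltW a0); rewrite /scaled_modular => ->.
Qed.

Lemma Nphi_mulgl f (x : G) : LPhi f -> N (fun t => f (x * t)%g) <= N f.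
Proof.
move=> Lf; have [mf _] := Lf; have Lx := LOrlicz_mulgl x Lf.
apply/ler_addgt0Pr => e e0.
have [a [a0 al fa]] : exists a, [/\ 0 < a, (a%:E < (N f + e)%:E)%E &
    (scaled_modular Phi a^-1 f <= 1)%E].
  by apply: luxemburg_lt; rewrite NphiE// lte_fin ltrDl.
rewrite lte_fin in al; apply: le_trans (ltW al).
rewrite -lee_fin -NphiE//; apply: luxemburg_scaled_modular => //.
by rewrite scaled_modular_mulgl// invr_ge0 ltW.
Qed.

Lemma holder_mulgl f g (t : G) : LPhi f -> LPsi g ->
  (norm1 mu (fun s => f s * g (t^-1 * s)%g)%R <= (N f * O g)%:E)%E.
Proof.
move=> Lf Lg; have [mf _] := Lf; have [mg _] := Lg.
have mfg : cmeasurable (fun s => f s * g (t^-1 * s)%g).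
  by apply: cmeasurableM => //; exact: cmeasurable_translate.
rewrite -(norm1_mulgl haar t mfg).
have -> : (fun s => f (t * s)%g * g (t^-1 * (t * s))%g) =
    (fun s => f (t * s)%g * g s) by apply/funext => s; rewrite mulKg.
apply: le_trans (holder (LOrlicz_mulgl t Lf) Lg) _.
by rewrite lee_fin ler_wpM2r ?Opsi_ge0 ?Nphi_mulgl.
Qed.

Lemma conv_cintegrable f g t : LPhi f -> LPsi g ->
  cintegrable mu (fun s => f s * g (t^-1 * s)%g).
Proof.
move=> Lf Lg; have [mf _] := Lf; have [mg _] := Lg; split.
  by apply: cmeasurableM => //; exact: cmeasurable_translate.
by apply: le_lt_trans (holder_mulgl t Lf Lg) _; rewrite ltry.
Qed.

Lemma cabs_conv f g t : LPhi f -> LPsi g ->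
  cabs (Defs.conv mu f (check g) t) <= 2 * (N f * O g).
Proof.
move=> Lf Lg; rewrite convE; apply: cabs_cintegral_le.
  exact: conv_cintegrable.
exact: holder_mulgl.
Qed.

Lemma LOrlicz0 (P : R -> \bar R) : young_function P -> LOrlicz mu P (fun=> 0).
Proof.
move=> yP; split; first exact: cmeasurable_cst.
exists 1 => //; under eq_integral do rewrite cabs0 mulr0.
by case: yP => _ _ _ -> _; rewrite integral0.
Qed.

Lemma Nphi0 : N (fun=> 0) = 0.
Proof.
apply/eqP; rewrite eq_le Nphi_ge0 andbT -(mul0r (N (fun=> 0))).
apply: (Nphi_dom yPhi (LOrlicz0 yPhi) _ (lexx 0)); first exact: cmeasurable_cst.
by move=> t; rewrite cabs0 mulr0.
Qed.

(** The exact form of the hypothesis on [P] matters when [P] takes infinite values: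
a bounded function can then only be scaled into the region where [P] is finite. *)
Lemma Cc_LOrlicz (P : R -> \bar R) f : young_function P ->
  (exists2 s : R, 0 < s & (P s < +oo)%E) -> Cc f -> LOrlicz mu P f.
Proof.
move=> yP [s s0 Ps] Cf; have mf := Cc_cmeasurable Cf; split=> //.
have [b b0 fb] := Cc_bounded Cf.
case: Cf => _ [K cK fK]; have mK := borel_compact hG cK.
exists (s / b); first exact: divr_gt0.
have [p pE] : exists p, P s = p%:E.
  by exists (fine (P s)); rewrite fineK// ge0_fin_numE// young_ge0.
have p0 : 0 <= p by rewrite -lee_fin -pE young_ge0.
apply: (@le_lt_trans _ _ (\int[mu]_t (p%:E * (\1_(K : set (borel G)) t)%:E))%E).
  apply: ge0_le_integral => //.
  - by move=> t _; exact: young_ge0.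
  - by apply: measurable_young_cabs; rewrite ?divr_ge0// ltW.
  - by apply: measurable_funeM; apply/measurable_EFinP; exact: measurable_indic.
  - move=> t _; have [Kt|nKt] := pselect (K t).
      rewrite indicE mem_set// mule1 -pE; apply: young_le => //.
      apply/andP; split; first by rewrite mulr_ge0 ?divr_ge0 ?cabs_ge0// ltW.
      by rewrite mulrAC ler_pdivrMr// ler_wpM2l// ltW.
    rewrite fK// cabs0 mulr0; case: yP => _ _ _ -> _.
    by rewrite mule_ge0// lee_fin.
rewrite ge0_integralZl_EFin//; first last.
- by apply/measurable_EFinP; exact: measurable_indic.
rewrite integral_indic// setIT lte_mul_pinfty// ?lee_fin//.
exact: haar_compact.
Qed.

Lemma Cc_LPhi f : Cc f -> LPhi f.
Proof. by apply: Cc_LOrlicz => //; apply: young_lty => //; rewrite -compl. Qed.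

Lemma Cc_LPsi f : Cc f -> LPsi f.
Proof. by apply: Cc_LOrlicz => //; rewrite compl; exact: complementary_lty. Qed.

End ComplementaryPair.
End OrliczNorms.

(** * Rearrangement of double series *)

Section DoubleSums.

(** The pairs are enumerated by [pickle_inv], a partial function whose undefined
values are read as zero terms. *)
Definition in_square (N M k : nat) : bool :=
  if pickle_inv k is Some (n, m) then (n < N)%N && (m < M)%N else false.

Lemma sum_square (V : zmodType) (F : nat * nat -> V) (N M : nat) :
  exists K0 : nat, forall K : nat, (K0 <= K)%N ->
  \sum_(0 <= k < K | in_square N M k) oapp F 0 (pickle_inv k) =
  \sum_(0 <= n < N) \sum_(0 <= m < M) F (n, m).
Proof.
pose s1 := [seq pickle (n, m) | n <- iota 0 N, m <- iota 0 M].
exists (\max_(k <- s1) k).+1 => K leK.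
transitivity (\sum_(k <- s1) oapp F 0 (pickle_inv k)); last first.
  rewrite /s1 big_allpairs_dep /index_iota !subn0.
  by apply: eq_bigr => n _; apply: eq_bigr => m _; rewrite pickleK_inv.
rewrite -big_filter; apply: perm_big; apply: uniq_perm.
- by apply: filter_uniq; rewrite iota_uniq.
- apply: allpairs_uniq; rewrite ?iota_uniq// => -[n m] [n' m'] _ _.
  exact: (pcan_inj (@pickleK_inv (nat * nat)%type)).
- move=> k; rewrite mem_filter mem_index_iota leq0n /=.
  apply/andP/allpairsP => [[]|[[n m]]] /=.
    rewrite /in_square; case E : (pickle_inv k) => [[n m]|]// /andP[nN mM] _.
    exists (n, m); rewrite !mem_iota !add0n; split=> //.
    by have := pickle_invK (T := (nat * nat)%type) k; rewrite E.
  rewrite !mem_iota !add0n /= => -[nN mM ->]; rewrite /in_square pickleK_inv nN mM; split=> //.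
  apply: leq_trans leK; rewrite ltnS.
  apply: (@leq_bigmax_seq _ s1 xpredT id) => //.
  by apply/allpairsP; exists (n, m); rewrite /= !mem_iota !add0n.
Qed.

Lemma in_square_oapp (V : zmodType) (F : nat * nat -> V) (J : nat) :
  exists M0 : nat, forall N M k, (M0 <= N)%N -> (M0 <= M)%N -> (k < J)%N ->
  in_square N M k || (oapp F 0 (pickle_inv k) == 0).
Proof.
pose w k := if @pickle_inv (nat * nat)%type k is Some (n, m) then maxn n m else 0%N.
exists (\max_(k < J) w k).+1 => N M k hN hM kJ.
rewrite /in_square; case E : (pickle_inv k) => [[n m]|] /=; last by rewrite eqxx.
have h : (w k <= \max_(k < J) w k)%N.
  exact: (@leq_bigmax_cond _ xpredT (fun k : 'I_J => w k) (Ordinal kJ)).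
move: h; rewrite /w E geq_max => /andP[h1 h2].
by rewrite (leq_trans _ hN) ?ltnS// (leq_trans _ hM) ?ltnS.
Qed.



Lemma sum_pickle_le (R : realDomainType) (c : nat * nat -> R) (K : nat) :
  (forall p, 0 <= c p) -> exists N M : nat,
  \sum_(0 <= k < K) oapp c 0 (pickle_inv k) <=
  \sum_(0 <= n < N) \sum_(0 <= m < M) c (n, m).
Proof.
move=> c0; have [M0 hM0] := in_square_oapp c K.
have [K0 hK0] := sum_square c M0 M0.
exists M0, M0; rewrite -(hK0 (maxn K K0)) ?leq_maxr//.
rewrite [leRHS](big_cat_nat (n := K)) ?leq_maxl//=.
have oc0 k : 0 <= oapp c 0 (pickle_inv k) by case: (pickle_inv k).
apply: (@le_trans _ _ (\sum_(0 <= k < K | in_square M0 M0 k) oapp c 0 (pickle_inv k))).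
  rewrite [leRHS]big_mkcond/=; apply: ler_sum_nat => k /andP[_ kK].
  by have := hM0 M0 M0 k (leqnn _) (leqnn _) kK; case: in_square => //= /eqP ->.
by rewrite lerDl; apply: sumr_ge0.
Qed.

(** Rearrangement of an absolutely convergent double series.  Beyond [J] all terms
together are small, so a partial sum up to [J] is close to any square partial
sum containing it, and the latter tends to [l] row by row. *)
Lemma sum_pickle_cvg (R : realType) (a : nat * nat -> R[i]) (c : nat * nat -> R)
    (B : R) (u : nat -> R[i]) (l : R[i]) :
  (forall p, cabs (a p) <= c p) ->
  (forall N M, \sum_(0 <= n < N) \sum_(0 <= m < M) c (n, m) <= B) ->
  (forall n e, 0 < e -> exists M, forall m, (M <= m)%N ->
     cabs (\sum_(0 <= k < m) a (n, k) - u n) < e) ->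
  (forall e, 0 < e -> exists N, forall n, (N <= n)%N ->
     cabs (\sum_(0 <= k < n) u k - l) < e) ->
  forall e, 0 < e -> exists J, forall j, (J <= j)%N ->
     cabs (\sum_(0 <= k < j) oapp a 0 (pickle_inv k) - l) < e.
Proof.
move=> ac cB hu hl e e0.
have c0 p : 0 <= c p by apply: le_trans (ac p); exact: cabs_ge0.
pose ct k := oapp c 0 (@pickle_inv (nat * nat)%type k).
have ct0 k : 0 <= ct k by rewrite /ct; case: (pickle_inv k).
have ctB K : \sum_(0 <= k < K) ct k <= B.
  by have [N [M h]] := sum_pickle_le K c0; exact: le_trans h (cB N M).
pose S := [set \sum_(0 <= k < K) ct k | K in [set: nat]].
have hS : has_sup S.
  split; first by exists (\sum_(0 <= k < 0) ct k); exists 0%N.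
  by exists B => _ [K _ <-].
have e40 : 0 < e / 4 by rewrite divr_gt0.
have [_ [J0 _ <-] hJ0] := sup_adherent e40 hS.
exists J0 => J J0J.
have tail K : \sum_(J <= k < K) ct k <= e / 4.
  have [JK|/ltnW KJ] := leqP J K; last by rewrite big_geq// ltW.
  have h1 : \sum_(0 <= k < K) ct k <= sup S by apply: sup_upper_bound => //; exists K.
  have h2 : \sum_(0 <= k < J0) ct k <= \sum_(0 <= k < J) ct k.
    by rewrite [leRHS](big_cat_nat (n := J0))//= lerDl sumr_ge0.
  rewrite (big_cat_nat (n := J))//= in h1; lra.
have [M0 hM0] := in_square_oapp a J.
have [N1 hN1] := hl _ e40.
(* the square must contain all pairs enumerated before [J] *)
pose N := maxn M0 N1.
have N0 : 0 < (N%:R + 1 : R) by rewrite ltr_wpDl.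
have eN : 0 < e / 4 / (N%:R + 1) by rewrite divr_gt0.
have [m_ hm_] := choice (fun n => hu n _ eN).
pose M := maxn M0 (\max_(n < N) m_ n).
have [K0 hK0] := sum_square a N M.
pose K := maxn J K0.
have h1 : cabs (\sum_(0 <= n < N) u n - l) < e / 4.
  by apply: hN1; rewrite leq_maxr.
have h2 : cabs (\sum_(0 <= n < N) \sum_(0 <= m < M) a (n, m) -
    \sum_(0 <= n < N) u n) <= e / 4.
  rewrite -sumrB; apply: le_trans (cabs_sum _ _ _) _.
  apply: (@le_trans _ _ (\sum_(0 <= n < N) e / 4 / (N%:R + 1))).
    apply: ler_sum_nat => n /andP[_ nN].
    apply/ltW/hm_; apply: leq_trans (leq_maxr _ _).
    exact: (@leq_bigmax_cond _ xpredT (fun n : 'I_N => m_ n) (Ordinal nN)).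
  rewrite sumr_const_nat subn0 -(mulr_natr (e / 4 / _)) -mulrA ler_piMr ?(ltW e40)//.
  by rewrite mulrC ler_pdivrMr// mul1r lerDl.
have h3 : cabs (\sum_(0 <= k < J) oapp a 0 (pickle_inv k) -
    \sum_(0 <= n < N) \sum_(0 <= m < M) a (n, m)) <= e / 4.
  rewrite -(hK0 K) ?leq_maxr// [X in _ - X](big_cat_nat (n := J)) ?leq_maxl//=.
  have -> : \sum_(0 <= i < J | in_square N M i) oapp a 0 (pickle_inv i) =
      \sum_(0 <= k < J) oapp a 0 (pickle_inv k).
    rewrite [LHS]big_mkcond/=; apply: eq_big_nat => k /andP[_ kJ].
    by have := hM0 N M k (leq_maxl _ _) (leq_maxl _ _) kJ; case: in_square => //= /eqP ->.
  rewrite opprD addNKr cabsN; apply: le_trans (cabs_sum _ _ _) _.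
  apply: le_trans (tail K); rewrite big_mkcond/=; apply: ler_sum => k _.
  case: in_square; last exact: ct0.
  by rewrite /ct; case: (pickle_inv k) => [p|] /=; [exact: ac|exact: (eq_ind_r (fun x => x <= 0) (lexx 0) cabs0)].
set x := \sum_(0 <= k < J) _ in h3 *.
set y := \sum_(0 <= n < N) \sum_(0 <= m < M) _ in h2 h3 *.
set z := \sum_(0 <= n < N) u n in h1 h2 *.
have -> : x - l = (x - y) + ((y - z) + (z - l)) by ring.
have t1 := ler_cabsD (x - y) ((y - z) + (z - l)).
have t2 := ler_cabsD (y - z) (z - l).
lra.
Qed.

End DoubleSums.

(** * Series representations of elements of the Figa-Talamanca algebra *)

Section Representations.
Context {R : realType} {G : topologicalGroupType}.
Variable mu : {measure set (borel G) -> \bar R}.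
Variables Phi Psi : R -> \bar R.
Hypothesis yPhi : young_function Phi.
Hypothesis yPsi : young_function Psi.
Hypothesis compl : Psi = complementary Phi.
Hypothesis hG : hausdorff_space G.
Hypothesis haar : left_haar_measure mu.
Local Notation C := R[i].
Local Notation LPhi := (LOrlicz mu Phi).
Local Notation LPsi := (LOrlicz mu Psi).
Local Notation N := (Nphi mu Phi).
Local Notation O := (Opsi mu Phi).
Local Notation conv := (Defs.conv mu).
Implicit Types (f g u : G -> C).

Definition seq_cvg (x : nat -> C) (l : C) :=
  forall e : R, 0 < e -> exists J, forall j, (J <= j)%N -> cabs (x j - l) < e.

(** [Rep c u]: some series representation of [u], as in the definition of the
Figa-Talamanca-Herz algebra, has cost at most [c].  Costs are expressed by real
partial sums, and continuity of [u] is a separate matter ([A_PhiP]). *)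
Definition Rep (c : R) u := exists f g : nat -> G -> C,
  [/\ forall n, LPhi (f n), forall n, LPsi (g n),
      forall n, \sum_(0 <= k < n) N (f k) * O (g k) <= c
    & forall t, seq_cvg (fun n => \sum_(0 <= k < n) conv (f k) (check (g k)) t) (u t)].

Lemma Rep_le (c c' : R) u : c <= c' -> Rep c u -> Rep c' u.
Proof.
move=> cc [f [g [Lf Lg fg fu]]]; exists f, g; split=> // n.
exact: le_trans (fg n) cc.
Qed.

Lemma Rep_ext (c : R) u v : u =1 v -> Rep c u -> Rep c v.
Proof. by move/funext => ->. Qed.

Lemma conv0 t : conv (fun=> 0) (check (fun=> 0)) t = 0.
Proof.
rewrite convE -[RHS](cintegral0 mu); apply: eq_cintegral => s.
by rewrite mul0r.
Qed.

Lemma Rep_single (c : R) f g : LPhi f -> LPsi g -> N f * O g <= c ->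
  Rep c (conv f (check g)).
Proof.
move=> Lf Lg fgc.
pose z : G -> C := fun=> 0.
exists (fun n => if n is 0 then f else z), (fun n => if n is 0 then g else z).
split=> [[|n]|[|n]|n|t e e0] //; try exact: LOrlicz0.
- case: n => [|n].
    by rewrite big_nil (le_trans _ fgc)// mulr_ge0 ?Nphi_ge0 ?Opsi_ge0.
  rewrite big_nat_recl//= big1 ?addr0// => i _.
  by rewrite Nphi0// mul0r.
- exists 1%N => -[//|j] _; rewrite big_nat_recl//= big1 ?addr0 ?subrr ?cabs0// => i _.
  exact: conv0.
Qed.

(** Completeness of the algebra, in concrete form: a representation of the sum is
obtained by enumerating all terms of all the given representations. *)
Lemma Rep_series (c : nat -> R) (B : R) (v : nat -> G -> C) u :
  (forall n, Rep (c n) (v n)) -> (forall n, \sum_(0 <= k < n) c k <= B) ->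
  (forall t, seq_cvg (fun n => \sum_(0 <= k < n) v k t) (u t)) -> Rep B u.
Proof.
move=> /choice[f /choice[g fg]] cB vu.
pose F (p : nat * nat) := f p.1 p.2; pose H (p : nat * nat) := g p.1 p.2.
pose w p := N (F p) * O (H p).
have LF p : LPhi (F p) by have [h _ _ _] := fg p.1; exact: h.
have LH p : LPsi (H p) by have [_ h _ _] := fg p.1; exact: h.
have w0 p : 0 <= w p by rewrite mulr_ge0 ?Nphi_ge0 ?Opsi_ge0.
have wB n m : \sum_(0 <= i < n) \sum_(0 <= j < m) w (i, j) <= B.
  apply: le_trans (cB n); apply: ler_sum => i _.
  by have [_ _ h _] := fg i; exact: h.
pose z : G -> C := fun=> 0.
exists (fun k => oapp F z (pickle_inv k)), (fun k => oapp H z (pickle_inv k)).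
split.
- by move=> k; case: (pickle_inv k) => [p|]; [exact: LF|exact: LOrlicz0].
- by move=> k; case: (pickle_inv k) => [p|]; [exact: LH|exact: LOrlicz0].
- move=> n; have [n1 [m1 h]] := sum_pickle_le n w0.
  apply: le_trans (le_trans h (wB n1 m1)).
  rewrite le_eqVlt; apply/orP; left; apply/eqP; apply: eq_bigr => k _.
  by case: (pickle_inv k) => //=; rewrite Nphi0// mul0r.
- move=> t e e0.
  pose a p := conv (F p) (check (H p)) t.
  have [||||J hJ] := @sum_pickle_cvg R a (fun p => 2 * w p) (2 * B) (fun n => v n t) (u t) _ _ _ _ e e0.
  + by move=> p; exact: (cabs_conv yPhi yPsi compl haar).
  + move=> n m; rewrite (eq_bigr (fun i => 2 * \sum_(0 <= j < m) w (i, j))).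
      by rewrite -mulr_sumr ler_pM2l.
    by move=> i _; rewrite mulr_sumr.
  + by move=> n d d0; have [_ _ _ h] := fg n; exact: h.
  + exact: vu.
  exists J => j Jj; rewrite (eq_bigr (fun k => oapp a 0 (pickle_inv k))); first exact: hJ.
  by move=> k _; case: (pickle_inv k) => //=; exact: conv0.
Qed.

Lemma seq_cvg_eventually (x : nat -> C) (l : C) (J : nat) :
  (forall j, (J <= j)%N -> x j = l) -> seq_cvg x l.
Proof. by move=> h e e0; exists J => j /h ->; rewrite subrr cabs0. Qed.

Lemma Rep0 : Rep 0 (fun=> 0).
Proof.
have L0 P : young_function P -> LOrlicz mu P (fun=> 0) by exact: LOrlicz0.
have := @Rep_single 0 (fun=> 0) (fun=> 0) (L0 _ yPhi) (L0 _ yPsi).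
rewrite Nphi0// mul0r => /(_ (lexx 0)).
by rewrite (_ : conv _ _ = (fun=> 0)) //; apply/funext => t; exact: conv0.
Qed.

Lemma Rep_sum (n : nat) (c : nat -> R) (v : nat -> G -> C) :
  (forall i, (i < n)%N -> Rep (c i) (v i)) -> (forall i, (i < n)%N -> 0 <= c i) ->
  Rep (\sum_(i < n) c i) (fun t => \sum_(i < n) v i t).
Proof.
move=> hv c0.
pose c' i := if (i < n)%N then c i else 0.
pose v' i t := if (i < n)%N then v i t else 0 : C.
have sum_lt (V : nmodType) (x : nat -> V) m : (n <= m)%N ->
    \sum_(0 <= k < m) (if (k < n)%N then x k else 0) = \sum_(i < n) x i.
  move=> nm; rewrite (big_cat_nat (n := n))//= [X in _ + X]big1_seq ?addr0.
    by rewrite big_mkord; apply: eq_bigr => i _; rewrite ltn_ord.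
  by move=> k; rewrite mem_index_iota => /andP[_ /andP[nk _]]; rewrite ltnNge nk.
apply: (@Rep_series c' _ v').
- move=> k; rewrite /c' /v'; case: ifPn => kn; first exact: hv.
  exact: Rep0.
- move=> m; rewrite -(sum_lt _ c (maxn n m)) ?leq_maxl//.
  rewrite [leRHS](big_cat_nat (n := m)) ?leq_maxr//= lerDl.
  by apply: sumr_ge0 => k _; case: ifPn => // kn; exact: c0.
- by move=> t; apply: (seq_cvg_eventually (J := n)) => j nj; exact: sum_lt.
Qed.

Lemma Rep_add (c d : R) u v : 0 <= c -> 0 <= d -> Rep c u -> Rep d v ->
  Rep (c + d) (fun t => u t + v t).
Proof.
move=> c0 d0 hu hv.
have := @Rep_sum 2 (fun i => if i is 0 then c else d) (fun i => if i is 0 then u else v).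
rewrite !big_ord_recl big_ord0 addr0 /=.
rewrite (_ : (fun t => \sum_(i < 2) _) = (fun t => u t + v t)); last first.
  by apply/funext => t; rewrite !big_ord_recl big_ord0 addr0.
by apply; case.
Qed.

Lemma convZl (z : C) f g t : LPhi f -> LPsi g ->
  conv (fun s => z * f s) (check g) t = z * conv f (check g) t.
Proof.
move=> Lf Lg; rewrite !convE -cintegralZ; last exact: (conv_cintegrable yPhi yPsi compl haar).
by apply: eq_cintegral => s; rewrite mulrA.
Qed.

Lemma Rep_scale (z : C) (c : R) u : Rep c u ->
  Rep (cabs z * c) (fun t => z * u t).
Proof.
move=> [f [g [Lf Lg fg fu]]]; exists (fun n t => z * f n t), g; split=> //.
- move=> n; have [mf _] := Lf n.
  apply: (LOrlicz_dom yPhi (Lf n) _ (cabs_ge0 z)); first exact: cmeasurableZ.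
  by move=> t; rewrite cabsM.
- move=> n; apply: le_trans (ler_wpM2l (cabs_ge0 z) (fg n)).
  rewrite mulr_sumr; apply: ler_sum => k _; rewrite mulrA.
  apply: ler_wpM2r; first exact: Opsi_ge0.
  have [mf _] := Lf k.
  apply: (Nphi_dom yPhi (Lf k) _ (cabs_ge0 z)); first exact: cmeasurableZ.
  by move=> t; rewrite cabsM.
- move=> t e e0; have z1 : 0 < cabs z + 1 by rewrite ltr_wpDl ?cabs_ge0.
  have [J hJ] := fu t _ (divr_gt0 e0 z1); exists J => j /hJ h.
  rewrite (eq_bigr (fun k => z * conv (f k) (check (g k)) t)); last first.
    by move=> k _; exact: convZl.
  rewrite -mulr_sumr -mulrBr cabsM; move: h; rewrite ltr_pdivlMr//.
  apply: le_lt_trans; rewrite mulrC ler_wpM2l ?cabs_ge0//; lra.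
Qed.

Lemma A_PhiP u : A_Phi mu Phi Psi u <->
  continuous (u : G -> C^o) /\ exists c, Rep c u.
Proof.
split=> [[cu [f [g [Lf Lg fin fu]]]]|[cu [c [f [g [Lf Lg fgc fu]]]]]]; split=> //.
  have w0 n : (0 <= luxemburg_norm mu Phi (f n) * orlicz_norm mu Phi (g n))%E.
    by rewrite mule_ge0 ?luxemburg_ge0// orlicz_ge0.
  set S := (\sum_(0 <= n <oo) _)%E in fin.
  have S0 : (0 <= S)%E by apply: nneseries_ge0.
  exists (fine S), f, g; split=> //.
  - move=> n; rewrite -lee_fin fineK ?ge0_fin_numE// -sumEFin.
    apply: (@le_trans _ _ (\sum_(0 <= k < n)
        luxemburg_norm mu Phi (f k) * orlicz_norm mu Phi (g k))%E).
      apply: lee_sum => k _.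
      by rewrite EFinM (NphiE yPhi (Lf k)) (OpsiE yPhi yPsi compl (Lg k)).
    exact: nneseries_lim_ge.
  - move=> t e e0; have /cabs_cvgE/(_ e e0)[J _ hJ] := fu t.
    by exists J => j Jj; exact: hJ.
exists f, g; split=> //.
- apply: (@le_lt_trans _ _ c%:E); last by rewrite ltry.
  apply: lime_le; first by apply: is_cvg_nneseries => n _ _; rewrite mule_ge0 ?luxemburg_ge0// orlicz_ge0.
  apply: nearW => n.
  apply: (@le_trans _ _ (\sum_(0 <= k < n) N (f k) * O (g k))%:E); last first.
    by rewrite lee_fin.
  rewrite -sumEFin; apply: lee_sum => k _.
  by rewrite EFinM (NphiE yPhi (Lf k)) (OpsiE yPhi yPsi compl (Lg k)).
- move=> t; apply/cabs_cvgE => e e0; have [J hJ] := fu t e e0.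
  by exists J => // j /= Jj; exact: hJ.
Qed.

End Representations.

(** * Interchange of integrals *)

Section CompactlySupportedCoefficients.
Context {R : realType} {G : topologicalGroupType}.
Variable mu : {measure set (borel G) -> \bar R}.
Hypothesis hG : hausdorff_space G.
Hypothesis haar : left_haar_measure mu.
Local Notation C := R[i].
Local Notation conv := (Defs.conv mu).
Implicit Types (f g u phi : G -> C).

Lemma mesh_sum (n i : nat) (E : nat -> set (borel G)) (a : nat -> C) (t : G) :
  (i < n)%N -> E i t -> (forall j, E j t -> j = i) ->
  \sum_(j < n) \1_(E j) t * a j = a i.
Proof.
move=> ni Ei uniqE; rewrite (bigD1 (Ordinal ni))//= indic_mem// mul1r.
rewrite big1 ?addr0// => j ji; rewrite indic_nmem ?mul0r// => /uniqE h.
by move/eqP : ji; apply; apply: val_inj.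
Qed.

(** The Borel sets of [G * G] need not be generated by rectangles, so Fubini's
theorem for product measures does not apply.  Instead [g (t^-1 s)] is replaced
on each cell of a fine mesh of the support of [f] by [g (t^-1 r_j)]: then both
iterated integrals become the same finite sum, and by uniform continuity each
of them moved by at most a multiple of the mesh tolerance. *)
Lemma fubini_Cc phi f g : cintegrable mu phi -> Cc f -> Cc g ->
  cintegral mu (fun s => f s * conv phi g s) =
  cintegral mu (fun t => phi t * conv f (check g) t).
Proof.
move=> phii Cf Cg; have fi := Cc_cintegrable hG haar Cf.
have [b b0 gb] := Cc_bounded Cg.
have mg := Cc_cmeasurable Cg; have mf := Cc_cmeasurable Cf.
have [_ [K cK fK]] := Cf.
pose a := fine (norm1 mu f); pose d := fine (norm1 mu phi).
have a0 : 0 <= a by rewrite fine_ge0// norm1_ge0.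
have d0 : 0 <= d by rewrite fine_ge0// norm1_ge0.
have mphig : cmeasurable (conv phi g).
  by apply: continuous_cmeasurable; exact: conv_continuous_right.
have mfg : cmeasurable (conv f (check g)).
  by apply: continuous_cmeasurable; exact: conv_continuous.
have phigi s : cintegrable mu (fun t => phi t * g (t^-1 * s)%g).
  apply: (@bounded_cintegrable _ _ _ phi (fun t => g (t^-1 * s)%g) b) => //.
  exact: Cc_cmeasurable_invg.
have fgi t : cintegrable mu (fun s => f s * g (t^-1 * s)%g).
  apply: (@bounded_cintegrable _ _ _ f _ b) => //.
  exact: cmeasurable_translate.
have phigb s : cabs (conv phi g s) <= 2 * b * d.
  apply: cabs_cintegral_dom => //; [by case: (phigi s)|exact: ltW|].
  by move=> t; rewrite cabsM mulrC ler_wpM2r ?cabs_ge0.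
have fgb t : cabs (conv f (check g) t) <= 2 * b * a.
  rewrite convE; apply: cabs_cintegral_dom => //; [by case: (fgi t)|exact: ltW|].
  by move=> s; rewrite cabsM mulrC ler_wpM2r ?cabs_ge0.
suff H e : 0 < e -> cabs (cintegral mu (fun s => f s * conv phi g s) -
    cintegral mu (fun t => phi t * conv f (check g) t)) <= 8 * a * d * e.
  apply/eqP; rewrite -subr_eq0; apply/eqP/cabs0_eq0/eqP.
  rewrite eq_le cabs_ge0 andbT; apply/ler_addgt0Pr => e e0.
  have k0 : 0 < 8 * a * d + 1 by rewrite ltr_wpDl// !mulr_ge0.
  apply: le_trans (H _ (divr_gt0 e0 k0)) _; rewrite add0r mulrCA ger_pMr//.
  by rewrite ler_pdivrMr// mul1r lerDl.
move=> e0; have [W [oW W1 gW]] := uniform_continuity_right Cg e0.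
have [n [r [E [mE EW rK cov]]]] := mesh hG cK oW W1.
pose I j := cintegral mu (fun s => f s * \1_(E j) s).
have fEi j : cintegrable mu (fun s => f s * \1_(E j) s).
  apply: (@bounded_cintegrable _ _ _ f _ 1) => //; first exact: cmeasurable_indic.
  by move=> s; exact: cabs_indic.
(* the two inner integrals after discretization in [s] *)
pose P s := \sum_(j < n) \1_(E j) s * conv phi g (r j).
pose Q t := \sum_(j < n) I j * g (t^-1 * r j)%g.
have PQ : cintegral mu (fun s => f s * P s) = cintegral mu (fun t => phi t * Q t).
  transitivity (\sum_(j < n) conv phi g (r j) * I j).
    rewrite (@eq_cintegral _ _ mu _ (fun s => \sum_(j < n) conv phi g (r j) * (f s * \1_(E j) s))).
      rewrite cintegral_sum; last by move=> j; exact: cintegrableZ.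
      by apply: eq_bigr => j _; rewrite cintegralZ.
    by move=> s; rewrite mulr_sumr; apply: eq_bigr => j _; ring.
  rewrite (@eq_cintegral _ _ mu _ (fun t => \sum_(j < n) I j * (phi t * g (t^-1 * r j)%g))).
    rewrite cintegral_sum; last by move=> j; exact: cintegrableZ.
    by apply: eq_bigr => j _; rewrite cintegralZ// mulrC.
  by move=> s; rewrite mulr_sumr; apply: eq_bigr => j _; ring.
have fPhi_i : cintegrable mu (fun s => f s * conv phi g s).
  exact: bounded_cintegrable phigb.
have phif_i : cintegrable mu (fun t => phi t * conv f (check g) t).
  exact: bounded_cintegrable fgb.
have fPi : cintegrable mu (fun s => f s * P s).
  rewrite (_ : (fun s => f s * P s) = fun s => \sum_(j < n) conv phi g (r j) * (f s * \1_(E j) s)).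
    by apply: cintegrable_sum => j; exact: cintegrableZ.
  by apply/funext => s; rewrite mulr_sumr; apply: eq_bigr => j _; ring.
have phiQi : cintegrable mu (fun t => phi t * Q t).
  rewrite (_ : (fun t => phi t * Q t) = fun t => \sum_(j < n) I j * (phi t * g (t^-1 * r j)%g)).
    by apply: cintegrable_sum => j; exact: cintegrableZ.
  by apply/funext => s; rewrite mulr_sumr; apply: eq_bigr => j _; ring.
have hP : cabs (cintegral mu (fun s => f s * conv phi g s) -
    cintegral mu (fun s => f s * P s)) <= 4 * a * d * e.
  rewrite -cintegralB//.
  have e2 : 0 <= 2 * e * d by rewrite !mulr_ge0// ltW.
  rewrite (_ : 4 * a * d * e = 2 * (2 * e * d) * a); last by ring.
  apply: cabs_cintegral_dom => //; first by case: (cintegrableB fPhi_i fPi).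
  move=> s; have [Ks|nKs] := pselect (K s); last first.
    by rewrite fK// !mul0r subr0 cabs0 mulr0.
  have [i ni [Ei uE]] := cov s Ks.
  rewrite -mulrBr cabsM mulrC ler_wpM2r ?cabs_ge0//.
  rewrite /P (mesh_sum (fun j => conv phi g (r j)) ni Ei uE) -cintegralB//.
  apply: cabs_cintegral_dom => //; [|exact: ltW|].
    by case: (cintegrableB (phigi s) (phigi (r i))).
  move=> t; rewrite -mulrBr cabsM mulrC ler_wpM2r ?cabs_ge0//.
  have -> : (t^-1 * s = (t^-1 * r i) * ((r i)^-1 * s))%g by rewrite -mulgA mulVKg.
  by apply/ltW/gW; case: (EW _ _ Ei).
have hQ : cabs (cintegral mu (fun t => phi t * conv f (check g) t) -
    cintegral mu (fun t => phi t * Q t)) <= 4 * a * d * e.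
  rewrite -cintegralB//.
  have e2 : 0 <= 2 * e * a by rewrite !mulr_ge0// ltW.
  rewrite (_ : 4 * a * d * e = 2 * (2 * e * a) * d); last by ring.
  apply: cabs_cintegral_dom => //; first by case: (cintegrableB phif_i phiQi).
  move=> t; rewrite -mulrBr cabsM mulrC ler_wpM2r ?cabs_ge0//.
  have fEgi j : cintegrable mu (fun s => g (t^-1 * r j)%g * (f s * \1_(E j) s)).
    exact: cintegrableZ.
  have -> : Q t = cintegral mu (fun s => \sum_(j < n) g (t^-1 * r j)%g * (f s * \1_(E j) s)).
    rewrite cintegral_sum//; apply: eq_bigr => j _.
    by rewrite cintegralZ// mulrC.
  have sumi : cintegrable mu (fun s => \sum_(j < n) g (t^-1 * r j)%g * (f s * \1_(E j) s)).
    exact: cintegrable_sum.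
  rewrite convE -cintegralB//.
  apply: cabs_cintegral_dom => //; [|exact: ltW|].
    by case: (cintegrableB (fgi t) sumi).
  move=> s; have [Ks|nKs] := pselect (K s); last first.
    rewrite fK// !mul0r sub0r cabsN big1 ?cabs0 ?mulr0// => j _.
    by rewrite mul0r mulr0.
  have [i ni [Ei uE]] := cov s Ks.
  rewrite (_ : \sum_(j < n) _ = f s * \sum_(j < n) \1_(E j) s * g (t^-1 * r j)%g); last first.
    by rewrite mulr_sumr; apply: eq_bigr => j _; ring.
  rewrite (mesh_sum (fun j => g (t^-1 * r j)%g) ni Ei uE) -mulrBr cabsM mulrC ler_wpM2r ?cabs_ge0//.
  have -> : (t^-1 * s = (t^-1 * r i) * ((r i)^-1 * s))%g by rewrite -mulgA mulVKg.
  by apply/ltW/gW; case: (EW _ _ Ei).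
rewrite PQ in hP.
set x := cintegral mu (fun s => f s * conv phi g s) in hP *.
set y := cintegral mu (fun t => phi t * conv f (check g) t) in hQ *.
set z := cintegral mu (fun t => phi t * Q t) in hP hQ.
have -> : x - y = (x - z) - (y - z) by ring.
apply: le_trans (ler_cabsB _ _) _.
rewrite (_ : 8 * a * d * e = 4 * a * d * e + 4 * a * d * e); last by ring.
exact: (lerD hP hQ).
Qed.

End CompactlySupportedCoefficients.

(** * Coefficient functions in the first two algebras, and separation of points *)

Section Membership.
Context {R : realType} {G : topologicalGroupType}.
Variable mu : {measure set (borel G) -> \bar R}.
Variables Phi Psi : R -> \bar R.
Hypothesis yPhi : young_function Phi.
Hypothesis yPsi : young_function Psi.
Hypothesis compl : Psi = complementary Phi.
Hypothesis hG : hausdorff_space G.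
Hypothesis haar : left_haar_measure mu.
Local Notation C := R[i].
Local Notation LPhi := (LOrlicz mu Phi).
Local Notation LPsi := (LOrlicz mu Psi).
Local Notation N := (Nphi mu Phi).
Local Notation O := (Opsi mu Phi).
Local Notation conv := (Defs.conv mu).
Implicit Types (f g u : G -> C).

Lemma Cc_conv_continuous f g : Cc f -> Cc g ->
  continuous (conv f (check g) : G -> C^o).
Proof.
by move=> Cf Cg; apply: conv_continuous => //; exact: Cc_cintegrable.
Qed.

Lemma Cc_conv_A f g : Cc f -> Cc g -> A_Phi mu Phi Psi (conv f (check g)).
Proof.
move=> Cf Cg; apply/(A_PhiP mu yPhi yPsi compl); split.
  exact: Cc_conv_continuous.
exists (N f * O g); apply: Rep_single => //.
- exact: (Cc_LPhi yPhi yPsi compl).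
- exact: (Cc_LPsi yPhi yPsi compl).
Qed.

Lemma Opsi_le_op_norm S h : LPsi h -> O h <= 1 -> bounded_operator mu Phi Psi S ->
  ((O (S h))%:E <= op_norm mu Phi Psi S)%E.
Proof.
move=> Lh h1 [LS _ _ _]; rewrite -(OpsiE yPhi yPsi compl (LS _ Lh)).
apply: ereal_sup_ubound; exists h => //; split=> //.
by rewrite (OpsiE yPhi yPsi compl Lh) lee_fin.
Qed.

(** The function is represented by the functional [S |-> \int f * S g], which is bounded
by Hoelder's inequality.  Since [S] is homogeneous only almost everywhere, [g] is scaled
to [h = g / l] in the unit ball before [S] is applied, and the functional is multiplied by [l]. *)
Lemma Cc_conv_W f g : Cc f -> Cc g -> W_Phi mu Phi Psi (conv f (check g)).
Proof.
move=> Cf Cg; split; first exact: Cc_conv_continuous.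
have Lf := Cc_LPhi yPhi yPsi compl hG haar Cf.
have Lg := Cc_LPsi yPhi yPsi compl hG haar Cg.
pose l := O g + 1.
have l0 : 0 < l by rewrite ltr_wpDl// Opsi_ge0.
pose h := fun t => (l^-1)%:C%C * g t.
have Ch : Cc h by exact: Cc_Z.
have Lh := Cc_LPsi yPhi yPsi compl hG haar Ch.
have lV0 : 0 <= l^-1 by rewrite invr_ge0 ltW.
have h1 : O h <= 1.
  apply: le_trans (Opsi_dom yPhi yPsi compl Lg (Cc_cmeasurable Ch) lV0 _) _.
    by move=> t; rewrite cabsM cabs_real ger0_norm.
  by rewrite ler_pdivrMl// mulr1 lerDl.
have fSi S : PF_Psi mu Phi Psi S -> cintegrable mu (fun s => f s * S h s).
  move=> [[LS _ _ _] _]; have Li := LS _ Lh; split.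
    by apply: cmeasurableM; [exact: Cc_cmeasurable|case: Li].
  by apply: le_lt_trans (holder yPhi yPsi compl Lf Li) _; rewrite ltry.
exists (fun S => l%:C%C * cintegral mu (fun s => f s * S h s)).
  split.
    move=> a S T PS PT.
    rewrite (_ : (fun s => _) = (fun s => a * (f s * S h s) + f s * T h s)); last first.
      by apply/funext => s; ring.
    rewrite cintegralD; [|exact/cintegrableZ/fSi|exact: fSi].
    by rewrite cintegralZ; [ring|exact: fSi].
  exists (l * (2 * N f)) => S PS; have fi := fSi _ PS.
  have [BS _] := PS; have [LS _ _ _] := BS.
  apply: (@le_trans _ _ (l * (2 * (N f * O (S h))))%:E).
    rewrite lee_fin cabsM cabs_real (gtr0_norm l0) ler_pM2l//.
    apply: cabs_cintegral_le => //.
    exact: (holder yPhi yPsi compl Lf (LS _ Lh)).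
  rewrite !mulrA EFinM; apply: lee_wpmul2l.
    by rewrite lee_fin !mulr_ge0 ?Nphi_ge0// ltW.
  exact: Opsi_le_op_norm.
move=> phi phii; have fi := Cc_cintegrable hG haar Cf; split.
  apply: (@bounded_cintegrable _ _ _ phi _ (2 * (N f * O g))) => //.
    by apply: continuous_cmeasurable; exact: Cc_conv_continuous.
  by move=> t; exact: (cabs_conv yPhi yPsi compl haar).
have [b b0 hb] := Cc_bounded Ch.
have ki s : cintegrable mu (fun t => phi t * h (t^-1 * s)%g).
  apply: (@bounded_cintegrable _ _ _ phi (fun t => h (t^-1 * s)%g) b) => //.
  exact: Cc_cmeasurable_invg.
rewrite -(fubini_Cc hG haar phii Cf Cg) -cintegralZ; last first.
  apply: (@bounded_cintegrable _ _ _ f _ (2 * b * fine (norm1 mu phi))) => //.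
    by apply: continuous_cmeasurable; exact: conv_continuous_right.
  move=> s; apply: cabs_cintegral_dom => //; [by case: (ki s)|exact: ltW|].
  by move=> t; rewrite cabsM mulrC ler_wpM2r ?cabs_ge0.
apply: eq_cintegral => s; rewrite mulrCA; congr (_ * _).
rewrite /Defs.conv -cintegralZ; last exact: ki.
apply: eq_cintegral => t; rewrite /h mulrCA; congr (_ * _).
by rewrite mulrA -rmorphM divff ?gt_eqF// mul1r.
Qed.

End Membership.

Section Separation.
Context {R : realType} {G : topologicalGroupType}.
Variable mu : {measure set (borel G) -> \bar R}.
Hypothesis hG : hausdorff_space G.
Hypothesis lcG : locally_compact [set: G].
Hypothesis haar : left_haar_measure mu.
Local Notation C := R[i].
Local Notation conv := (Defs.conv mu).

Lemma Cc_real (k : G -> R) : continuous k ->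
  (exists2 K, compact K & forall t, ~ K t -> k t = 0) ->
  Cc (fun t => (k t)%:C%C : C).
Proof.
move=> ck [K cK kK]; split; last by exists K => // t /kK ->.
apply/cabs_continuousE => x e e0; have /cvgrPdist_lt/(_ e e0) := ck x.
by apply: filterS => t; rewrite distrC -rmorphB cabs_real.
Qed.

(** With a bump function [k] near the unit and [f] its translate to [y], the value at
[y] is [\int k ^ 2], and a nonzero value at [t] puts [t] in [y V V^-1]. *)
Lemma Cc_conv_separates (y : G) (U : set G) : nbhs y U ->
  exists f g : G -> C, [/\ Cc f, Cc g, conv f (check g) y != 0
    & forall t, ~ U t -> conv f (check g) t = 0].
Proof.
move=> nU.
have cm : continuous (fun p : G * G => (y * p.1 * p.2^-1)%g).
  apply: continuous_mulg; last by apply: continuous_invg => p; exact: cvg_snd.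
  by apply: continuous_mulg => p; [exact: cvg_cst|exact: cvg_fst].
have : nbhs (1%g : G, 1%g : G) ((fun p : G * G => (y * p.1 * p.2^-1)%g) @^-1` U).
  by apply: cm => /=; rewrite mulg1 invg1 mulg1.
move=> [[V1 V2] [/= nV1 nV2] sV].
have [k [ck k0 k1 kV kK]] := @bump_function R _ _ hG lcG (filterI nV1 nV2).
have Ck := Cc_real ck kK.
pose g t : C := (k t)%:C%C; pose f t : C := g (y^-1 * t)%g.
have Cf : Cc f by exact: Cc_translate.
exists f, g; split=> //; last first.
  move=> t nUt; rewrite convE -[RHS](cintegral0 mu); apply: eq_cintegral => s.
  rewrite /f /g -rmorphM.
  have [V1s|/kV ->] := pselect ((V1 `&` V2) (y^-1 * s)%g); last by rewrite mul0r.
  have [V2s|/kV ->] := pselect ((V1 `&` V2) (t^-1 * s)%g); last by rewrite mulr0.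
  exfalso; apply: nUt.
  have /= := sV ((y^-1 * s)%g, (t^-1 * s)%g) (conj V1s.1 V2s.2).
  by rewrite invgM invgK mulVKg mulVKg.
rewrite convE; have [b b0 gb] := Cc_bounded Ck.
have fi : cintegrable mu (fun s => f s * g (y^-1 * s)%g).
  apply: (@bounded_cintegrable _ _ _ f (fun s => g (y^-1 * s)%g) b) => //.
  + exact: Cc_cintegrable.
  + by apply: Cc_cmeasurable; exact: Cc_translate.
  + by move=> t; exact: gb.
apply/eqP => /(congr1 (@complex.Re R)); rewrite /cintegral /= => /eqP; apply/negP.
have -> : (\int[mu]_t complex.Re (f t * g (y^-1 * t)%g))%R =
    (\int[mu]_t (k (y^-1 * t)%g ^+ 2))%R.
  apply: eq_Rintegral => t _; rewrite /f /g -rmorphM /= expr2 //.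
rewrite gt_eqF// /Rintegral fine_gt0//.
pose S := [set t | 1 / 2 < k (y^-1 * t)%g].
have ckt : continuous (fun t => k (y^-1 * t)%g).
  move=> t; exact: (@continuous_comp _ _ _ (fun t => (y^-1 * t)%g) k t
    (@continuous_mulgl G (y^-1)%g t) (ck _)).
have oS : open S.
  rewrite (_ : S = (fun t => k (y^-1 * t)%g) @^-1` `]1 / 2, +oo[%classic); last first.
    by apply/seteqP; split=> t /=; rewrite in_itv/= andbT.
  by apply: open_comp => [t _|]; [exact: ckt|exact: interval_open].
have mS := borel_open oS.
apply/andP; split.
  apply: (@lt_le_trans _ _ (\int[mu]_t ((1/4)%:E * (\1_(S : set (borel G)) t)%:E))%E).
    rewrite ge0_integralZl_EFin//; last by apply/measurable_EFinP; exact: measurable_indic.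
    rewrite integral_indic// setIT mule_gt0//.
    by apply: (haar_open_gt0 hG haar oS (x := y)); rewrite /S /= mulVg k1; lra.
  apply: ge0_le_integral => //.
  - by apply: measurable_funeM; apply/measurable_EFinP; exact: measurable_indic.
  - apply/measurable_EFinP; apply: measurable_funX; exact: continuous_borel.
  - move=> t _; rewrite -EFinM lee_fin indicE.
    have [/set_mem St|_] := boolP (t \in S); last by rewrite mulr0 sqr_ge0.
    by move: St; rewrite /S /= mulr1; nra.
have [_ fin] := fi; apply: le_lt_trans fin; apply: ge0_le_integral => //.
- by move=> t _; rewrite lee_fin sqr_ge0.
- apply/measurable_EFinP; apply: measurable_funX; exact: continuous_borel.
- by apply: measurable_EFin_cabs; case: fi.
- by move=> t _; rewrite lee_fin /f /g -rmorphM cabs_real -expr2 ger0_norm// sqr_ge0.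
Qed.

End Separation.

(** * Averaging over signs *)

Section SchurMultipliers.
Context {R : realType} {G : topologicalGroupType}.
Variable mu : {measure set (borel G) -> \bar R}.
Variables Phi Psi : R -> \bar R.
Hypothesis yPhi : young_function Phi.
Hypothesis yPsi : young_function Psi.
Hypothesis compl : Psi = complementary Phi.
Hypothesis haar : left_haar_measure mu.
Local Notation C := R[i].
Local Notation LPhi := (LOrlicz mu Phi).
Local Notation LPsi := (LOrlicz mu Psi).
Local Notation N := (Nphi mu Phi).
Local Notation O := (Opsi mu Phi).
Local Notation conv := (Defs.conv mu).
Local Notation Rep := (Rep mu Phi Psi).
Implicit Types (f g u : G -> C).

Lemma LOrlicz_mul (P : R -> \bar R) f a (A : R) : young_function P ->
  LOrlicz mu P f -> cmeasurable a ->
  (forall t, cabs (a t) <= A) -> LOrlicz mu P (fun t => f t * a t).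
Proof.
move=> yP Lf ma aA; have [mf _] := Lf.
have A0 : 0 <= A by apply: le_trans (aA 1%g); exact: cabs_ge0.
apply: (LOrlicz_dom yP Lf _ A0); first exact: cmeasurableM.
by move=> t; rewrite cabsM mulrC ler_wpM2r ?cabs_ge0.
Qed.

Lemma Nphi_mul f a (A : R) : LPhi f -> cmeasurable a ->
  (forall t, cabs (a t) <= A) -> N (fun t => f t * a t) <= A * N f.
Proof.
move=> Lf ma aA; have [mf _] := Lf.
have A0 : 0 <= A by apply: le_trans (aA 1%g); exact: cabs_ge0.
apply: (Nphi_dom yPhi Lf _ A0); first exact: cmeasurableM.
by move=> t; rewrite cabsM mulrC ler_wpM2r ?cabs_ge0.
Qed.

Lemma Opsi_mul g a (A : R) : LPsi g -> cmeasurable a ->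
  (forall t, cabs (a t) <= A) -> O (fun t => g t * a t) <= A * O g.
Proof.
move=> Lg ma aA; have [mg _] := Lg.
have A0 : 0 <= A by apply: le_trans (aA 1%g); exact: cabs_ge0.
apply: (Opsi_dom yPhi yPsi compl Lg _ A0); first exact: cmeasurableM.
by move=> t; rewrite cabsM mulrC ler_wpM2r ?cabs_ge0.
Qed.

Section FixedPair.
Variables h k : G -> C.
Hypothesis Lh : LPhi h.
Hypothesis Lk : LPsi k.
Local Notation X := (N h * O k).

Let X_ge0 : 0 <= X.
Proof. by rewrite mulr_ge0 ?Nphi_ge0 ?Opsi_ge0. Qed.

Lemma conv_mul_cintegrable a b (A B : R) t : cmeasurable a -> cmeasurable b ->
  (forall t, cabs (a t) <= A) -> (forall t, cabs (b t) <= B) ->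
  cintegrable mu (fun s => (h s * a s) * (k (t^-1 * s)%g * b (t^-1 * s)%g)).
Proof.
move=> ma mb aA bB.
have := conv_cintegrable yPhi yPsi compl haar t
  (LOrlicz_mul yPhi Lh ma aA) (LOrlicz_mul yPsi Lk mb bB).
by [].
Qed.

(** The tensors [h a_i (x) k b_i] together cost no more than [A B] times [h (x) k]:
the sum of [a_i (x) b_i] is the average over all signs of the tensors
[(\sum e_i a_i) (x) (\sum e_i b_i)], whose factors are bounded by [A] and [B] pointwise.
Signs are inserted one at a time, [a0] and [b0] being the signed sums so far. *)
Lemma Rep_signs (A B : R) (n : nat) (a b : nat -> G -> C) :
  (forall i, cmeasurable (a i)) -> (forall i, cmeasurable (b i)) ->
  forall a0 b0, cmeasurable a0 -> cmeasurable b0 ->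
  (forall t, cabs (a0 t) + \sum_(i < n) cabs (a i t) <= A) ->
  (forall t, cabs (b0 t) + \sum_(i < n) cabs (b i t) <= B) ->
  Rep (A * B * X) (fun t =>
    conv (fun s => h s * a0 s) (check (fun s => k s * b0 s)) t +
    \sum_(i < n) conv (fun s => h s * a i s) (check (fun s => k s * b i s)) t).
Proof.
move=> ma mb; elim: n => [|n ih] a0 b0 ma0 mb0 hA hB.
  have {}hA t : cabs (a0 t) <= A by have := hA t; rewrite big_ord0 addr0.
  have {}hB t : cabs (b0 t) <= B by have := hB t; rewrite big_ord0 addr0.
  rewrite (_ : (fun t => _) =
    conv (fun s => h s * a0 s) (check (fun s => k s * b0 s))); last first.
    by apply/funext => t; rewrite big_ord0 addr0.
  apply: Rep_single => //; [exact: LOrlicz_mul hA|exact: LOrlicz_mul hB|].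
  rewrite mulrACA; apply: ler_pM; rewrite ?Nphi_ge0 ?Opsi_ge0//.
    exact: Nphi_mul.
  exact: Opsi_mul.
have half0 : 0 <= (2^-1 : R) by lra.
have hA1 (sg : C) : cabs sg = 1 -> forall t,
    cabs (a0 t + sg * a n t) + \sum_(i < n) cabs (a i t) <= A.
  move=> sg1 t; have := hA t; rewrite big_ord_recr /=.
  have := ler_cabsD (a0 t) (sg * a n t); rewrite cabsM sg1; lra.
have hB1 (sg : C) : cabs sg = 1 -> forall t,
    cabs (b0 t + sg * b n t) + \sum_(i < n) cabs (b i t) <= B.
  move=> sg1 t; have := hB t; rewrite big_ord_recr /=.
  have := ler_cabsD (b0 t) (sg * b n t); rewrite cabsM sg1; lra.
have mab (c d : G -> C) (z : C) : cmeasurable c -> cmeasurable d ->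
    cmeasurable (fun t => c t + z * d t).
  by move=> mc md; apply: cmeasurableD => //; exact: cmeasurableZ.
have c1 : cabs (1 : C) = 1 by exact: cabs1.
have cN1 : cabs (-1 : C) = 1 by rewrite cabsN cabs1.
have ihp := ih _ _ (mab _ _ 1 ma0 (ma n)) (mab _ _ 1 mb0 (mb n)) (hA1 _ c1) (hB1 _ c1).
have ihm := ih _ _ (mab _ _ (-1) ma0 (ma n)) (mab _ _ (-1) mb0 (mb n)) (hA1 _ cN1) (hB1 _ cN1).
pose hf : C := (2^-1)%:C%C.
have chf : cabs hf = 2^-1 by rewrite cabs_real ger0_norm.
have A0 : 0 <= A.
  by apply: le_trans (hA 1%g); rewrite addr_ge0 ?cabs_ge0 ?sumr_ge0// => i _; exact: cabs_ge0.
have B0 : 0 <= B.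
  by apply: le_trans (hB 1%g); rewrite addr_ge0 ?cabs_ge0 ?sumr_ge0// => i _; exact: cabs_ge0.
have ABX0 : 0 <= A * B * X by apply: mulr_ge0 => //; exact: mulr_ge0.
have hhX : 0 <= cabs hf * (A * B * X) by rewrite mulr_ge0 ?cabs_ge0.
have := Rep_add yPhi yPsi compl haar hhX hhX
  (Rep_scale yPhi yPsi compl haar hf ihp) (Rep_scale yPhi yPsi compl haar hf ihm).
rewrite chf -mulrDl (_ : 2^-1 + 2^-1 = 1 :> R) ?mul1r; last by field.
move=> HR; apply: Rep_ext HR => t.
rewrite big_ord_recr /= -mulrDr.
set S := \sum_(i < n) _.
rewrite !convE.
have bnd (c : nat -> G -> C) (c0 : G -> C) M : (forall t, cabs (c0 t) + \sum_(i < n.+1) cabs (c i t) <= M) ->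
    (forall t, cabs (c0 t) <= M) /\ (forall t, cabs (c n t) <= M).
  move=> hM; split=> s; have := hM s; rewrite big_ord_recr /=.
    have : 0 <= \sum_(i < n) cabs (c i s) by rewrite sumr_ge0// => i _; exact: cabs_ge0.
    have := cabs_ge0 (c n s); lra.
  have : 0 <= \sum_(i < n) cabs (c i s) by rewrite sumr_ge0// => i _; exact: cabs_ge0.
  have := cabs_ge0 (c0 s); lra.
have [a0A anA] := bnd _ _ _ hA; have [b0B bnB] := bnd _ _ _ hB.
pose I (c d : G -> C) s := (h s * c s) * (k (t^-1 * s)%g * d (t^-1 * s)%g).
have I00 : cintegrable mu (I a0 b0) by exact: conv_mul_cintegrable a0A b0B.
have I01 : cintegrable mu (I a0 (b n)) by exact: conv_mul_cintegrable a0A bnB.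
have I10 : cintegrable mu (I (a n) b0) by exact: conv_mul_cintegrable anA b0B.
have I11 : cintegrable mu (I (a n) (b n)) by exact: conv_mul_cintegrable anA bnB.
have expand (z : C) : cintegral mu (fun s => h s * (a0 s + z * a n s) *
      (k (t^-1 * s)%g * (b0 (t^-1 * s)%g + z * b n (t^-1 * s)%g))) =
    cintegral mu (I a0 b0) + z * cintegral mu (I a0 (b n)) +
    (z * cintegral mu (I (a n) b0) + z ^+ 2 * cintegral mu (I (a n) (b n))).
  have i1 := cintegrableD I00 (cintegrableZ z I01).
  have i2 := cintegrableD (cintegrableZ z I10) (cintegrableZ (z ^+ 2) I11).
  rewrite -!cintegralZ// -!cintegralD//; try exact: cintegrableZ.
  by apply: eq_cintegral => s; rewrite /I; ring.
rewrite !expand.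
have hf2 : hf + hf = 1.
  by rewrite /hf -rmorphD (_ : 2^-1 + 2^-1 = 1 :> R) ?rmorph1//; field.
set i00 := cintegral mu (I a0 b0); set i01 := cintegral mu (I a0 (b n)).
set i10 := cintegral mu (I (a n) b0); set i11 := cintegral mu (I (a n) (b n)).
rewrite -/i00 -/i11.
transitivity ((hf + hf) * (i00 + i11 + S)); first by ring.
by rewrite hf2; ring.
Qed.

End FixedPair.
End SchurMultipliers.

(** * Finite rank kernels *)

Section FiniteRankKernels.
Context {R : realType} {G : topologicalGroupType}.
Local Notation C := R[i].

(** Sums of rank-one kernels [a (x) b], with a bound [c] on the total product of
sup norms, that is, on their norm in the projective tensor product. *)
Inductive fin_ker (D : set G) : R -> (G -> G -> C) -> Prop :=
| fin_ker0 : fin_ker D 0 (fun _ _ => 0)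
| fin_kerS c kap (a b : G -> C) (A B : R) :
    continuous (a : G -> C^o) -> continuous (b : G -> C^o) ->
    (forall t, cabs (a t) <= A) -> (forall t, cabs (b t) <= B) -> supported b D ->
    fin_ker D c kap -> fin_ker D (c + A * B) (fun x y => kap x y + a x * b y).

Lemma fin_ker_ge0 D c kap : fin_ker D c kap -> 0 <= c.
Proof.
elim=> // {}c _ a b A B _ _ aA bB _ _ c0; rewrite addr_ge0// mulr_ge0//.
  by apply: le_trans (aA 1%g); exact: cabs_ge0.
by apply: le_trans (bB 1%g); exact: cabs_ge0.
Qed.

Lemma fin_ker_ext D c kap kap' : (forall x y, kap x y = kap' x y) ->
  fin_ker D c kap -> fin_ker D c kap'.
Proof.
by move=> h; have -> : kap = kap' by apply/funext => x; apply/funext => y.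
Qed.

Lemma fin_ker_le D c c' kap : c <= c' -> fin_ker D c kap -> fin_ker D c' kap.
Proof.
move=> cc hk.
have c0 : continuous ((fun=> 0) : G -> C^o) by move=> t; exact: cvg_cst.
have := @fin_kerS D c kap (fun=> 0) (fun=> 0) (c' - c) 1 c0 c0.
rewrite mulr1 (addrC c) subrK => H.
have {}H : fin_ker D c' (fun x y => kap x y + 0 * 0).
  by apply: H => // t; rewrite cabs0 ?subr_ge0// ler01.
by apply: fin_ker_ext H => x y; rewrite mul0r addr0.
Qed.

Lemma fin_kerD D c c' kap kap' : fin_ker D c kap -> fin_ker D c' kap' ->
  fin_ker D (c + c') (fun x y => kap x y + kap' x y).
Proof.
move=> hk; elim=> [|{}c' {}kap' a b A B ca cb aA bB bD _ ih].
  by rewrite addr0; apply: fin_ker_ext hk => x y; rewrite addr0.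
rewrite addrA; apply: fin_ker_ext (fin_kerS ca cb aA bB bD ih) => x y.
by rewrite addrA.
Qed.

Lemma fin_ker_sum D n (c : nat -> R) (kap : nat -> G -> G -> C) :
  (forall j, (j < n)%N -> fin_ker D (c j) (kap j)) ->
  fin_ker D (\sum_(j < n) c j) (fun x y => \sum_(j < n) kap j x y).
Proof.
elim: n => [|n ih] hk.
  rewrite big_ord0; apply: fin_ker_ext (fin_ker0 D) => x y.
  by rewrite big_ord0.
rewrite big_ord_recr /=.
have := fin_kerD (ih (fun j jn => hk j (ltnW jn))) (hk n (ltnSn n)).
by apply: fin_ker_ext => x y; rewrite big_ord_recr.
Qed.

Lemma fin_ker1 (D : set G) (a b : G -> C) (A B : R) :
  continuous (a : G -> C^o) -> continuous (b : G -> C^o) ->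
  (forall t, cabs (a t) <= A) -> (forall t, cabs (b t) <= B) -> supported b D ->
  fin_ker D (A * B) (fun x y => a x * b y).
Proof.
move=> ca cb aA bB bD; rewrite -[A * B]add0r.
apply: fin_ker_ext (fin_kerS ca cb aA bB bD (fin_ker0 D)) => x y.
by rewrite add0r.
Qed.

End FiniteRankKernels.

Section Transfer.
Context {R : realType} {G : topologicalGroupType}.
Variable mu : {measure set (borel G) -> \bar R}.
Variables Phi Psi : R -> \bar R.
Hypothesis yPhi : young_function Phi.
Hypothesis yPsi : young_function Psi.
Hypothesis compl : Psi = complementary Phi.
Hypothesis haar : left_haar_measure mu.
Local Notation C := R[i].
Local Notation LPhi := (LOrlicz mu Phi).
Local Notation LPsi := (LOrlicz mu Psi).
Local Notation N := (Nphi mu Phi).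
Local Notation O := (Opsi mu Phi).
Local Notation conv := (Defs.conv mu).
Local Notation Rep := (Rep mu Phi Psi).

Variables h k : G -> C.
Hypothesis Lh : LPhi h.
Hypothesis Lk : LPsi k.
Variables (p : nat) (y : nat -> G) (E : nat -> set (borel G)).
Hypothesis mE : forall i, measurable (E i).
Hypothesis disjE : forall i j t, E i t -> E j t -> i = j.
Variables (D : set G) (M : R).
Hypothesis overlap : forall s,
  \sum_(i < p) (if `[< D (s * y i)%g >] then 1 else 0) <= M.
Local Notation X := (N h * O k).

(** The integrand of [t |-> \int h(s) k(s') kap_E(s, s') ds], [s' = t^-1 s], where
[kap_E] is [kap] transported to each strip [E_i * G] by right translation by [y_i]. *)
Definition ker_int (kap : G -> G -> C) (t s : G) : C :=
  h s * k (t^-1 * s)%g * \sum_(i < p) \1_(E i) s * kap (s * y i)%g (t^-1 * s * y i)%g.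

Definition ker_conv (kap : G -> G -> C) (t : G) : C :=
  cintegral mu (ker_int kap t).

(** The first factors have disjoint supports [E_i] and the second factors have
overlap at most [M], so [Rep_signs] applies. *)
Lemma ker_rank1 (a b : G -> C) (A B : R) :
  continuous (a : G -> C^o) -> continuous (b : G -> C^o) ->
  (forall t, cabs (a t) <= A) -> (forall t, cabs (b t) <= B) -> supported b D ->
  (forall t, cintegrable mu (ker_int (fun x y => a x * b y) t)) /\
  Rep (A * (B * M) * X) (ker_conv (fun x y => a x * b y)).
Proof.
move=> ca cb aA bB bD.
have A0 : 0 <= A by apply: le_trans (aA 1%g); exact: cabs_ge0.
have B0 : 0 <= B by apply: le_trans (bB 1%g); exact: cabs_ge0.
have mr (c : G -> C) (z : G) : continuous (c : G -> C^o) -> cmeasurable (fun s => c (s * z)%g).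
  move=> cc; apply: continuous_cmeasurable.
  exact: (continuous_precomp (@continuous_mulgr G z) cc).
pose a_ i s := \1_(E i) s * a (s * y i)%g.
pose b_ i s := b (s * y i)%g.
have ma i : cmeasurable (a_ i).
  by apply: cmeasurableM; [exact: cmeasurable_indic|exact: mr].
have mb i : cmeasurable (b_ i) by exact: mr.
have aA_ i t : cabs (a_ i t) <= A.
  rewrite /a_ cabsM -[A]mul1r ler_pM ?cabs_ge0//; exact: cabs_indic.
have bB_ i t : cabs (b_ i t) <= B by exact: bB.
have term i t : cintegrable mu (fun s => (h s * a_ i s) * (k (t^-1 * s)%g * b_ i (t^-1 * s)%g)).
  exact: (conv_mul_cintegrable yPhi yPsi compl haar Lh Lk t (ma i) (mb i) (aA_ i) (bB_ i)).
have kerE t : ker_int (fun x y => a x * b y) t =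
    fun s => \sum_(i < p) (h s * a_ i s) * (k (t^-1 * s)%g * b_ i (t^-1 * s)%g).
  apply/funext => s; rewrite /ker_int mulr_sumr; apply: eq_bigr => i _.
  by rewrite /a_ /b_; ring.
split; first by move=> t; rewrite kerE; exact: cintegrable_sum.
have m0 : cmeasurable ((fun=> 0) : G -> C) by exact: cmeasurable_cst.
have sA t : cabs (0 : C) + \sum_(i < p) cabs (a_ i t) <= A.
  rewrite cabs0 add0r.
  have [[i0 Ei0]|nE] := pselect (exists i : 'I_p, E i t).
    rewrite (bigD1 i0)//= big1 ?addr0// => j ji; rewrite /a_ indic_nmem ?mul0r ?cabs0// => Ej.
    by move/eqP : ji; apply; apply: val_inj; exact: disjE Ej Ei0.
  rewrite big1// => i _; rewrite /a_ indic_nmem ?mul0r ?cabs0// => Ei.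
  by apply: nE; exists i.
have sB t : cabs (0 : C) + \sum_(i < p) cabs (b_ i t) <= B * M.
  rewrite cabs0 add0r; apply: le_trans (ler_wpM2l B0 (overlap t)).
  rewrite mulr_sumr; apply: ler_sum => i _; case: asboolP => Dt.
    by rewrite mulr1.
  by rewrite mulr0 /b_ bD// cabs0.
have HR := Rep_signs yPhi yPsi compl haar Lh Lk ma mb m0 m0 sA sB.
apply: Rep_ext HR => t.
rewrite (_ : conv _ _ t = 0) ?add0r; last first.
  rewrite -[RHS](cintegral0 mu); apply: eq_cintegral => s.
  by rewrite mulr0 mul0r.
rewrite /ker_conv kerE cintegral_sum//; apply: eq_bigr => i _.
by rewrite convE.
Qed.

Lemma fin_ker_Rep c kap : fin_ker D c kap ->
  (forall t, cintegrable mu (ker_int kap t)) /\ Rep (c * (M * X)) (ker_conv kap).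
Proof.
have M0 : 0 <= M.
  by apply: le_trans (overlap 1%g); apply: sumr_ge0 => i _; case: ifP.
have X0 : 0 <= X by rewrite mulr_ge0 ?Nphi_ge0 ?Opsi_ge0.
have MX0 : 0 <= M * X by exact: mulr_ge0.
elim=> [|{}c {}kap a b A B ca cb aA bB bD hk [ih1 ih2]].
  have k0 t : ker_int (fun _ _ => 0) t = fun=> 0.
    by apply/funext => s; rewrite /ker_int big1 ?mulr0// => i _; rewrite mulr0.
  split; first by move=> t; rewrite k0; exact: cintegrable0.
  rewrite mul0r; apply: Rep_ext (Rep0 mu yPhi yPsi) => t.
  by rewrite /ker_conv k0 cintegral0.
have [r1 r2] := ker_rank1 ca cb aA bB bD.
have kD t : ker_int (fun x y => kap x y + a x * b y) t =
    fun s => ker_int kap t s + ker_int (fun x y => a x * b y) t s.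
  apply/funext => s; rewrite /ker_int -mulrDr -big_split /=; congr (_ * _).
  by apply: eq_bigr => i _; rewrite mulrDr.
split; first by move=> t; rewrite kD; exact: cintegrableD.
rewrite (_ : (c + A * B) * (M * X) = c * (M * X) + A * (B * M) * X); last by ring.
have A0 : 0 <= A by apply: le_trans (aA 1%g); exact: cabs_ge0.
have B0 : 0 <= B by apply: le_trans (bB 1%g); exact: cabs_ge0.
have d1 : 0 <= c * (M * X) by apply: mulr_ge0 => //; exact: fin_ker_ge0 hk.
have d2 : 0 <= A * (B * M) * X by apply: mulr_ge0 => //; rewrite !mulr_ge0.
apply: Rep_ext (Rep_add yPhi yPsi compl haar d1 d2 ih2 r2) => t.
by rewrite /ker_conv kD cintegralD.
Qed.

End Transfer.

(** * Expansion of a coefficient function into rank-one kernels *)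

Section HalfPowers.
Context {R : realType}.

Definition halfpow (m : nat) : R := 2^-1 ^+ m.

Lemma halfpow_gt0 m : 0 < halfpow m.
Proof. by rewrite exprn_gt0// invr_gt0. Qed.

Lemma halfpowS m : halfpow m.+1 = halfpow m / 2.
Proof. by rewrite /halfpow exprS mulrC. Qed.

Lemma sum_halfpow M : \sum_(0 <= m < M) halfpow m <= 2.
Proof.
suff -> : \sum_(0 <= m < M) halfpow m = 2 - 2 * halfpow M.
  by rewrite gerBl mulr_ge0// ltW// halfpow_gt0.
elim: M => [|M ih]; first by rewrite big_nil /halfpow expr0 mulr1 subrr.
by rewrite big_nat_recr//= ih halfpowS; field.
Qed.

Lemma halfpow_small (K e : R) : 0 <= K -> 0 < e ->
  exists J, forall m, (J <= m)%N -> K * halfpow m < e.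
Proof.
move=> K0 e0; have Ke : 0 <= K / e by rewrite divr_ge0// ltW.
exists (Num.bound (K / e)) => m Jm.
have h1 : K / e < m%:R by apply: lt_le_trans (archi_boundP Ke) _; rewrite ler_nat.
have h2 : halfpow m * (m.+1)%:R <= 1.
  rewrite /halfpow exprVn mulrC ler_pdivrMr ?exprn_gt0// mul1r -natrX ler_nat.
  exact: ltn_expl.
have h3 : K < m.+1%:R * e.
  by move: h1; rewrite ltr_pdivrMr// => /lt_le_trans; apply; rewrite ler_pM2r// ler_nat.
have hp := halfpow_gt0 m.
apply: (@lt_le_trans _ _ (m.+1%:R * e * halfpow m)); first by rewrite ltr_pM2r.
by rewrite mulrAC -[leRHS]mul1r ler_pM2r// mulrC.
Qed.

End HalfPowers.

Section KernelExpansion.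
Context {R : realType} {G : topologicalGroupType}.
Variable mu : {measure set (borel G) -> \bar R}.
Hypothesis hG : hausdorff_space G.
Hypothesis haar : left_haar_measure mu.
Local Notation C := R[i].
Local Notation conv := (Defs.conv mu).

Lemma norm1_indic (A : set (borel G)) : measurable A ->
  norm1 mu (\1_A : G -> C) = mu A.
Proof.
move=> mA; rewrite -[mu A](congr1 mu (setIT A)) -(integral_indic mu measurableT mA).
apply: eq_integral => t _; congr EFin; rewrite !indicE.
by case: (t \in A); rewrite ?cabs0 ?cabs1.
Qed.

Lemma sum_disjoint_measure (n : nat) (E : nat -> set (borel G)) (Q : set (borel G)) :
  (forall i, measurable (E i)) -> measurable Q -> (mu Q < +oo)%E ->
  (forall i, E i `<=` Q) -> (forall i j t, E i t -> E j t -> i = j) ->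
  \sum_(i < n) fine (mu (E i)) <= fine (mu Q).
Proof.
move=> mE mQ Qfin EQ disj.
have fin A : measurable A -> A `<=` Q -> mu A \is a fin_num.
  move=> mA AQ; rewrite ge0_fin_numE//; apply: le_lt_trans Qfin.
  by apply: le_measure; rewrite ?inE.
rewrite -lee_fin fineK ?fin// -sumEFin.
rewrite (eq_bigr (fun i : 'I_n => mu (E i))); last by move=> i _; rewrite fineK ?fin.
rewrite -(@measure_bigsetU_ord _ _ _ mu n xpredT (fun i : 'I_n => E i))//; last first.
  by move=> i j _ _ [t [Ei Ej]]; apply: val_inj; exact: disj Ei Ej.
apply: le_measure; rewrite ?inE//; first exact: bigsetU_measurable.
by elim/big_ind : _ => [//|A B hA hB t [/hA|/hB]//|i _]; exact: EQ.
Qed.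

(** The coefficient of [f (x r_j)] when [\int f (x r) g (z r) dr] is discretized on a
cell [E] with sample point [r_j]. *)
Definition slice_integral (g : G -> C) (E : set (borel G)) (z : G) : C :=
  cintegral mu (fun r => \1_E r * g (z * r)%g).

Section Slices.
Variables (g : G -> C) (b : R) (Q : set (borel G)).
Hypothesis Cg : Cc g.
Hypothesis gb : forall t, cabs (g t) <= b.
Hypothesis mQ : measurable Q.
Hypothesis Qfin : (mu Q < +oo)%E.

Let b0 : 0 <= b. Proof. by apply: le_trans (gb 1%g); exact: cabs_ge0. Qed.

Lemma indic_cintegrable E : measurable E -> E `<=` Q ->
  cintegrable mu (\1_E : G -> C).
Proof.
move=> mE EQ; split; first exact: cmeasurable_indic.
rewrite -/(norm1 _ _) norm1_indic//; apply: le_lt_trans Qfin.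
by apply: le_measure; rewrite ?inE.
Qed.

Lemma slice_cintegrable E z : measurable E -> E `<=` Q ->
  cintegrable mu (fun r => \1_E r * g (z * r)%g).
Proof.
move=> mE EQ; apply: (@bounded_cintegrable _ _ _ (\1_E : G -> C) _ b) => //.
  exact: indic_cintegrable.
by apply: cmeasurable_translate; exact: Cc_cmeasurable.
Qed.

Lemma slice_integral_continuous E : measurable E -> E `<=` Q ->
  continuous (slice_integral g E : G -> C^o).
Proof.
move=> mE EQ.
apply: (@cintegral_continuous _ _ _ (\1_E : G -> C) (fun z r => g (z * r)%g) b) => //.
- exact: indic_cintegrable.
- by move=> z; apply: cmeasurable_translate; exact: Cc_cmeasurable.
move=> x e e0; have [W [oW W1 gW]] := uniform_continuity_left Cg e0.
have cc := @continuous_mulgr G (x^-1)%g.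
have : \forall z \near x, W (z * x^-1)%g.
  by apply: (cc x); apply: open_nbhs_nbhs; split=> //; rewrite mulgV.
apply: filterS => z Wz t; have -> : (z * t = (z * x^-1) * (x * t))%g.
  by rewrite mulgA mulgVK.
exact: gW.
Qed.

Lemma slice_integral_le E z : measurable E -> E `<=` Q ->
  cabs (slice_integral g E z) <= 2 * b * fine (mu E).
Proof.
move=> mE EQ; rewrite -norm1_indic//.
apply: cabs_cintegral_dom => //.
- exact: indic_cintegrable.
- by case: (slice_cintegrable z mE EQ).
- by move=> t; rewrite cabsM mulrC ler_wpM2r ?cabs_ge0.
Qed.

Lemma slice_integral_sum E n (F : nat -> set (borel G)) z :
  measurable E -> E `<=` Q -> (forall j, measurable (F j)) ->
  (forall t, E t -> exists2 i, (i < n)%N & F i t /\ forall j, F j t -> j = i) ->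
  slice_integral g E z = \sum_(j < n) slice_integral g (E `&` F j) z.
Proof.
move=> mE EQ mF cov; rewrite -cintegral_sum; last first.
  move=> j; apply: slice_cintegrable; first exact: measurableI.
  by move=> t [/EQ].
apply: eq_cintegral => t; rewrite -mulr_suml; congr (_ * _).
have [Et|nEt] := pselect (E t); last first.
  rewrite indic_nmem// big1// => j _; rewrite indic_nmem// => -[] //.
have [i ni [Fi uF]] := cov t Et.
rewrite indic_mem// (bigD1 (Ordinal ni))//= indic_mem// big1 ?addr0// => j ji.
rewrite indic_nmem// => -[_ /uF h].
by move/eqP : ji; apply; apply: val_inj.
Qed.

Lemma slice_integral_set0 E z : E = set0 -> slice_integral g E z = 0.
Proof.
move=> ->; rewrite -[RHS](cintegral0 mu); apply: eq_cintegral => t.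
by rewrite indic_nmem ?mul0r.
Qed.

End Slices.

(** By left invariance [u (x z^-1) = \int f (x r) g (z r) dr], and for [x] in [D] only
the [r] in the compact set [Q] contribute.  Discretizing [r |-> f (x r)] on a mesh of
tolerance [2^-m] gives a finite rank kernel [P m], uniformly close to [u (x z^-1)] in both
variables.  On the common refinement of two meshes, [P m.+1 - P m] is a sum of rank-one
kernels whose first factors are of order [2^-m], so the differences are summable. *)
Lemma kernel_expansion (f g : G -> C) (D : set G) : Cc f -> Cc g -> compact D ->
  exists (D' : set G) (B : R) (kap : nat -> G -> G -> C) (c : nat -> R),
  [/\ compact D', forall m, fin_ker D' (c m) (kap m),
      forall M, \sum_(0 <= m < M) c m <= B
    & forall e : R, 0 < e -> exists J, forall M, (J <= M)%N ->
      forall x z, D x ->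
      cabs (\sum_(0 <= m < M) kap m x z - conv f (check g) (x * z^-1)%g) < e].
Proof.
move=> Cf Cg cD.
have [bf bf0 fb] := Cc_bounded Cf; have [bg bg0 gb] := Cc_bounded Cg.
have [cf [Sf cSf fS]] := Cf; have [cg [Sg cSg gS]] := Cg.
pose Q : set (borel G) := mulset (invset D) Sf.
have cQ : compact (Q : set G) by apply: compact_mulset => //; exact: compact_invset.
have mQ : measurable Q by exact: borel_compact.
have Qfin : (mu Q < +oo)%E by exact: haar_compact.
pose q := fine (mu Q); have q0 : 0 <= q by rewrite fine_ge0.
pose D' := mulset Sg (invset Q).
have cD' : compact D' by apply: compact_mulset => //; exact: compact_invset.
have gD' E : E `<=` Q -> supported (slice_integral g E) D'.
  move=> EQ z nz; rewrite -[RHS](cintegral0 mu); apply: eq_cintegral => t.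
  have [Et|nEt] := pselect (E t); last by rewrite indic_nmem// mul0r.
  rewrite gS ?mulr0// => Szt; apply: nz.
  have -> : z = (z * t * t^-1)%g by rewrite mulgK.
  by apply: mulsetP => //; rewrite /invset/= invgK; exact: EQ.
pose e_ := @halfpow R.
have hmesh m : exists q : nat * (nat -> G) * (nat -> set (borel G)),
  [/\ forall i, measurable (q.2 i),
      forall i t, q.2 i t -> Q t /\
        (forall x, cabs (f (x * t)%g - f (x * q.1.2 i)%g) < e_ m)
    & forall t, Q t -> exists2 i, (i < q.1.1)%N & q.2 i t /\ forall j, q.2 j t -> j = i].
  have [W [oW W1 fW]] := uniform_continuity_right Cf (halfpow_gt0 m).
  have [n [r [E [mE EW _ cov]]]] := mesh hG cQ oW W1.
  exists (n, r, E); split=> //= i t Et; have [Qt Wt] := EW _ _ Et; split=> // x.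
  have -> : (x * t = (x * r i) * ((r i)^-1 * t))%g by rewrite -mulgA mulVKg.
  exact: fW.
have [w hw] := choice hmesh.
pose n m := (w m).1.1; pose r m := (w m).1.2; pose E m := (w m).2.
have mE m i : measurable (E m i) by have [h _ _] := hw m; exact: h.
have EQ m i : E m i `<=` Q by move=> t Et; have [_ h _] := hw m; case: (h i t Et).
have Ef m i t x : E m i t -> cabs (f (x * t)%g - f (x * r m i)%g) < e_ m.
  by move=> Et; have [_ h _] := hw m; case: (h i t Et) => _; exact.
have cov m t : Q t -> exists2 i, (i < n m)%N & E m i t /\ forall j, E m j t -> j = i.
  by move=> Qt; have [_ _ h] := hw m; exact: h.
have disjE m i j t : E m i t -> E m j t -> i = j.
  move=> Ei Ej; have [l _ [_ u]] := cov m t (EQ _ _ _ Ei).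
  by rewrite (u _ Ei) (u _ Ej).
have cfr z : continuous ((fun x => f (x * z)%g) : G -> C^o).
  exact: (continuous_precomp (@continuous_mulgr G z) cf).
have cg_ A : measurable A -> A `<=` Q -> continuous (slice_integral g A : G -> C^o).
  by move=> mA AQ; exact: (slice_integral_continuous Cg gb mQ Qfin mA AQ).
have bg_ A z : measurable A -> A `<=` Q ->
    cabs (slice_integral g A z) <= 2 * bg * fine (mu A).
  by move=> mA AQ; exact: (slice_integral_le Cg gb mQ Qfin z mA AQ).
pose P m x z := \sum_(j < n m) f (x * r m j)%g * slice_integral g (E m j) z.
pose kap m x z := if m is m'.+1 then P m x z - P m' x z else P 0%N x z.
pose c m := if m is m'.+1 then 4 * bg * q * e_ m' else 2 * bf * bg * q.
exists D', (2 * bf * bg * q + 8 * bg * q), kap, c; split=> //.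
- case=> [|m].
  + apply: (@fin_ker_le _ _ _ (\sum_(j < n 0%N) bf * (2 * bg * fine (mu (E 0%N j))))).
      rewrite -mulr_sumr -mulr_sumr /c.
      rewrite (_ : 2 * bf * bg * q = bf * (2 * bg * q)); last by ring.
      rewrite ler_pM2l// ler_pM2l ?mulr_gt0//.
      exact: (sum_disjoint_measure _ (mE 0%N) mQ Qfin (EQ 0%N) (@disjE 0%N)).
    apply: (@fin_ker_sum _ _ D' (n 0%N) (fun j => bf * (2 * bg * fine (mu (E 0%N j))))
      (fun j x z => f (x * r 0%N j)%g * slice_integral g (E 0%N j) z)) => j _.
    exact: (@fin_ker1 _ _ D' (fun x => f (x * r 0%N j)%g) (slice_integral g (E 0%N j))
      bf _ (cfr _) (cg_ _ (mE _ _) (EQ _ _)) (fun x => fb _)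
      (fun z => bg_ _ z (mE _ _) (EQ _ _)) (gD' _ (EQ _ _))).
  + pose F j j' := E m j `&` E m.+1 j'.
    have mF j j' : measurable (F j j') by exact: measurableI.
    have FQ j j' : F j j' `<=` Q by move=> t [/EQ].
    apply: (@fin_ker_le _ _ _ (\sum_(j < n m) \sum_(j' < n m.+1)
        2 * e_ m * (2 * bg * fine (mu (F j j'))))).
      rewrite /c (_ : 4 * bg * q * e_ m = 2 * e_ m * (2 * bg * q)); last by ring.
      rewrite (eq_bigr (fun j : 'I_(n m) => 2 * e_ m * (2 * bg * \sum_(j' < n m.+1) fine (mu (F j j'))))); last first.
        by move=> j _; rewrite !mulr_sumr.
      rewrite -!mulr_sumr ler_pM2l ?mulr_gt0 ?halfpow_gt0// ler_pM2l ?mulr_gt0//.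
      apply: le_trans (sum_disjoint_measure (n m) (mE m) mQ Qfin (EQ m) (@disjE m)).
      apply: ler_sum => j _.
      apply: (sum_disjoint_measure (n m.+1) (mF j) (mE m j)).
      * by apply: le_lt_trans Qfin; apply: le_measure; rewrite ?inE.
      * by move=> j' t [].
      * by move=> i i' t [_ h1] [_ h2]; exact: disjE h1 h2.
    (* both sums are refined to the cells [F j j'] *)
    have kapE x z : \sum_(j < n m) \sum_(j' < n m.+1)
        (f (x * r m.+1 j')%g - f (x * r m j)%g) * slice_integral g (F j j') z = kap m.+1 x z.
      rewrite /kap /P.
      rewrite (eq_bigr (fun j : 'I_(n m) => \sum_(j' < n m.+1) f (x * r m.+1 j')%g * slice_integral g (F j j') z -
          f (x * r m j)%g * slice_integral g (E m j) z)); last first.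
        move=> j _; rewrite (slice_integral_sum (F := E m.+1) (n := n m.+1) Cg gb mQ Qfin z (mE m j) (EQ m j) (mE m.+1)); last first.
          by move=> t /EQ; exact: cov.
        by rewrite mulr_sumr -sumrB; apply: eq_bigr => j' _; rewrite mulrBl.
      rewrite sumrB exchange_big /=; congr (_ - _); apply: eq_bigr => j' _.
      rewrite -mulr_sumr; congr (_ * _).
      rewrite (slice_integral_sum (F := E m) (n := n m) Cg gb mQ Qfin z (mE m.+1 j') (EQ m.+1 j') (mE m)); last first.
        by move=> t /EQ; exact: cov.
      by apply: eq_bigr => j _; rewrite /F setIC.
    apply: fin_ker_ext kapE _.
    apply: (@fin_ker_sum _ _ D' (n m) (fun j => \sum_(j' < n m.+1) 2 * e_ m * (2 * bg * fine (mu (F j j'))))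
      (fun j x z => \sum_(j' < n m.+1)
        (f (x * r m.+1 j')%g - f (x * r m j)%g) * slice_integral g (F j j') z)) => j _.
    apply: (@fin_ker_sum _ _ D' (n m.+1) (fun j' => 2 * e_ m * (2 * bg * fine (mu (F j j'))))
      (fun j' x z => (f (x * r m.+1 j')%g - f (x * r m j)%g) * slice_integral g (F j j') z)) => j' _.
    (* an empty cell gives no control on its two sample points *)
    have [[t [Et E't]]|nF] := pselect (F j j' !=set0); last first.
      have F0 : F j j' = set0 by apply: contrapT => /eqP/set0P.
      apply: (@fin_ker_le _ _ _ 0).
        apply: mulr_ge0; first by rewrite mulr_ge0// ltW// halfpow_gt0.
        by rewrite mulr_ge0 ?fine_ge0// mulr_ge0// ltW.
      by apply: fin_ker_ext (fin_ker0 D') => x z; rewrite slice_integral_set0 ?mulr0.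
    have cdiff : continuous ((fun x => f (x * r m.+1 j')%g - f (x * r m j)%g) : G -> C^o).
      by move=> x; apply: (@cvgB _ C^o); exact: cfr.
    have bdiff x : cabs (f (x * r m.+1 j')%g - f (x * r m j)%g) <= 2 * e_ m.
      have h1 := Ef _ _ _ x Et; have h2 := Ef _ _ _ x E't.
      rewrite (_ : _ - _ = (f (x * t)%g - f (x * r m j)%g) - (f (x * t)%g - f (x * r m.+1 j')%g)); last by ring.
      apply: le_trans (ler_cabsB _ _) _.
      have := halfpow_gt0 (R := R) m; move: h2; rewrite /e_ halfpowS => h2 h3.
      move: h1; rewrite /e_ => h1; lra.
    exact: (@fin_ker1 _ _ D' _ _ _ _ cdiff (cg_ _ (mF _ _) (FQ _ _)) bdiff
      (fun z => bg_ _ z (mF _ _) (FQ _ _)) (gD' _ (FQ _ _))).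
- case=> [|M].
    by rewrite big_nil addr_ge0// !mulr_ge0// ltW.
  rewrite big_nat_recl//= lerD2l -mulr_sumr.
  rewrite (_ : 8 * bg * q = 4 * bg * q * 2); last by ring.
  by rewrite ler_wpM2l ?sum_halfpow// !mulr_ge0// ltW.
- move=> e e0.
  have k0 : 0 <= 2 * bg * q by rewrite !mulr_ge0// ltW.
  have [J hJ] := halfpow_small k0 e0.
  exists J.+1 => -[//|M] /= JM x z Dx.
  have -> : \sum_(0 <= m < M.+1) kap m x z = P M x z.
    elim: {JM} M => [|M ih]; first by rewrite big_nat1.
    by rewrite big_nat_recr//= ih /kap addrC subrK.
  apply: le_lt_trans (hJ M JM).
  have fgi : cintegrable mu (fun s => f s * g ((x * z^-1)^-1 * s)%g).
    apply: (@bounded_cintegrable _ _ _ f _ bg) => //; first exact: Cc_cintegrable.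
    by apply: cmeasurable_translate; exact: Cc_cmeasurable.
  have -> : conv f (check g) (x * z^-1)%g = cintegral mu (fun t => f (x * t)%g * g (z * t)%g).
    rewrite convE -(cintegral_mulgl haar x fgi); apply: eq_cintegral => t.
    by rewrite invgM invgK -mulgA mulKg.
  have fgi' : cintegrable mu (fun t => f (x * t)%g * g (z * t)%g).
    have := cintegrable_mulgl haar x fgi.
    rewrite (_ : (fun t => _) = (fun t => f (x * t)%g * g (z * t)%g))//.
    by apply/funext => t; rewrite invgM invgK -mulgA mulKg.
  have Pi : cintegrable mu (fun t => \sum_(j < n M) f (x * r M j)%g * (\1_(E M j) t * g (z * t)%g)).
    apply: cintegrable_sum => j; apply: cintegrableZ.
    exact: (slice_cintegrable Cg gb mQ Qfin).
  have -> : P M x z = cintegral mu (fun t => \sum_(j < n M) f (x * r M j)%g * (\1_(E M j) t * g (z * t)%g)).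
    rewrite cintegral_sum; last first.
      by move=> j; apply: cintegrableZ; exact: (slice_cintegrable Cg gb mQ Qfin).
    apply: eq_bigr => j _; rewrite cintegralZ//.
    exact: (slice_cintegrable Cg gb mQ Qfin).
  rewrite -cintegralB//.
  have bge0 : 0 <= bg * e_ M by rewrite mulr_ge0 ?ltW ?halfpow_gt0.
  apply: le_trans (cabs_cintegral_dom (indic_cintegrable mQ Qfin mQ (@subset_refl _ Q)) _ bge0 _) _.
  + by case: (cintegrableB Pi fgi').
  + move=> t; have [Qt|nQt] := pselect (Q t); last first.
      rewrite (_ : f (x * t)%g = 0); last first.
        apply: fS => St; apply: nQt.
        have -> : t = (x^-1 * (x * t))%g by rewrite mulKg.
        by apply: mulsetP => //; rewrite /invset/= invgK.
      rewrite mul0r subr0 big1 ?cabs0 ?mulr_ge0 ?cabs_ge0 ?ltW ?halfpow_gt0// => j _.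
      by rewrite indic_nmem ?mul0r ?mulr0// => /EQ.
    have [i ni [Ei uE]] := cov M t Qt.
    rewrite (_ : \sum_(j < n M) _ = (\sum_(j < n M) \1_(E M j) t * f (x * r M j)%g) * g (z * t)%g); last first.
      by rewrite mulr_suml; apply: eq_bigr => j _; ring.
    rewrite (mesh_sum (fun j => f (x * r M j)%g) ni Ei uE) -mulrBl cabsM indic_mem// cabs1 mulr1 mulrC.
    by apply: ler_pM; rewrite ?cabs_ge0// cabsB ltW// Ef.
  + by rewrite norm1_indic// /q (_ : 2 * _ * _ = 2 * bg * fine (mu Q) * e_ M)//; ring.
Qed.

End KernelExpansion.

(** * Truncation to compact sets *)

Section Tightness.
Context {R : realType} {G : topologicalGroupType}.
Variable mu : {measure set (borel G) -> \bar R}.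
Variables Phi : R -> \bar R.
Hypothesis yPhi : young_function Phi.
Hypothesis yPsi : young_function (complementary Phi).
Hypothesis hG : hausdorff_space G.
Hypothesis haar : left_haar_measure mu.
Hypothesis delta2 : Delta2_from 0 Phi.
Local Notation C := R[i].

Lemma Delta2_pow (a : R) : 0 < a -> exists2 c : R, 0 < c &
  forall t, 0 <= t -> (Phi (a * t)%R <= c%:E * Phi t)%E.
Proof.
move=> a0; have [c c0 hc] := delta2.
have H n : exists2 d : R, 0 < d & forall t, 0 <= t -> (Phi (2 ^+ n * t)%R <= d%:E * Phi t)%E.
  elim: n => [|n [d d0 ih]].
    by exists 1 => // t t0; rewrite expr0 mul1r mul1e.
  exists (c * d); first exact: mulr_gt0.
  move=> t t0; rewrite exprS -mulrA; apply: le_trans (hc _ _) _.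
    by rewrite mulr_ge0// exprn_ge0.
  by rewrite EFinM -muleA lee_wpmul2l ?ih// lee_fin ltW.
have [n an] : exists n : nat, a <= 2 ^+ n.
  exists (Num.bound a); apply: (@le_trans _ _ (Num.bound a)%:R).
    by apply/ltW/archi_boundP/ltW.
  by rewrite -natrX ler_nat ltnW// ltn_expl.
have [d d0 hd] := H n; exists d => // t t0.
apply: le_trans (hd t t0); apply: young_le => //.
by rewrite mulr_ge0 ?(ltW a0)//= ler_wpM2r.
Qed.

Lemma Delta2_lty (t : R) : 0 <= t -> (Phi t < +oo)%E.
Proof.
move=> t0; have [s s0 Ps] := young_lty yPhi yPsi.
have [->|tn0] := eqVneq t 0; first by case: yPhi => _ _ _ -> _; rewrite ltry.
have ts : 0 < t / s by rewrite divr_gt0// lt_neqAle eq_sym tn0.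
have [c c0 hc] := Delta2_pow ts.
have := hc s (ltW s0); rewrite divfK ?gt_eqF// => /le_lt_trans; apply.
by rewrite lte_mul_pinfty ?lee_fin ?ltW// ge0_fin_numE ?young_ge0.
Qed.

Lemma Delta2_gt0 (t : R) : 0 < t -> (0 < Phi t)%E.
Proof.
move=> t0; have [s s0 Ps] := young_ge1 yPhi.
have [c c0 hc] := Delta2_pow (divr_gt0 s0 t0).
have := hc t (ltW t0); rewrite divfK ?gt_eqF// => h.
rewrite lt0e young_ge0// andbT; apply/eqP => P0.
by move: (le_trans Ps h); rewrite P0 mule0 lee_fin ler10.
Qed.

(** Outer regularity encloses [A] in an open set [U] of finite measure, and inner
regularity of open sets provides [K]. *)
Lemma haar_inner (A : set (borel G)) (d : R) : measurable A -> (mu A < +oo)%E ->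
  0 < d -> exists (U : set (borel G)) (K : set G), [/\ open (U : set G), A `<=` U, compact K, K `<=` U &
    (mu (U `\` K) <= d%:E)%E].
Proof.
move=> mA Afin d0; have [[_ outer inner] _ _] := haar.
move: (Afin); rewrite (outer A mA) => /ereal_inf_lt[_ [U [oU AU] <-] Ufin].
have mU := borel_open oU.
have Ufin' : mu U \is a fin_num by rewrite ge0_fin_numE.
have : (mu U - d%:E < mu U)%E by rewrite -(fineK Ufin') -EFinB lte_fin gtrBl.
rewrite {2}(inner U oU) => /ereal_sup_gt[_ [K [cK KU] <-] UK].
exists U, K; split=> //.
have mK := borel_compact hG cK.
rewrite measureD//.
have KUE : U `&` K = K by apply/setIidPr.
rewrite KUE leeBlDr; last first.
  by rewrite ge0_fin_numE//; exact: haar_compact.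
by apply: ltW; rewrite addeC -lteBlDr.
Qed.

(** Under the growth condition [w = Phi (|h| / e)] is integrable.  Outside some
[B n], where [|h|] is bounded away from 0 and infinity, it has integral at most 1/2; on
[B n], a set of finite measure, it is bounded, so its integral over [B n] minus [K] is at
most 1/2 for [K] compact large.  Hence [h] off [K] has modular at most 1 at scale [e]. *)
Lemma Nphi_tight (h : G -> C) (e : R) : LOrlicz mu Phi h -> 0 < e ->
  exists2 K : set G, compact K & Nphi mu Phi (fun t => h t * \1_(~` K) t) <= e.
Proof.
move=> Lh e0; have [mh [a a0 fa]] := Lh.
have eV0 : 0 < e^-1 by rewrite invr_gt0.
pose w (t : borel G) := Phi (e^-1 * cabs (h t)).
have mw : measurable_fun setT w by apply: measurable_young_cabs => //; exact: ltW.
have w0 t : (0 <= w t)%E by exact: young_ge0.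
have wi : (\int[mu]_t w t < +oo)%E.
  have [c c0 hc] := Delta2_pow (divr_gt0 eV0 a0).
  apply: (@le_lt_trans _ _ (c%:E * scaled_modular mu Phi a h)%E); last first.
    by rewrite lte_mul_pinfty ?lee_fin ?ltW// ge0_fin_numE ?integral_ge0// => t _; exact: young_ge0.
  rewrite /scaled_modular -ge0_integralZl_EFin ?(ltW c0)//; first last.
  - by apply: measurable_young_cabs => //; exact: ltW.
  - by move=> t _; exact: young_ge0.
  apply: ge0_le_integral => //.
  - by apply: measurable_funeM; apply: measurable_young_cabs => //; exact: ltW.
  - move=> t _; rewrite /w.
    rewrite (_ : e^-1 * cabs (h t) = e^-1 / a * (a * cabs (h t))); last first.
      by rewrite mulrA divfK// gt_eqF.
    by apply: hc; rewrite mulr_ge0 ?cabs_ge0// ltW.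
have iw : mu.-integrable setT w.
  apply/integrableP; split=> //.
  by under eq_integral do rewrite gee0_abs//.
pose B (n : nat) : set (borel G) := [set t | n.+1%:R^-1 < cabs (h t) <= n.+1%:R].
have mcabs := cmeasurable_cabs mh.
have mB n : measurable (B n).
  rewrite (_ : B n = (fun t : borel G => cabs (h t)) @^-1` `]n.+1%:R^-1, n.+1%:R]%classic); last first.
    by apply/seteqP; split=> t /=; rewrite in_itv.
  by rewrite -[X in measurable X]setTI; exact: mcabs.
pose f_ n t := (w t * (\1_(~` B n) t)%:E)%E.
have mf_ n : measurable_fun setT (f_ n).
  apply: emeasurable_funM => //; apply/measurable_EFinP; apply: measurable_indic.
  exact: measurableC.
have f_cvg : {ae mu, forall t, setT t -> f_ ^~ t @ \oo --> (cst 0%E : borel G -> \bar R) t}.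
  apply: aeW => t _; have [h0|hn0] := eqVneq (cabs (h t)) 0.
    rewrite (_ : f_ ^~ t = cst 0%E); first exact: cvg_cst.
    apply/funext => n; rewrite /f_ /w h0 mulr0; case: yPhi => _ _ _ -> _.
    by rewrite mul0e.
  have h0 : 0 < cabs (h t) by rewrite lt_neqAle eq_sym hn0 cabs_ge0.
  apply: cvg_near_cst; exists (maxn (Num.bound (cabs (h t))^-1) (Num.bound (cabs (h t)))) => // n.
  rewrite /= geq_max => /andP[n1 n2].
  rewrite /f_ indicE memNset ?mule0// => -[]; rewrite /B /=.
  have b1 : (cabs (h t))^-1 < n.+1%:R.
    apply: lt_le_trans (archi_boundP _) _; first by rewrite invr_ge0 ltW.
    by rewrite ler_nat ltnW.
  apply/andP; split; first by rewrite invf_plt ?posrE.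
  apply/ltW; apply: lt_le_trans (archi_boundP (ltW h0)) _.
  by rewrite ler_nat ltnW.
have dom : {ae mu, forall t n, setT t -> (`|f_ n t| <= w t)%E}.
  apply: aeW => t n _; rewrite gee0_abs ?mule_ge0 ?lee_fin//.
  by rewrite -[leRHS]mule1 lee_wpmul2l// lee_fin indicE; case: (_ \in _).
have [_ _] := dominated_convergence measurableT mf_ (measurable_cst _) f_cvg iw dom.
rewrite integral0 => lim0.
have h2 : (0 < 2^-1 :> R) by rewrite invr_gt0.
have [n hn] : exists n, (\int[mu]_t f_ n t <= (2^-1)%:E)%E.
  have : \forall n \near \oo, (\int[mu]_t f_ n t < (2^-1)%:E)%E.
    have hlt : (0 < (2^-1)%:E :> \bar R)%E by rewrite lte_fin.
    exact: (lim0 _ (open_ereal_lt' hlt)).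
  by move=> [m _ hm]; exists m; apply/ltW/hm => /=.
have nr : (0 : R) < n.+1%:R by rewrite ltr0n.
have Bfin : (mu (B n) < +oo)%E.
  have [eta etaE] : exists eta, Phi (e^-1 * n.+1%:R^-1) = eta%:E.
    exists (fine (Phi (e^-1 * n.+1%:R^-1))); rewrite fineK// ge0_fin_numE ?young_ge0//.
    by rewrite Delta2_lty// mulr_ge0 ?ltW// invr_gt0.
  have eta0 : 0 < eta by rewrite -lte_fin -etaE Delta2_gt0// mulr_gt0// invr_gt0.
  have : (eta%:E * mu (B n) < +oo)%E.
    apply: le_lt_trans wi.
    rewrite -[mu (B n)](congr1 mu (setIT (B n))) -(integral_indic mu measurableT (mB n)).
    rewrite -ge0_integralZl_EFin ?(ltW eta0)//; last first.
      by apply/measurable_EFinP; exact: measurable_indic.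
    apply: ge0_le_integral => //.
    - by move=> t _; apply: mule_ge0; rewrite lee_fin// ltW.
    - by apply: measurable_funeM; apply/measurable_EFinP; exact: measurable_indic.
    - move=> t _; rewrite indicE; have [/set_mem Bt|_] := boolP (t \in B n); last by rewrite mule0.
      rewrite mule1 -etaE; apply: young_le => //.
      move: Bt => /andP[b1 _]; apply/andP; split; last by rewrite ler_pM2l// ltW.
      by rewrite ltW// mulr_gt0// invr_gt0.
  move=> etaB; rewrite ltey; apply/eqP => Boo; move: etaB.
  by rewrite Boo gt0_muley ?ltxx// lte_fin.
have [m mE] : exists m, Phi (e^-1 * n.+1%:R) = m%:E.
  exists (fine (Phi (e^-1 * n.+1%:R))); rewrite fineK// ge0_fin_numE ?young_ge0//.
  by rewrite Delta2_lty// mulr_ge0 ?ltW.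
have m0 : 0 <= m by rewrite -lee_fin -mE young_ge0.
have m1 : 0 < 2 * (m + 1) by lra.
have dd0 : 0 < (2 * (m + 1))^-1 by rewrite invr_gt0.
have [U [K [oU BU cK KU UKd]]] := haar_inner (mB n) Bfin dd0.
exists K => //.
have mK : measurable (K : set (borel G)) := borel_compact hG cK.
have mU := borel_open oU.
have mUK : measurable (U `\` K) by exact: measurableD.
have mhK : cmeasurable (fun t => h t * \1_(~` K) t).
  by apply: cmeasurableM => //; apply: cmeasurable_indic; exact: measurableC.
have LhK : LOrlicz mu Phi (fun t => h t * \1_(~` K) t).
  apply: (LOrlicz_dom yPhi Lh mhK ler01) => t.
  by rewrite cabsM mulrC ler_wpM2r ?cabs_ge0// cabs_indic.
rewrite -lee_fin -(NphiE yPhi LhK); apply: luxemburg_scaled_modular => //.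
apply: (@le_trans _ _ (\int[mu]_t (f_ n t + m%:E * (\1_(U `\` K) t)%:E))%E).
  apply: ge0_le_integral => //.
  - by move=> t _; exact: young_ge0.
  - by apply: measurable_young_cabs => //; exact: ltW.
  - apply: emeasurable_funD => //.
    by apply: measurable_funeM; apply/measurable_EFinP; exact: measurable_indic.
  - move=> t _; have f0 : (0 <= f_ n t)%E by rewrite mule_ge0 ?lee_fin.
    have u0 : (0 <= m%:E * (\1_(U `\` K) t)%:E)%E by rewrite mule_ge0 ?lee_fin.
    have [Kt|nKt] := pselect (K t).
      rewrite indic_nmem; last by [].
      rewrite mulr0 cabs0 mulr0; case: (yPhi) => _ _ _ -> _.
      exact: adde_ge0.
    rewrite indic_mem// mulr1 -/(w t).
    have [Bt|nBt] := pselect (B n t); last first.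
      by rewrite {1}/f_ indicE mem_set// mule1 leeDl.
    rewrite [(\1_(U `\` K) t)]indicE (mem_set (A := U `\` K)) ?mule1; last by split=> //; exact: BU.
    apply: le_trans (leeDr _ f0); rewrite -mE; apply: young_le => //.
    move: Bt => /andP[_ b2]; apply/andP; split; last by rewrite ler_pM2l.
    by rewrite mulr_ge0 ?cabs_ge0// ltW.
rewrite ge0_integralD//; first last.
- by apply: measurable_funeM; apply/measurable_EFinP; exact: measurable_indic.
- by move=> t _; rewrite mule_ge0 ?lee_fin.
- by move=> t _; rewrite mule_ge0 ?lee_fin.
rewrite ge0_integralZl_EFin//; last by apply/measurable_EFinP; exact: measurable_indic.
rewrite integral_indic// setIT.
apply: (@le_trans _ _ ((2^-1)%:E + m%:E * ((2 * (m + 1))^-1)%:E)%E).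
  by apply: leeD => //; rewrite lee_wpmul2l// lee_fin.
rewrite -EFinM -EFinD lee_fin.
have : m / (2 * (m + 1)) <= 2^-1.
  by rewrite ler_pdivrMr//; lra.
lra.
Qed.

End Tightness.

(** * Separated covers *)

Section SeparatedCovers.
Context {R : realType} {G : topologicalGroupType}.
Variable mu : {measure set (borel G) -> \bar R}.
Hypothesis hG : hausdorff_space G.
Hypothesis haar : left_haar_measure mu.
Variables (W N0 : set G).
Hypothesis oW : open W.
Hypothesis W1 : W 1%g.
Hypothesis cN : compact N0.
Hypothesis WN : W `<=` N0.

Let w : R := fine (mu W).

Let muW : mu W = w%:E.
Proof.
rewrite fineK// ge0_fin_numE//; apply: le_lt_trans (haar_compact haar cN).
by apply: le_measure; rewrite ?inE//; [exact: borel_open|exact: borel_compact].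
Qed.

Let w0 : 0 < w.
Proof. by rewrite -lte_fin -muW; exact: (haar_open_gt0 hG haar oW W1). Qed.

Definition separated (p : nat) (y : nat -> G) := forall i j t,
  (i < p)%N -> (j < p)%N -> W ((y i)^-1 * t)%g -> W ((y j)^-1 * t)%g -> i = j.

Definition packing_bound (D : set G) : R := fine (mu (mulset D N0)) / w.

(** The bound does not involve the number [p] of translates, nor the set that they
are taken from: this makes the multiplier estimate uniform. *)
Lemma packing_count (D : set G) (s : G) (p : nat) (y : nat -> G) :
  compact D -> separated p y ->
  \sum_(i < p) (if `[< D (s * y i)%g >] then 1 else 0) <= packing_bound D.
Proof.
move=> cD sep.
have cDN := compact_mulset cD cN.
have := packing hG haar (s := s) (P := fun i => `[< D (s * y i)%g >]) cD cN oW WN sep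
  (fun i _ h => asboolW h).
rewrite muW /packing_bound ler_pdivlMr//.
rewrite -[X in (_ <= X)%E]fineK; last by rewrite ge0_fin_numE//; exact: haar_compact.
rewrite sumEFin lee_fin => /(le_trans _); apply.
rewrite mulr_suml [leRHS]big_mkcond/=; apply: ler_sum => i _.
by case: ifP; rewrite ?mul1r ?mul0r.
Qed.

(** A maximal separated family; separated families in [K^-1] have bounded size. *)
Lemma separated_cover (K : set G) : compact K ->
  exists (p : nat) (y : nat -> G), separated p y /\
    forall s, K s -> exists2 i, (i < p)%N & mulset N0 (invset N0) (s * y i)%g.
Proof.
move=> cK; apply: contrapT => nmax.
have cK' := compact_invset cK.
have all_p p : exists y, separated p y /\ forall i, (i < p)%N -> invset K (1 * y i)%g.
  elim: p => [|p [y [sep yK]]]; first by exists (fun=> 1%g); split.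
  have [s [Ks sfar]] : exists s, K s /\
      forall i, (i < p)%N -> ~ mulset N0 (invset N0) (s * y i)%g.
    apply: contrapT => h; apply: nmax; exists p, y; split=> // s Ks.
    apply: contrapT => h'; apply: h; exists s; split=> // i ip DD.
    by apply: h'; exists i.
  have far i t : (i < p)%N -> W ((y i)^-1 * t)%g -> W (s * t)%g -> False.
    move=> ip Wi Ws; apply: (sfar i ip).
    have -> : (s * y i = (s * t) * ((y i)^-1 * t)^-1)%g.
      by rewrite invgM invgK -mulgA mulVKg.
    apply: mulsetP; first exact: WN.
    by rewrite /invset/= invgK; exact: WN.
  exists (fun i => if i == p then s^-1%g else y i); split.
    move=> i j t; rewrite !ltnS.
    have [->|ip] := eqVneq i p; have [->|jp] := eqVneq j p => // hi hj.
    - by rewrite invgK => Ws Wj; exfalso; apply: (far j t) => //; rewrite ltn_neqAle jp.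
    - by rewrite invgK => Wi Ws; exfalso; apply: (far i t) => //; rewrite ltn_neqAle ip.
    - by apply: sep; rewrite ltn_neqAle ?ip ?jp.
  move=> i; rewrite ltnS; have [->|ip] := eqVneq i p => hi.
    by rewrite mul1g /invset/= invgK.
  by apply: yK; rewrite ltn_neqAle ip.
pose p := Num.bound (packing_bound (invset K)).
have [y [sep yK]] := all_p p.
have := packing_count 1%g cK' sep.
rewrite (eq_bigr (fun=> 1)); last by move=> i _; rewrite asboolT//; exact: yK.
rewrite sumr_const card_ord leNgt => /negP; apply.
apply: archi_boundP; rewrite divr_ge0 ?fine_ge0// ltW//.
Qed.

Lemma separated_partition (K : set G) : compact K ->
  exists (p : nat) (y : nat -> G) (E : nat -> set (borel G)),
  [/\ separated p y, forall i, measurable (E i),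
      forall i s, E i s -> mulset N0 (invset N0) (s * y i)%g,
      forall i j s, E i s -> E j s -> i = j
    & forall s, K s -> exists2 i, (i < p)%N & E i s].
Proof.
move=> cK; have [p [y [sep cov]]] := separated_cover cK.
pose D := mulset N0 (invset N0).
have cD : compact D by apply: compact_mulset => //; exact: compact_invset.
pose F i : set (borel G) := [set s | D (s * y i)%g].
have mF i : measurable (F i).
  by apply: borel_compact => //; exact: compact_mulgr.
exists p, y, (fun i => F i `&` \bigcap_(j in [set j | (j < i)%N]) ~` F j).
split=> //.
- move=> i; apply: measurableI => //; apply: bigcap_measurableType => j _.
  exact: measurableC.
- by move=> i s [].
- move=> i j s [Fi nFi] [Fj nFj].
  by case: (ltngtP i j) => // ij; exfalso; [exact: nFj ij Fi|exact: nFi ij Fj].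
- move=> s /cov[i ip Di].
  have exi : exists i, `[< F i s >] by exists i; apply/asboolP.
  case: (ex_minnP exi) => i0 /asboolP Fi0 mini; exists i0.
    by apply: leq_ltn_trans ip; apply: mini; apply/asboolP.
  split=> // j /= ji Fj.
  by have := mini j (asboolT Fj); rewrite leqNgt ji.
Qed.

End SeparatedCovers.

Section Multipliers.
Context {R : realType} {G : topologicalGroupType}.
Variable mu : {measure set (borel G) -> \bar R}.
Variables Phi Psi : R -> \bar R.
Hypothesis yPhi : young_function Phi.
Hypothesis yPsi : young_function Psi.
Hypothesis compl : Psi = complementary Phi.
Hypothesis hG : hausdorff_space G.
Hypothesis lcG : locally_compact [set: G].
Hypothesis haar : left_haar_measure mu.
Local Notation C := R[i].
Local Notation LPhi := (LOrlicz mu Phi).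
Local Notation LPsi := (LOrlicz mu Psi).
Local Notation N := (Nphi mu Phi).
Local Notation O := (Opsi mu Phi).
Local Notation conv := (Defs.conv mu).
Local Notation Rep := (Rep mu Phi Psi).

(** With [s' = t^-1 s] one has [u t = u (s s'^-1)], which for [s] in the piece [E_i]
is [u ((s y_i) (s' y_i)^-1)] with [s y_i] in the fixed compact set [D].  So one expansion of
the kernel on [D * G] serves all pieces, at a cost [B] times the overlap [M], both
independent of [K]. *)
Lemma multiplier_compact (f g : G -> C) : Cc f -> Cc g ->
  exists2 B : R, 0 <= B & forall (h k : G -> C) (K : set G), LPhi h -> LPsi k ->
    compact K -> supported h K ->
    Rep (B * (N h * O k)) (fun t => conv f (check g) t * conv h (check k) t).
Proof.
move=> Cf Cg; set u := conv f (check g).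
have [N0 + [cN _]] := lcG I (x := 1%g).
rewrite withinET => nN.
pose W := N0°.
have oW : open W by exact: open_interior.
have W1 : W 1%g by exact: nN.
have WN : W `<=` N0 by exact: interior_subset.
pose D := mulset N0 (invset N0).
have cD : compact D by apply: compact_mulset => //; exact: compact_invset.
have [D' [B [kap [c [cD' fk cB hk]]]]] := kernel_expansion hG haar Cf Cg cD.
pose M := packing_bound mu W N0 D'.
have M0 : 0 <= M by rewrite divr_ge0// fine_ge0.
have B0 : 0 <= B by apply: le_trans (cB 0%N); rewrite big_nil.
exists (B * M); first exact: mulr_ge0.
move=> h k K Lh Lk cK hK.
have [p [y [E [sep mE ED disjE cov]]]] := separated_partition hG haar oW W1 cN WN cK.
have overlap s := packing_count hG haar oW W1 cN WN s cD' sep.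
have fR m := fin_ker_Rep yPhi yPsi compl haar Lh Lk mE disjE overlap (fk m).
have X0 : 0 <= M * (N h * O k) by rewrite mulr_ge0// mulr_ge0 ?Nphi_ge0 ?Opsi_ge0.
rewrite -mulrA; apply: (Rep_series yPhi yPsi compl haar (fun m => (fR m).2)).
  by move=> n; rewrite -mulr_suml ler_wpM2r.
move=> t e e0.
have hki := conv_cintegrable yPhi yPsi compl haar t Lh Lk.
pose nrm := fine (norm1 mu (fun s => h s * k (t^-1 * s)%g)).
have nrm0 : 0 <= nrm by rewrite fine_ge0// norm1_ge0.
have n1 : 0 < 2 * nrm + 1 by rewrite ltr_wpDl// mulr_ge0.
have en : 0 < e / (2 * nrm + 1) by rewrite divr_gt0.
have [J hJ] := hk _ en; exists J => j Jj.
rewrite convE -cintegralZ//.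
have sumi : cintegrable mu (fun s => \sum_(0 <= m < j) ker_int h k p y E (kap m) t s).
  by apply: cintegrable_sum => m; exact: (fR m).1.
rewrite /ker_conv -cintegral_sum; last by move=> m; exact: (fR m).1.
have ui : cintegrable mu (fun s => u t * (h s * k (t^-1 * s)%g)) by exact: cintegrableZ.
rewrite -cintegralB//.
apply: le_lt_trans (cabs_cintegral_dom hki _ (ltW en) _) _.
- by case: (cintegrableB sumi ui).
- move=> s; have [Ks|nKs] := pselect (K s); last first.
    rewrite hK// !mul0r mulr0 subr0 big1 ?cabs0 ?mulr0// => m _.
    by rewrite /ker_int hK// !mul0r.
  have [i ip Ei] := cov s Ks.
  have single m : ker_int h k p y E (kap m) t s =
      h s * k (t^-1 * s)%g * kap m (s * y i)%g (t^-1 * s * y i)%g.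
    rewrite /ker_int (bigD1 (Ordinal ip))//= indic_mem// mul1r big1 ?addr0// => l li.
    rewrite indic_nmem ?mul0r// => El; move/eqP : li; apply; apply: val_inj.
    exact: disjE El Ei.
  rewrite (eq_bigr _ (fun m _ => single m)) -mulr_sumr [u t * _]mulrC -mulrBr [leLHS]cabsM [leLHS]mulrC.
  apply: ler_wpM2r; first exact: cabs_ge0.
  have := hJ j Jj (s * y i)%g (t^-1 * s * y i)%g (ED _ _ Ei).
  have -> : (s * y i * (t^-1 * s * y i)^-1 = t)%g.
    by rewrite !invgM invgK mulgA mulgA mulgK mulgV mul1g.
  exact: ltW.
- rewrite -/nrm (_ : 2 * _ * nrm = (2 * nrm) * e / (2 * nrm + 1)).
    by rewrite ltr_pdivrMr// mulrC ltr_pM2l// ltrDl.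
  by field; rewrite gt_eqF.
Qed.

End Multipliers.

(** * Minimal ideals in algebras of functions *)

Section Ideals.
Context {R : realType} {G : topologicalGroupType}.
Local Notation C := R[i].
Implicit Types (B M I : set (G -> C)).

Lemma discrete_of_isolated (x : G) : open [set x] -> discrete_space G.
Proof.
move=> ox A; rewrite (_ : A = \bigcup_(y in A) [set y]); last first.
  by apply/seteqP; split=> [y Ay|y [z Az ->]//]; exists y.
apply: bigcup_open => y _; rewrite (_ : [set y] = [set t | [set x] (x * y^-1 * t)%g]).
  exact: open_preimage_mulgl.
apply/seteqP; split=> [t -> /=|t /= h]; first by rewrite mulgVK.
by apply: (@mulgI _ (x * y^-1)%g); rewrite h mulgVK.
Qed.

Lemma chi_line_minimal B (x : G) : (forall k : C, B (fun t => k * \1_[set x] t)) ->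
  minimal_ideal B (chi_line x).
Proof.
move=> Bx; split.
- split.
  + by move=> _ [k _ <-].
  + by exists 0 => //; apply/funext => t; rewrite mul0r.
  + move=> _ _ [k _ <-] [l _ <-]; exists (k + l) => //.
    by apply/funext => t; rewrite mulrDl.
  + move=> k _ [l _ <-]; exists (k * l) => //.
    by apply/funext => t; rewrite mulrA.
  + move=> b _ _ [l _ <-]; exists (b x * l) => //; apply/funext => t.
    have [->|tx] := pselect (t = x); first by rewrite mulrA.
    by rewrite indic_nmem// !mulr0.
- apply/eqP => h; have : (fun t => 1 * \1_[set x] t) = (fun=> 0) :> (G -> C).
    have : chi_line x ((fun t => 1 * \1_[set x] t) : G -> C) by exists 1.
    by rewrite h.
  by move/(congr1 (fun f => f x)); rewrite indic_mem// mulr1 => /eqP; rewrite oner_eq0.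
- move=> I [IB I0 ID IZ IM] Ix.
  have [[u Iu u0]|nI] := pselect (exists2 u, I u & u != (fun=> 0)).
    right; apply/seteqP; split=> // _ [k _ <-].
    have [l _ ul] := Ix u Iu.
    have l0 : l != 0.
      by apply: contraNneq u0 => l0; rewrite -ul l0; apply/eqP/funext => t; rewrite mul0r.
    have := IZ (k / l) u Iu; rewrite -ul.
    rewrite (_ : (fun t => _) = (fun t => k * \1_[set x] t))//.
    by apply/funext => t; rewrite mulrA divfK.
  left; apply/seteqP; split=> [u Iu|_ ->//].
  by apply: contrapT => u0; apply: nI; exists u => //; apply/eqP.
Qed.

(** Take [u] in [M] with [u x != 0].  The members of [M] vanishing at [x] form an ideal
without [u], so they are all zero; if [u y != 0] for some [y <> x], multiplying [u] by an
element of [B] that separates [x] from [y] would contradict this.  So [u] lives at [x]; the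
members of [M] that live at [x] are an ideal containing [u], hence all of [M]. *)
Lemma minimal_ideal_chi_line B M :
  (forall u, B u -> continuous (u : G -> C^o)) ->
  (forall x y : G, x <> y -> exists2 b, B b & b x = 0 /\ b y != 0) ->
  minimal_ideal B M -> discrete_space G /\ exists x : G, M = chi_line x.
Proof.
move=> Bcont Bsep [[MB M0 MD MZ MM] Mn0 minM].
have [u [x [Mu ux]]] : exists u x, M u /\ u x != 0.
  apply: contrapT => h; move/eqP : Mn0; apply; apply/seteqP; split=> [u Mu|_ ->//].
  apply/funext => x; apply: contrapT => /eqP ux; apply: h; exists u, x; split=> //.
have sub_ideal (P : set G) : ideal B (M `&` [set v | forall z, P z -> v z = 0]).
  split.
  + by move=> v [/MB].
  + by split.
  + by move=> v w [Mv hv] [Mw hw]; split; [exact: MD|move=> z Pz; rewrite hv// hw// addr0].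
  + by move=> k v [Mv hv]; split; [exact: MZ|move=> z Pz; rewrite hv// mulr0].
  + by move=> b v Bb [Mv hv]; split; [exact: MM|move=> z Pz; rewrite hv// mulr0].
have uy y : y <> x -> u y = 0.
  move=> yx; apply: contrapT => /eqP uy.
  have [b Bb [bx by0]] := Bsep x y (fun h => yx (esym h)).
  have [|h|h] := minM _ (sub_ideal [set x]); first by move=> v [].
  - have : zero_ideal (fun t => b t * u t).
      by rewrite -h; split; [exact: MM|move=> _ ->; rewrite bx mul0r].
    by move/(congr1 (fun f => f y)) => /eqP; rewrite mulf_eq0 (negbTE by0) (negbTE uy).
  - have : M u by []; rewrite -h => -[_ /(_ x erefl)] /eqP.
    by rewrite (negbTE ux).
have MxE : M = chi_line x.
  have [|h|h] := minM _ (sub_ideal [set y | y <> x]); first by move=> v [].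
  - have : zero_ideal u by rewrite -h.
    by move/(congr1 (fun f => f x)) => /eqP; rewrite (negbTE ux).
  - apply/seteqP; split=> [v|_ [k _ <-]].
      rewrite -h => -[Mv vz]; exists (v x) => //; apply/funext => t.
      have [->|tx] := pselect (t = x); first by rewrite indic_mem// mulr1.
      by rewrite indic_nmem// mulr0 vz.
    rewrite (_ : (fun t => _) = (fun t => k / u x * u t)); first exact: MZ.
    apply/funext => t; have [->|tx] := pselect (t = x); first by rewrite indic_mem// mulr1 divfK.
    by rewrite indic_nmem// (uy t tx) !mulr0.
split; last by exists x.
apply: (@discrete_of_isolated x); rewrite openE => _ ->.
have ux0 : 0 < cabs (u x).
  rewrite lt_neqAle cabs_ge0 andbT eq_sym; apply: contra ux => /eqP h.
  by apply/eqP/cabs0_eq0.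
have /cabs_continuousE/(_ x _ ux0) := Bcont u (MB _ Mu).
apply: filterS => t; apply: contraPP => tx; rewrite uy// sub0r cabsN.
by rewrite ltxx.
Qed.

Lemma minimal_ideals_of B :
  (forall u, B u -> continuous (u : G -> C^o)) ->
  (forall x y : G, x <> y -> exists2 b, B b & b x = 0 /\ b y != 0) ->
  (discrete_space G -> forall (x : G) (k : C), B (fun t => k * \1_[set x] t)) ->
  (forall M, M `<=` B -> (minimal_ideal B M <->
     discrete_space G /\ exists x : G, M = chi_line x)) /\
  ((exists M, minimal_ideal B M) <-> discrete_space G).
Proof.
move=> Bcont Bsep Bchi; split=> [M _|]; split.
- exact: minimal_ideal_chi_line.
- by move=> [dG [x ->]]; apply: chi_line_minimal; exact: Bchi.
- by move=> [M /minimal_ideal_chi_line[]].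
- by move=> dG; exists (chi_line 1%g); apply: chi_line_minimal; exact: Bchi.
Qed.

End Ideals.

(** * Coefficient functions are multipliers *)

Section AllMultipliers.
Context {R : realType} {G : topologicalGroupType}.
Variable mu : {measure set (borel G) -> \bar R}.
Variables Phi Psi : R -> \bar R.
Hypothesis yPhi : young_function Phi.
Hypothesis yPsi : young_function Psi.
Hypothesis compl : Psi = complementary Phi.
Hypothesis hG : hausdorff_space G.
Hypothesis lcG : locally_compact [set: G].
Hypothesis haar : left_haar_measure mu.
Hypothesis delta2 : ~ compact [set: G] -> Delta2_from 0 Phi.
Local Notation C := R[i].
Local Notation LPhi := (LOrlicz mu Phi).
Local Notation LPsi := (LOrlicz mu Psi).
Local Notation N := (Nphi mu Phi).
Local Notation O := (Opsi mu Phi).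
Local Notation conv := (Defs.conv mu).
Local Notation Rep := (Rep mu Phi Psi).

Lemma Nphi_tight_Delta2 (h : G -> C) (e : R) : LPhi h -> 0 < e ->
  exists2 K : set G, compact K & N (fun t => h t * \1_(~` K) t) <= e.
Proof.
move=> Lh e0; have [cG|ncG] := pselect (compact [set: G]); last first.
  by apply: Nphi_tight => //; [rewrite -compl|exact: delta2].
exists setT => //.
rewrite (_ : (fun t => _) = (fun=> 0)); first by rewrite Nphi0// ltW.
by apply/funext => t; rewrite indic_nmem ?mulr0// => /(_ I).
Qed.

(** [h] is the sum of compactly supported pieces, cut off successively by sets [K_ j]
chosen so that the remainders decrease geometrically; the slack [d] pays for all pieces
but the first. *)
Lemma multiplier (f g : G -> C) : Cc f -> Cc g ->
  exists2 B : R, 0 <= B & forall (h k : G -> C) (d : R), LPhi h -> LPsi k ->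
    0 < d -> Rep (B * (N h * O k) + d)
      (fun t => conv f (check g) t * conv h (check k) t).
Proof.
move=> Cf Cg; set u := conv f (check g).
have [B B0 hB] := multiplier_compact yPhi yPsi compl hG lcG haar Cf Cg.
exists B => // h k d Lh Lk d0.
have O0 : 0 <= O k by exact: Opsi_ge0.
pose den := 2 * (B * O k) + 1.
have den0 : 0 < den by rewrite ltr_wpDl// !mulr_ge0.
pose eta := d / den.
have eta0 : 0 < eta by rewrite divr_gt0.
have eta_h m : 0 < eta * halfpow m :> R by rewrite mulr_gt0// halfpow_gt0.
have tight m : exists K : set G, compact K /\
    N (fun t => h t * \1_(~` K) t) <= eta * halfpow m.
  by have [K cK KN] := Nphi_tight_Delta2 Lh (eta_h m); exists K.
have [K_ hK] := choice tight.
have mK m : measurable (K_ m : set (borel G)).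
  by apply: borel_compact => //; case: (hK m).
have mKC m : cmeasurable (\1_(~` K_ m) : G -> C).
  by apply: cmeasurable_indic; exact: measurableC.
have mKI m : cmeasurable (\1_(K_ m) : G -> C) by exact: cmeasurable_indic.
pose fix rem j : G -> C :=
  if j is j'.+1 then (fun t => rem j' t * \1_(~` K_ j') t) else h.
have Lrem j : LPhi (rem j).
  elim: j => [|j ih] //=; exact: (LOrlicz_mul yPhi ih (mKC j) (fun t => cabs_indic _ t)).
have rem_le j t : cabs (rem j t) <= cabs (h t).
  elim: j => [|j ih] //=; rewrite cabsM -[leRHS]mulr1.
  by apply: ler_pM; rewrite ?cabs_ge0 ?cabs_indic.
have Nrem j : N (rem j.+1) <= eta * halfpow j.
  have [_ hN] := hK j; apply: le_trans hN.
  rewrite -[leRHS]mul1r; apply: (Nphi_dom yPhi) => //.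
  - exact: (LOrlicz_mul yPhi Lh (mKC j) (fun t => cabs_indic _ t)).
  - by case: (Lrem j.+1).
  - by move=> t; rewrite mul1r /= !cabsM ler_wpM2r ?cabs_ge0.
pose piece j t := rem j t * \1_(K_ j) t.
have Lpiece j : LPhi (piece j).
  exact: (LOrlicz_mul yPhi (Lrem j) (mKI j) (fun t => cabs_indic _ t)).
have Npiece j : N (piece j) <= N (rem j).
  rewrite -[leRHS]mul1r.
  exact: (Nphi_mul yPhi (Lrem j) (mKI j) (fun t => cabs_indic _ t)).
have conv_rem j t : conv (rem j) (check k) t =
    conv (piece j) (check k) t + conv (rem j.+1) (check k) t.
  rewrite !convE -cintegralD; [|exact: (conv_cintegrable yPhi yPsi compl haar)..].
  apply: eq_cintegral => s; rewrite /piece /= -mulrDl -mulrDr.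
  have [Ks|nKs] := pselect (K_ j s).
    by rewrite indic_mem// indic_nmem ?addr0 ?mulr1// => /(_ Ks).
  by rewrite indic_nmem// indic_mem// add0r mulr1.
pose c j := if j is j'.+1 then B * (eta * halfpow j' * O k) else B * (N h * O k).
apply: (@Rep_series _ _ mu Phi Psi yPhi yPsi compl haar c _
  (fun j t => u t * conv (piece j) (check k) t)).
- move=> j; apply: Rep_le (hB (piece j) k (K_ j) (Lpiece j) Lk _ _).
  + rewrite /c; case: j => [|j]; apply: ler_wpM2l => //; apply: ler_wpM2r => //.
    exact: le_trans (Npiece _) (Nrem _).
  + by case: (hK j).
  + by move=> t nKt; rewrite /piece indic_nmem// mulr0.
- case=> [|j].
    by rewrite big_nil addr_ge0 ?(ltW d0)// !mulr_ge0 ?Nphi_ge0.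
  rewrite big_nat_recl//= lerD2l.
  rewrite (eq_bigr (fun i => B * eta * O k * halfpow i)); last by move=> i _; ring.
  rewrite -mulr_sumr.
  apply: (@le_trans _ _ (B * eta * O k * 2)).
    apply: ler_wpM2l; last exact: sum_halfpow.
    by rewrite mulr_ge0// mulr_ge0// ltW.
  rewrite (_ : B * eta * O k * 2 = (2 * (B * O k)) * d / den).
    by rewrite ler_pdivrMr// mulrC ler_pM2l// lerDl.
  by rewrite /eta; ring.
- move=> t e e0.
  have K0 : 0 <= cabs (u t) * (2 * (eta * O k)).
    apply: mulr_ge0; first exact: cabs_ge0.
    by rewrite mulr_ge0// mulr_ge0// ltW.
  have [J hJ] := halfpow_small K0 e0.
  exists J.+1 => -[//|j] Jj.
  have -> : \sum_(0 <= i < j.+1) u t * conv (piece i) (check k) t =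
      u t * (conv h (check k) t - conv (rem j.+1) (check k) t).
    elim: {Jj} j.+1 => [|m ih].
      by rewrite big_nil subrr mulr0.
    rewrite big_nat_recr// ih [conv (rem m) _ _]conv_rem /=; ring.
  rewrite (_ : _ - _ = - (u t * conv (rem j.+1) (check k) t)); last by ring.
  rewrite cabsN cabsM; apply: le_lt_trans (hJ j Jj).
  rewrite -mulrA; apply: ler_wpM2l; first exact: cabs_ge0.
  apply: le_trans (cabs_conv yPhi yPsi compl haar t (Lrem _) Lk) _.
  rewrite -mulrA ler_pM2l// [leRHS]mulrAC; apply: ler_wpM2r => //.
Qed.

(** Termwise multiplication, with slack [2^-n] for the [n]-th term of the series. *)
Lemma Cc_conv_B (f g : G -> C) : Cc f -> Cc g ->
  B_Phi mu Phi Psi (conv f (check g)).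
Proof.
move=> Cf Cg; have cu := Cc_conv_continuous hG haar Cf Cg.
set u := conv f (check g) in cu *; split; first exact: cu.
move=> v Av.
have [cv [c [h [k [Lh Lk hkc hkv]]]]] := (A_PhiP mu yPhi yPsi compl v).1 Av.
apply: (A_PhiP mu yPhi yPsi compl _).2; split.
  move=> t; exact: (@cvgM _ _ _ _ (u : G -> C^o) (v : G -> C^o) _ _ (cu t) (cv t)).
have [B B0 hB] := multiplier Cf Cg.
exists (B * c + 2).
apply: (@Rep_series _ _ mu Phi Psi yPhi yPsi compl haar
  (fun n => B * (N (h n) * O (k n)) + halfpow n) _
  (fun n t => u t * conv (h n) (check (k n)) t)).
- by move=> n; apply: hB => //; exact: halfpow_gt0.
- move=> n; rewrite big_split /= -mulr_sumr.
  by apply: lerD; [rewrite ler_wpM2l|exact: sum_halfpow].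
- move=> t e e0; have u1 : 0 < cabs (u t) + 1 by rewrite ltr_wpDl ?cabs_ge0.
  have [J hJ] := hkv t _ (divr_gt0 e0 u1); exists J => j /hJ.
  rewrite -mulr_sumr -mulrBr cabsM ltr_pdivlMr//.
  by apply: le_lt_trans; rewrite mulrC ler_wpM2l ?cabs_ge0// lerDl.
Qed.

End AllMultipliers.

(** * Minimal ideals of the three algebras *)

Theorem corollary4p9 (R : realType) (G : topologicalGroupType)
    (mu : {measure set (borel G) -> \bar R}) (Phi Psi : R -> \bar R)
    (B : set (G -> R[i])) :
  hausdorff_space G -> locally_compact [set: G] -> left_haar_measure mu ->
  young_function Phi -> young_function Psi -> Psi = complementary Phi ->
  Delta2 G Phi -> Delta2 G Psi ->
  B = A_Phi mu Phi Psi \/ B = W_Phi mu Phi Psi \/ B = B_Phi mu Phi Psi ->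
  (forall M, M `<=` B ->
     (minimal_ideal B M <->
      discrete_space G /\ exists x : G, M = chi_line x)) /\
  ((exists M, minimal_ideal B M) <-> discrete_space G).
Proof.
move=> hG lcG haar yPhi yPsi compl [_ d2Phi] _ BE.
have Bcont u : B u -> continuous (u : G -> R[i]^o).
  by case: BE => [->|[->|->]] [].
have Bconv f g : Cc f -> Cc g -> B (Defs.conv mu f (check g)).
  move=> Cf Cg; case: BE => [->|[->|->]].
  - exact: (Cc_conv_A yPhi yPsi compl hG haar Cf Cg).
  - exact: (Cc_conv_W yPhi yPsi compl hG haar Cf Cg).
  - exact: (Cc_conv_B yPhi yPsi compl hG lcG haar d2Phi Cf Cg).
apply: minimal_ideals_of => //.
- move=> x y xy.
  have nU : nbhs y (~` [set x]).
    apply: open_nbhs_nbhs; split; last by move=> /= yx; exact: xy.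
    apply: closed_openC; apply: accessible_closed_set1.
    exact: hausdorff_accessible.
  have [f [g [Cf Cg uy uU]]] := Cc_conv_separates hG lcG haar nU.
  exists (Defs.conv mu f (check g)); first exact: Bconv.
  by split=> //; apply: uU => /(_ erefl).
- move=> dG x k.
  have nU : nbhs x [set x] by apply: open_nbhs_nbhs; split.
  have [f [g [Cf Cg ux uU]]] := Cc_conv_separates hG lcG haar nU.
  have := Bconv _ _ (Cc_Z (k / Defs.conv mu f (check g) x) Cf) Cg.
  congr B; apply/funext => t.
  rewrite (convZl yPhi yPsi compl haar); last 2 first.
  - exact: (Cc_LPhi yPhi yPsi compl hG haar Cf).
  - exact: (Cc_LPsi yPhi yPsi compl hG haar Cg).
  have [->|tx] := pselect (t = x); first by rewrite indic_mem// mulr1 divfK.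
  by rewrite indic_nmem// (uU t tx) !mulr0.
Qed.
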